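(* Let $A=\mathbb{Q}[[q]][q^{-1},\lambda^{\pm1}]$. After specializing $\pi=-1$, the functors $\mathsf F=\bigoplus_{k\ge0}\mathsf F_k$ and $\mathsf E=\bigoplus_{k\ge0}\mathsf E_k$ (with $K$ acting on the $k$-th summand through the shift $\langle -2k-1,1\rangle$, i.e. as multiplication by $\lambda q^{-1-2k}$) induce an action of quantum $\mathfrak{sl}_2$ on the Grothendieck groups $K_0(\mathcal M)$, $G_0(\mathcal M)$ and $\widehat G_0(\mathcal M)$. With this action there are $A$-linear isomorphisms $$K_0(\mathcal M)\cong M_A(\lambda q^{-1}),\qquad G_0(\mathcal M)\cong M_A^*(\lambda q^{-1})$$ of $\dot U_\lambda$-modules, and a $\mathbb{Q}((q,\lambda))$-linear isomorphism $$\widehat G_0(\mathcal M)\cong M(\lambda q^{-1})$$ of $U_q(\mathfrak{sl}_2)$-representations. Moreover these isomorphisms send the classes of the indecomposable projectives to canonical basis elements, $[\Omega_k]\mapsto m_k$ (for $K_0(\mathcal M)$ and $\widehat G_0(\mathcal M)$), and the classes of simples to dual canonical basis elements, $[S_k]\mapsto m^k$ (for $G_0(\mathcal M)$ and $\widehat G_0(\mathcal M)$).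
   Context: **Superrings.** All objects are $\mathbb Z\times\mathbb Z$-graded (first the $q$-grading, second the $\lambda$-grading) and $\mathbb Z/2$-graded (parity $p$). $\langle r,s\rangle$ shifts the $q$-degree up by $r$ and the $\lambda$-degree up by $s$. $\Pi$ is the parity shift of supermodules: $\Pi M=\{\pi(m)\}$ with left action $r\cdot\pi(m)=(-1)^{p(r)}\pi(r m)$ and unchanged right action. For $k\ge 0$, $$\Omega_k=\mathbb{Q}[x_{1,k},\dots,x_{k,k}]\otimes\Lambda(s_{1,k},\dots,s_{k,k}),\quad \Omega_{k,k+1}=\mathbb{Q}[x_{1,k},\dots,x_{k,k},\xi_{k+1}]\otimes\Lambda(s_{1,k+1},\dots,s_{k+1,k+1}),$$ with $x_{i,k}$ even of degree $(2i,0)$, $\xi_{k+1}$ even of degree $(2,0)$, $s_{i,k}$ and $s_{i,k+1}$ odd of degree $(-2i,2)$. $\Omega_{k,k+1}$ is an $\Omega_k$-algebra via $x_{i,k}\mapsto x_{i,k}$, $s_{i,k}\mapsto s_{i,k+1}+\xi_{k+1}s_{i+1,k+1}$, and an $\Omega_{k+1}$-algebra via $x_{i,k+1}\mapsto x_{i,k}+\xi_{k+1}x_{i-1,k}$ (with $x_{0,k}=1$, $x_{k+1,k}=0$), $s_{i,k+1}\mapsto s_{i,k+1}$. It is thus an $(\Omega_k,\Omega_{k+1})$-superbimodule; as an $(\Omega_{k+1},\Omega_k)$-superbimodule it is denoted $\Omega_{k+1,k}$. $S_k=\mathbb{Q}$ is the simple $\Omega_k$-supermodule (unique up to isomorphism,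 grading and parity shift). **Laurent series.** Order $\mathbb Z^2$ lexicographically with $\lambda$ dominant, i.e. $(a,b)\succ 0$ iff $b>0$, or $b=0$ and $a>0$ (written $0\prec q\prec\lambda$). A compatible cone is a set $C=\{\alpha_1v_1+\alpha_2v_2:\alpha_i\ge0\}\subset\mathbb R^2$ with $v_i\in\mathbb Z^2$, $v_i\succ 0$. For a coefficient ring $R$, $R((q,\lambda))$ consists of the formal series in $q^{\pm1},\lambda^{\pm1}$ with coefficients in $R$ whose support lies in a translate (by an element of $\mathbb Z^2$) of $C\cap\mathbb Z^2$ for some compatible cone $C$. Rational functions are expanded in $\mathbb Q((q,\lambda))$ (and $\mathbb Q(q)\subset\mathbb Q[[q]][q^{-1}]$ by expansion at $q=0$). **Categories.** $\Omega_k$-$\mathrm{smod}_{lf}$ is the category of bigraded left $\Omega_k$-supermodules that are finite-dimensional in each degree and cone bounded (their support lies in a translate of a compatible cone), with grading preserving maps. $\Omega_k$-$\mathrm{smod}^{\lambda}_{lf}$ is the full subcategory of those with $\lambda$-grading bounded above and below, and $\Omega_k$-$\mathrm{psmod}^\lambda$ the full subcategory of the latter consisting of the projective modules (they are direct sums of shifts of $\Omega_k$ and $\Pi\Omega_k$). **Grothendieck groups.** Let $\mathbb Z_\pi=\mathbb Z[\pi]/(\pi^2-1)$; $q,\lambda,\pi$ act by $\langle1,0\rangle,\langle0,1\rangle,\Pi$. The topological Grothendieck group of $\Omega_k$-$\mathrm{smod}_{lf}$ (resp. of $\Omega_k$-$\mathrm{smod}^\lambda_{lf}$) is the quotient of the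 usual Grothendieck group (of short exact sequences) by the kernel of the map sending $[M]$ to its series of multiplicities of shifts of the simple $S_k$; it is a module over $\mathbb Z_\pi((q,\lambda))$ (resp. over $\mathbb Z_\pi[[q]][q^{-1},\lambda^{\pm1}]$). The topological split Grothendieck group of $\Omega_k$-$\mathrm{psmod}^\lambda$ is the quotient of the usual split Grothendieck group by the kernel of the map recording the multiplicities of shifts of $\Omega_k$; it is a module over $\mathbb Z_\pi[[q]][q^{-1},\lambda^{\pm1}]$. Denote these by $\widehat G_0(\mathcal M_k)$, $G_0(\mathcal M_k)$, $K_0(\mathcal M_k)$ respectively, and let $\widehat G_0(\mathcal M)$, $G_0(\mathcal M)$, $K_0(\mathcal M)$ be the direct sums over $k\ge0$ of these modules, with scalars extended to $\mathbb{Q}$ and with $\pi$ set to $-1$, so that $\widehat G_0(\mathcal M)$ is a $\mathbb{Q}((q,\lambda))$-vector space and the other two are $A$-modules. **Functors.** $\mathsf F_k(M)=\Omega_{k+1,k}\otimes_{\Omega_k}M\,\langle -k,0\rangle$ (an $\Omega_{k+1}$-supermodule) and $\mathsf E_k(M)=\Omega_{k,k+1}\otimes_{\Omega_{k+1}}M\,\langle k+2,-1\rangle$ (an $\Omega_k$-supermodule). They are exact and preserve projectives, and act on the Grothendieck groups. **Quantum $\mathfrak{sl}_2$.** $U_q(\mathfrak{sl}_2)$ is the $\mathbb{Q}(q)$-algebra generated by $E,F,K^{\pm1}$ with $KE=q^2EK$, $KF=q^{-2}FK$, $EF-FE=\frac{K-K^{-1}}{q-q^{-1}}$. $\dot U_\lambda$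 is its idempotented version over $\mathbb{Q}(q)[\lambda^{\pm1}]$, with orthogonal idempotents $e_n$ ($n\in\mathbb Z$) satisfying $Ke_n=e_nK=\lambda q^ne_n$, $Ee_n=e_{n+2}E$, $Fe_n=e_{n-2}F$, $EFe_n-FEe_n=\frac{\lambda q^n-\lambda^{-1}q^{-n}}{q-q^{-1}}e_n$; $e_n$ acts as the projection onto the $\lambda q^n$-weight space. Write $[a]=\frac{q^a-q^{-a}}{q-q^{-1}}$. For $\mu=\lambda q^{c}$, $c\in\mathbb Z$, the Verma module $M(\mu)$ is the $\mathbb{Q}((q,\lambda))$-vector space with canonical basis $m_0,m_1,\dots$ and action $$Km_i=\mu q^{-2i}m_i,\quad Fm_i=[i+1]m_{i+1},\quad Em_i=\tfrac{\mu q^{1-i}-\mu^{-1}q^{i-1}}{q-q^{-1}}m_{i-1}\ (Em_0=0).$$ The dual canonical basis is $$m^k=\Bigl(\prod_{s=1}^k\frac{[s]\,(q-q^{-1})}{\mu q^{1-2s}(\mu q^{1-s}-\mu^{-1}q^{s-1})}\Bigr)m_k,$$ so that $Km^k=\mu q^{-2k}m^k$, $Em^k=[k]\mu^{-1}q^{2k-1}m^{k-1}$, $Fm^k=\frac{\mu q^{-k}-\mu^{-1}q^k}{q-q^{-1}}\mu q^{-2k-1}m^{k+1}$. $M_A(\mu)$ and $M_A^*(\mu)$ are the $A$-spans of $\{m_k\}$ and of $\{m^k\}$ respectively, which are $\dot U_\lambda$-modules. *)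

(* Defs.v *)
From HB Require Import structures.
From mathcomp Require Import all_boot all_order all_algebra.
From mathcomp Require Import boolp classical_sets.
From mathcomp Require Import freeg mpoly zify ring.
From mathcomp Require Import finset.
Set Implicit Arguments.
Unset Strict Implicit.
Unset Printing Implicit Defensive.
Import Order.TTheory GRing.Theory Num.Theory.
Local Open Scope ring_scope.

(* Bidegrees: first component the q-degree, second the lambda-degree.         *)
Notation bideg := (int * int)%type.

Definition succ0 (v : bideg) : bool :=
  (0 < v.2) || ((v.2 == 0) && (0 < v.1)).

(* C /\ Z^2 for the cone C spanned by v1 and v2; a lattice point with         *)
(* nonnegative real coordinates on v1, v2 also has nonnegative rational ones. *)
Definition in_cone (v1 v2 d : bideg) : Prop :=
  exists a b : rat, [/\ 0 <= a, 0 <= b,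
    d.1%:~R = a * v1.1%:~R + b * v2.1%:~R &
    d.2%:~R = a * v1.2%:~R + b * v2.2%:~R].

Definition cone_bounded (P : bideg -> Prop) : Prop :=
  exists v1 v2 t : bideg, [/\ succ0 v1, succ0 v2 &
    forall d, P d -> in_cone v1 v2 (d - t)].

Definition lambda_bounded (P : bideg -> Prop) : Prop :=
  exists B : int, forall d, P d -> `|d.2| <= B.

Section ConeNormalForm.

Definition bnd (N : int) (d : bideg) : bool :=
  (- N <= d.2) && (- N - N * (d.2 + N) <= d.1).

Lemma bnd_add N M d e : 0 <= N -> 0 <= M ->
  bnd N d -> bnd M e -> bnd (N + M) (d + e).
Proof.
move=> N0 M0 /andP[d2 d1] /andP[e2 e1]; apply/andP; split=> /=; first lia.
nia.
Qed.

Lemma bnd_le N M d : 0 <= N -> N <= M -> bnd N d -> bnd M d.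
Proof.
move=> N0 NM /andP[d2 d1]; apply/andP; split; first lia.
nia.
Qed.

Lemma cone_bndP (P : bideg -> Prop) : cone_bounded P <->
  exists N : int, 0 <= N /\ forall d, P d -> bnd N d.
Proof.
split=> [[v1 [v2 [t [p1 p2 Pt]]]]|[N [N0 PN]]]; last first.
  exists (1, 0), (- N, 1), (- N, - N); split=> // d /PN /andP[d2 d1].
  exists (d.1 + N + N * (d.2 + N))%:~R, (d.2 + N)%:~R; split=> /=.
  - by rewrite ler0z; lia.
  - by rewrite ler0z; lia.
  - by rewrite -!intrM -!intrD; congr (_%:~R); ring.
  - by rewrite -!intrM -!intrD; congr (_%:~R); ring.
pose M := `|v1.1| + `|v2.1|.
have key v : succ0 v -> `|v.1| <= M -> 0 <= v.2 /\ 0 <= v.1 + M * v.2.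
  rewrite /succ0 => /orP[v0|/andP[/eqP-> v0]] vM; last by split; lia.
  by split; [lia|nia].
have [|a0 a1] := key v1 p1; first by rewrite /M; lia.
have [|b0 b1] := key v2 p2; first by rewrite /M; lia.
exists (M + `|t.1| + `|t.2|); split; first by rewrite /M; lia.
move=> d /Pt[a [b [ha hb e1 e2]]].
have h2 : 0 <= d.2 - t.2.
  rewrite -(ler0z rat) e2 addr_ge0// mulr_ge0// ?ler0z//.
have h1 : 0 <= (d.1 - t.1) + M * (d.2 - t.2).
  rewrite -(ler0z rat) intrD intrM e2 e1.
  have -> : a * v1.1%:~R + b * v2.1%:~R + M%:~R * (a * v1.2%:~R + b * v2.2%:~R)
     = a * (v1.1 + M * v1.2)%:~R + b * (v2.1 + M * v2.2)%:~R :> rat.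
    by rewrite !intrD !intrM; ring.
  by rewrite addr_ge0// mulr_ge0// ler0z.
have M0 : 0 <= M by rewrite /M; lia.
by apply/andP; split; [lia|nia].
Qed.

End ConeNormalForm.

(* laurent false R is R((q,lambda)); laurent true R is the subring            *)
(* R[[q]][q^-1, lambda^{+-1}] of series whose lambda-degree is bounded above  *)
(* and below (cone boundedness then only bounds the q-degree from below).     *)
Definition laurent_supp (b : bool) (P : bideg -> Prop) : Prop :=
  cone_bounded P /\ (b -> lambda_bounded P).

Record laurent (b : bool) (R : zmodType) := Laurent {
  lcoef :> bideg -> R;
  lcoefP : laurent_supp b (fun d => lcoef d <> 0) }.

HB.instance Definition _ b R := gen_eqMixin (laurent b R).
HB.instance Definition _ b R := gen_choiceMixin (laurent b R).

Lemma laurent_eq b R (f g : laurent b R) : (forall d, f d = g d) -> f = g.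
Proof.
case: f g => f fP [g gP] /= /funext fg; case: g / fg gP => gP.
by congr Laurent; exact: Prop_irrelevance.
Qed.

Section LaurentSupport.

Lemma laurent_suppP b (P : bideg -> Prop) : laurent_supp b P <->
  exists N : int, 0 <= N /\ forall d, P d -> bnd N d && (b ==> (`|d.2| <= N)).
Proof.
split=> [[/cone_bndP[N [N0 PN]] lb]|[N [N0 PN]]]; last first.
  split; first by apply/cone_bndP; exists N; split=> // d /PN/andP[].
  by move=> bT; exists N => d /PN/andP[_]; rewrite bT.
case: b lb => [[//|B PB]|_]; last first.
  by exists N; split=> // d /PN ->.
exists (N + `|B|); split=> [|d Pd]; first lia.
apply/andP; split; first by apply: bnd_le (PN _ Pd); lia.
by have := PB d Pd; lia.
Qed.

Lemma laurent_supp_sub b (P Q : bideg -> Prop) :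
  (forall d, P d -> Q d) -> laurent_supp b Q -> laurent_supp b P.
Proof.
move=> PQ /laurent_suppP[N [N0 QN]]; apply/laurent_suppP.
by exists N; split=> // d /PQ/QN.
Qed.

Lemma laurent_suppU b (P Q : bideg -> Prop) :
  laurent_supp b P -> laurent_supp b Q -> laurent_supp b (fun d => P d \/ Q d).
Proof.
move=> /laurent_suppP[N [N0 PN]] /laurent_suppP[M [M0 QM]]; apply/laurent_suppP.
exists (N + M); split=> [|d [/PN|/QM] /andP[h1 h2]]; first lia.
  by rewrite (bnd_le _ _ h1)/=; [move/implyP: h2 => h2; apply/implyP => /h2|..]; lia.
by rewrite (bnd_le _ _ h1)/=; [move/implyP: h2 => h2; apply/implyP => /h2|..]; lia.
Qed.

Lemma laurent_supp_add b (P Q : bideg -> Prop) :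
  laurent_supp b P -> laurent_supp b Q ->
  laurent_supp b (fun d => exists e, P e /\ Q (d - e)).
Proof.
move=> /laurent_suppP[N [N0 PN]] /laurent_suppP[M [M0 QM]]; apply/laurent_suppP.
exists (N + M); split=> [|d [e [/PN/andP[h1 h2] /QM/andP[h3 h4]]]]; first lia.
rewrite -{1}(subrKC e d) bnd_add//=.
move/implyP: h2 => h2; move/implyP: h4 => h4; apply/implyP => bT.
by move: (h2 bT) (h4 bT) => /=; lia.
Qed.

Lemma laurent_supp0 b (P : bideg -> Prop) :
  (forall d, ~ P d) -> laurent_supp b P.
Proof. by move=> PF; apply/laurent_suppP; exists 0; split=> // d /PF. Qed.

Lemma laurent_supp1 b (d : bideg) : laurent_supp b (fun e => e = d).
Proof.
apply/laurent_suppP; exists (`|d.1| + `|d.2|); split=> [|e ->]; first lia.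
apply/andP; split; last by case: b => //=; lia.
apply/andP; split; [lia|nia].
Qed.

Lemma laurent_conv_fin b (P Q : bideg -> Prop) (d : bideg) :
  laurent_supp b P -> laurent_supp b Q ->
  exists2 s : seq bideg, uniq s & forall e, P e -> Q (d - e) -> e \in s.
Proof.
move=> /laurent_suppP[N [N0 PN]] /laurent_suppP[M [M0 QM]].
pose K := N + M + `|d.2|.
pose B := N + M + `|d.1| + `|d.2| + N * K + M * K.
pose r : seq int := [seq i%:Z - B | i <- iota 0 (absz (2 * B + 1))].
have memr (i : int) : - B <= i -> i <= B -> i \in r.
  move=> iB Bi; apply/mapP; exists (absz (i + B)); last by lia.
  by rewrite mem_iota; lia.
exists (undup [seq (i, j) | i <- r, j <- r]); first exact: undup_uniq.
move=> e /PN/andP[/andP[e2 e1] _] /QM/andP[/andP[/= f2 f1] _].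
have [hN hM] : 0 <= N * K /\ 0 <= M * K by split; apply: mulr_ge0; rewrite /K; lia.
have [g1 g2] : N * (e.2 + N) <= N * K /\ M * (d.2 - e.2 + M) <= M * K.
  by split; apply: ler_wpM2l => //; rewrite /K; lia.
rewrite mem_undup; apply/allpairsP; exists e; split; last by case: e {e1 e2 f1 f2 g1 g2}.
  move: g1 g2 f1 e1 hN hM => /=; rewrite /B.
  set p := N * (_ + _); set q := M * (_ + _); set p' := N * K; set q' := M * K.
  by move=> *; apply: memr; rewrite /B -/p' -/q'; lia.
by apply: memr; rewrite /B; move: hN hM f2 => /=; set p := N * K; set q := M * K; lia.
Qed.

End LaurentSupport.

Fact laurent_zero_supp b (R : zmodType) :
  laurent_supp b (fun d : bideg => (0 : R) <> 0).
Proof. by apply: laurent_supp0 => d; apply. Qed.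

(* The series with coefficients f, when f has an admissible support.          *)
Definition mk_laurent b (R : zmodType) (f : bideg -> R) : laurent b R :=
  if pselect (laurent_supp b (fun d => f d <> 0)) is left P then Laurent P
  else Laurent (laurent_zero_supp b R).

Section LaurentZmod.
Variables (b : bool) (R : zmodType).
Implicit Types f g : laurent b R.

Fact ladd_supp f g : laurent_supp b (fun d => f d + g d <> 0).
Proof.
apply: laurent_supp_sub (laurent_suppU (lcoefP f) (lcoefP g)) => d.
case: (eqVneq (f d) 0) => [->|/eqP]; last by left.
by rewrite add0r; right.
Qed.

Fact lopp_supp f : laurent_supp b (fun d => - f d <> 0).
Proof.
by apply: laurent_supp_sub (lcoefP f) => d h e; apply: h; rewrite e oppr0.
Qed.

Definition lzero := Laurent (laurent_zero_supp b R).
Definition ladd f g := Laurent (ladd_supp f g).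
Definition lopp f := Laurent (lopp_supp f).

Fact laddA : associative ladd.
Proof. by move=> f g h; apply: laurent_eq => d /=; rewrite addrA. Qed.
Fact laddC : commutative ladd.
Proof. by move=> f g; apply: laurent_eq => d /=; rewrite addrC. Qed.
Fact ladd0 : left_id lzero ladd.
Proof. by move=> f; apply: laurent_eq => d /=; rewrite add0r. Qed.
Fact laddN : left_inverse lzero lopp ladd.
Proof. by move=> f; apply: laurent_eq => d /=; rewrite addNr. Qed.

HB.instance Definition _ :=
  GRing.isZmodule.Build (laurent b R) laddA laddC ladd0 laddN.

End LaurentZmod.

Section LaurentRing.
Variables (b : bool) (R : comNzRingType).
Implicit Types f g h : laurent b R.

(* The convolution, summed over a finite set containing all nonzero terms.    *)
Definition lconv f g (d : bideg) : R :=
  \sum_(e <- s2val (cid2 (laurent_conv_fin d (lcoefP f) (lcoefP g))))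
    f e * g (d - e).

Lemma lconvE f g d (s : seq bideg) : uniq s ->
  (forall e, f e <> 0 -> g (d - e) <> 0 -> e \in s) ->
  lconv f g d = \sum_(e <- s) f e * g (d - e).
Proof.
move=> us fgs; rewrite /lconv; case: cid2 => t /= ut fgt.
have fg0 e : ~~ ((f e != 0) && (g (d - e) != 0)) -> f e * g (d - e) = 0.
  by rewrite negb_and !negbK => /orP[]/eqP->; rewrite ?mul0r ?mulr0.
pose P e := (f e != 0) && (g (d - e) != 0).
rewrite (bigID P) [RHS](bigID P) /= [X in _ + X]big1//.
rewrite [X in _ = _ + X]big1// !addr0 -!(big_filter _ P).
apply: perm_big; apply: uniq_perm; rewrite ?filter_uniq// => e.
rewrite !mem_filter /P; case: eqP => //= fe; case: eqP => //= ge.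
by rewrite fgt ?fgs.
Qed.

Lemma lconv_neq0 f g d :
  lconv f g d <> 0 -> exists e, f e <> 0 /\ g (d - e) <> 0.
Proof.
move=> h; apply: contrapT => nh; apply: h.
rewrite (lconvE (s := [::])) ?big_nil// => e fe ge.
by exfalso; apply: nh; exists e.
Qed.

Fact lmul_supp f g : laurent_supp b (fun d => lconv f g d <> 0).
Proof.
apply: laurent_supp_sub (laurent_supp_add (lcoefP f) (lcoefP g)) => d.
exact: lconv_neq0.
Qed.

Definition lmul f g := Laurent (lmul_supp f g).

Fact lmon_supp (c : bideg) :
  laurent_supp b (fun d => (d == c)%:R <> 0 :> R).
Proof.
by apply: laurent_supp_sub (laurent_supp1 b c) => d; case: eqP.
Qed.

(* The monomial q^c.1 lambda^c.2.                                             *)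
Definition lmon (c : bideg) : laurent b R := Laurent (lmon_supp c).

Fact lmulC : commutative lmul.
Proof.
move=> f g; apply: laurent_eq => d /=.
have [s us fs] := laurent_conv_fin d (lcoefP f) (lcoefP g).
rewrite (lconvE us fs) (lconvE (s := [seq d - e | e <- s])).
- by rewrite big_map; apply: eq_bigr => e _; rewrite subKr mulrC.
- by rewrite map_inj_uniq// => x y /(congr1 (fun z => d - z)); rewrite !subKr.
move=> e ge fe; apply/mapP; exists (d - e); last by rewrite subKr.
by apply: fs => //; rewrite subKr.
Qed.

Fact lmulA : associative lmul.
Proof.
move=> f g h; apply: laurent_eq => d.
have [s us fs] := laurent_conv_fin d (lcoefP f)
  (laurent_supp_add (lcoefP g) (lcoefP h)).
have [t ut ft] := laurent_conv_fin d
  (laurent_supp_add (lcoefP f) (lcoefP g)) (lcoefP h).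
have [r ur fr] : exists2 r : seq bideg, uniq r & forall a e, e \in t ->
    f a <> 0 -> g (e - a) <> 0 -> a \in r.
  elim: t {ut ft} => [|e t [r ur IH]]; first by exists [::].
  have [r' ur' fr'] := laurent_conv_fin e (lcoefP f) (lcoefP g).
  exists (undup (r' ++ r)) => [|a e']; first exact: undup_uniq.
  rewrite mem_undup mem_cat inE => /orP[/eqP->|et] fa ga.
    by rewrite fr'.
  by rewrite (IH _ _ et fa ga) orbT.
pose S := undup (s ++ r); have uS : uniq S := undup_uniq _.
rewrite /= (lconvE (s := S)) //; last first.
  by move=> e fe /lconv_neq0 ghe; rewrite mem_undup mem_cat fs.
rewrite (lconvE (s := t))//; last by move=> e /lconv_neq0 fge he; apply: ft.
transitivity (\sum_(a <- S) \sum_(e <- t) f a * g (e - a) * h (d - e)).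
  apply: eq_bigr => a _.
  case: (eqVneq (f a) 0) => [->|/eqP fa].
    by rewrite mul0r big1// => e _; rewrite !mul0r.
  rewrite /= (lconvE (s := [seq e - a | e <- t])).
  - rewrite big_map mulr_sumr; apply: eq_bigr => e _.
    by rewrite mulrA; congr (_ * h _); rewrite opprB addrA subrK.
  - by rewrite map_inj_uniq//; exact: addIr.
  move=> x gx hx; apply/mapP; exists (a + x); last by rewrite addrAC subrr add0r.
  apply: ft; last by rewrite opprD addrA.
  by exists a; rewrite addrAC subrr add0r.
rewrite exchange_big /=; apply: eq_big_seq => e et.
rewrite -mulr_suml; congr (_ * _); symmetry; apply: lconvE => // a fa ga.
by rewrite mem_undup mem_cat (fr a e) ?orbT.
Qed.

Fact lmul1 : left_id (lmon 0) lmul.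
Proof.
move=> f; apply: laurent_eq => d /=; rewrite (lconvE (s := [:: 0]))//.
  by rewrite big_seq1 /= mul1r subr0.
by move=> e /=; rewrite inE; case: eqP.
Qed.

Fact lmulDl : left_distributive lmul +%R.
Proof.
move=> f g h; apply: laurent_eq => d /=.
have [s _ fs] := laurent_conv_fin d (lcoefP f) (lcoefP h).
have [t _ ft] := laurent_conv_fin d (lcoefP g) (lcoefP h).
pose S := undup (s ++ t); have uS : uniq S := undup_uniq _.
have Sf e : f e <> 0 -> h (d - e) <> 0 -> e \in S.
  by move=> fe he; rewrite mem_undup mem_cat fs.
have Sg e : g e <> 0 -> h (d - e) <> 0 -> e \in S.
  by move=> ge he; rewrite mem_undup mem_cat ft ?orbT.
rewrite (lconvE uS Sf) (lconvE uS Sg) (lconvE uS).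
  by rewrite -big_split /=; apply: eq_bigr => e _; rewrite mulrDl.
move=> e /= fge he; case: (eqVneq (f e) 0) fge => [->|/eqP fe _].
  by rewrite add0r => ge; apply: Sg.
exact: Sf.
Qed.

Fact lone_neq0 : lmon 0 != 0.
Proof.
apply/eqP => e; have : lmon 0 0 = lzero b R 0 :> R by rewrite e.
by move=> /eqP; rewrite oner_eq0.
Qed.

HB.instance Definition _ := GRing.Zmodule_isComNzRing.Build (laurent b R)
  lmulA lmulC lmul1 lmulDl lone_neq0.

(* The inverse of an invertible series, chosen classically.                   *)
Definition lunit : {pred laurent b R} := fun f => `[< exists g, g * f = 1 >].
Definition linv f : laurent b R := xget f [set g | g * f = 1].

Fact lmulVf : {in lunit, left_inverse 1 linv *%R}.
Proof. by move=> f /asboolP[g gf]; rewrite /linv; case: xgetP => // /(_ g). Qed.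
Fact lunitP f g : g * f = 1 -> lunit f.
Proof. by move=> gf; apply/asboolP; exists g. Qed.
Fact linv_out : {in [predC lunit], linv =1 id}.
Proof.
move=> f /asboolP nf; rewrite /linv; case: xgetP => // g _ gf.
by exfalso; apply: nf; exists g.
Qed.

HB.instance Definition _ := GRing.ComNzRing_hasMulInverse.Build (laurent b R)
  lmulVf lunitP linv_out.

End LaurentRing.
Arguments lmon b R c : clear implicits.

(* The exterior algebra R (x) Lambda(s_1, ..., s_n): the coefficient of       *)
(* s_{j_1} ... s_{j_r}, j_1 < ... < j_r, is stored at the set {j_1, ..., j_r}. *)
Definition extalg (R : comNzRingType) (n : nat) : Type :=
  {ffun {set 'I_n} -> R}.

HB.instance Definition _ R n := GRing.Zmodule.on (extalg R n).

Section Exterior.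
Variables (R : comNzRingType) (n : nat).
Implicit Types (U V W : {set 'I_n}) (f g h : extalg R n).

Definition inversions V W : nat := \sum_(a in V) \sum_(b in W) (b < a)%N.

(* s_V s_W = ext_sign V W s_(V u W).                                          *)
Definition ext_sign V W : R :=
  if [disjoint V & W] then (-1) ^+ inversions V W else 0.

Definition ext_mul f g : extalg R n :=
  [ffun U => \sum_V \sum_(W | V :|: W == U) ext_sign V W * (f V * g W)].

Definition ext_const (c : R) : extalg R n :=
  [ffun U => if U == set0 then c else 0].

Definition ext_gen (j : 'I_n) : extalg R n := [ffun U => (U == [set j])%:R].

Lemma ext_sign0l W : ext_sign set0 W = 1.
Proof. by rewrite /ext_sign -setI_eq0 set0I eqxx /inversions big_set0. Qed.

Lemma ext_sign0r W : ext_sign W set0 = 1.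
Proof.
rewrite /ext_sign -setI_eq0 setI0 eqxx /inversions big1 ?expr0// => a _.
by rewrite big_set0.
Qed.

Lemma ext_signA U V W :
  ext_sign U V * ext_sign (U :|: V) W = ext_sign V W * ext_sign U (V :|: W).
Proof.
rewrite /ext_sign -!setI_eq0 setIUl setIUr !setU_eq0.
case: (eqVneq (U :&: V) set0) => UV; case: (eqVneq (U :&: W) set0) => UW;
  case: (eqVneq (V :&: W) set0) => VW; rewrite ?mulr0 ?mul0r//=.
have bU (A B : {set 'I_n}) (F : 'I_n -> nat) : A :&: B = set0 ->
    (\sum_(i in A :|: B) F i = \sum_(i in A) F i + \sum_(i in B) F i)%N.
  move=> /eqP; rewrite setI_eq0 => dAB; rewrite -bigU//=.
  by apply: eq_bigl => i; rewrite !inE.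
rewrite -!exprD; congr (_ ^+ _); rewrite /inversions (bU U V)//.
have -> : (\sum_(a in U) \sum_(b in V :|: W) (b < a) =
    \sum_(a in U) \sum_(b in V) (b < a) +
    \sum_(a in U) \sum_(b in W) (b < a))%N.
  by rewrite -big_split; apply: eq_bigr => a _; rewrite bU.
by lia.
Qed.

Lemma ext_mulE f g U : ext_mul f g U =
  \sum_V \sum_W (V :|: W == U)%:R * (ext_sign V W * (f V * g W)).
Proof.
rewrite ffunE; apply: eq_bigr => V _; rewrite big_mkcond; apply: eq_bigr => W _.
by case: eqP; rewrite ?mul1r ?mul0r.
Qed.

Let collapse (F : {set 'I_n} -> R) V : \sum_U (V == U)%:R * F U = F V.
Proof.
rewrite (bigD1 V)//= eqxx mul1r big1 ?addr0// => U /negPf.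
by rewrite eq_sym => ->; rewrite mul0r.
Qed.

Fact ext_mulA : associative ext_mul.
Proof.
move=> f g h; apply/ffunP => U.
transitivity (\sum_A \sum_B \sum_C (A :|: B :|: C == U)%:R *
    (ext_sign B C * ext_sign A (B :|: C) * (f A * g B * h C))).
  rewrite ext_mulE; apply: eq_bigr => A _.
  under eq_bigr => D _ do rewrite ext_mulE !mulr_sumr.
  rewrite exchange_big; apply: eq_bigr => B _ /=.
  under eq_bigr => D _ do rewrite !mulr_sumr.
  rewrite exchange_big; apply: eq_bigr => C _ /=.
  rewrite -setUA -[RHS](collapse (fun D => (A :|: D == U)%:R *
    (ext_sign B C * ext_sign A D * (f A * g B * h C)))).
  by apply: eq_bigr => D _; ring.
have -> : ext_mul (ext_mul f g) h U = \sum_C \sum_A \sum_B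
    (A :|: B :|: C == U)%:R *
    (ext_sign A B * ext_sign (A :|: B) C * (f A * g B * h C)).
  rewrite ext_mulE exchange_big; apply: eq_bigr => C _ /=.
  under eq_bigr => D _ do rewrite ext_mulE mulr_suml !mulr_sumr.
  rewrite exchange_big; apply: eq_bigr => A _ /=.
  under eq_bigr => D _ do rewrite mulr_suml !mulr_sumr.
  rewrite exchange_big; apply: eq_bigr => B _ /=.
  rewrite -[RHS](collapse (fun D => (D :|: C == U)%:R *
    (ext_sign A B * ext_sign D C * (f A * g B * h C)))).
  by apply: eq_bigr => D _; ring.
rewrite [RHS]exchange_big; apply: eq_bigr => A _ /=.
rewrite [RHS]exchange_big; apply: eq_bigr => B _ /=.
by apply: eq_bigr => C _; rewrite ext_signA; ring.
Qed.

Fact ext_mul1 : left_id (ext_const 1) ext_mul.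
Proof.
move=> f; apply/ffunP => U; rewrite ext_mulE (bigD1 set0)//= [X in _ + X]big1.
  rewrite addr0; transitivity (\sum_W (U == W)%:R * f W); last exact: collapse.
  apply: eq_bigr => W _.
  by rewrite set0U ext_sign0l ffunE eqxx !mul1r eq_sym.
move=> V /negPf V0; rewrite big1// => W _.
by rewrite ffunE V0 mul0r !mulr0.
Qed.

Fact ext_mulr1 : right_id (ext_const 1) ext_mul.
Proof.
move=> f; apply/ffunP => U; rewrite ext_mulE exchange_big (bigD1 set0)//=.
rewrite [X in _ + X]big1 ?addr0 => [|V /negPf V0].
  transitivity (\sum_W (U == W)%:R * f W); last exact: collapse.
  apply: eq_bigr => W _; by rewrite setU0 ext_sign0r ffunE eqxx mulr1 mul1r eq_sym.
by rewrite big1// => W _; rewrite [ext_const 1 V]ffunE V0 !mulr0.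
Qed.

Fact ext_mulDl : left_distributive ext_mul +%R.
Proof.
move=> f g h; apply/ffunP => U; rewrite [RHS]ffunE !ffunE -big_split.
apply: eq_bigr => V _; rewrite -big_split; apply: eq_bigr => W _ /=.
by rewrite ffunE; ring.
Qed.

Fact ext_mulDr : right_distributive ext_mul +%R.
Proof.
move=> f g h; apply/ffunP => U; rewrite [RHS]ffunE !ffunE -big_split.
apply: eq_bigr => V _; rewrite -big_split; apply: eq_bigr => W _ /=.
by rewrite [(g + h) W]ffunE; ring.
Qed.

Fact ext_one_neq0 : ext_const 1 != 0.
Proof.
by apply/eqP => /ffunP/(_ set0)/eqP; rewrite !ffunE eqxx oner_eq0.
Qed.

HB.instance Definition _ := GRing.Zmodule_isNzRing.Build (extalg R n)
  ext_mulA ext_mul1 ext_mulr1 ext_mulDl ext_mulDr ext_one_neq0.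

(* The parity involution s_j |-> - s_j.                                       *)
Definition ext_par f : extalg R n := [ffun U : {set 'I_n} => (-1) ^+ #|U| * f U].

Lemma ext_parD f g : ext_par (f + g) = ext_par f + ext_par g.
Proof. by apply/ffunP => U; rewrite !ffunE mulrDr. Qed.

Lemma ext_par1 : ext_par 1 = 1.
Proof.
apply/ffunP => U; rewrite !ffunE; case: eqP => [->|_]; last by rewrite mulr0.
by rewrite cards0 mul1r.
Qed.

Lemma ext_parM f g : ext_par (f * g) = ext_par f * ext_par g.
Proof.
apply/ffunP => U; rewrite !ffunE mulr_sumr; apply: eq_bigr => V _.
rewrite mulr_sumr; apply: eq_bigr => W /eqP <-; rewrite !ffunE.
rewrite /ext_sign; case: ifP => dVW; last by rewrite !mul0r mulr0.
have -> : #|V :|: W| = (#|V| + #|W|)%N by apply/eqP; rewrite (leq_card_setU V W).2.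
by rewrite exprD; ring.
Qed.

(* The augmentation s_j |-> 0.                                                *)
Lemma ext_mul_set0 f g : (f * g) set0 = f set0 * g set0.
Proof.
rewrite [f * g]/(ext_mul f g) ext_mulE (bigD1 set0)//= [X in _ + X]big1.
  rewrite addr0 (bigD1 set0)//= [X in _ + X]big1 ?addr0.
    by rewrite set0U eqxx ext_sign0l !mul1r.
  by move=> W /negPf W0; rewrite set0U W0 mul0r.
move=> V /negPf V0; rewrite big1// => W _.
by rewrite setU_eq0 V0 mul0r.
Qed.

End Exterior.

Inductive lspan (R : nzRingType) (V : lmodType R) (S : V -> Prop) : V -> Prop :=
| LSpan0 : lspan S 0
| LSpanS a x y : S x -> lspan S y -> lspan S (a *: x + y).

Section LQuot.
Variables (R : nzRingType) (V : lmodType R) (S : V -> Prop).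

Lemma lspanZD a x y : lspan S x -> lspan S y -> lspan S (a *: x + y).
Proof.
move=> + Sy; elim=> [|c z t Sz _ IH]; first by rewrite scaler0 add0r.
by rewrite scalerDr scalerA -addrA; exact: LSpanS.
Qed.

Definition lspanb : {pred V} := fun x => `[< lspan S x >].

Fact lspanb_zmod_closed : zmod_closed lspanb.
Proof.
split=> [|x y /asboolP Sx /asboolP Sy]; first exact/asboolP/LSpan0.
by apply/asboolP; rewrite addrC -scaleN1r; exact: lspanZD.
Qed.

HB.instance Definition _ := GRing.isZmodClosed.Build V lspanb lspanb_zmod_closed.

(* The quotient of V by the submodule generated by S.                         *)
Definition lquot : Type := Quotient.quot lspanb.

HB.instance Definition _ := GRing.Zmodule.on lquot.

Definition lpi (x : V) : lquot :=
  (\pi_(Quotient.quot lspanb) x)%qT.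

Definition lquot_scale (a : R) (x : lquot) : lquot :=
  lpi (a *: repr (x : Quotient.quot lspanb)).

Lemma lpi_eq x y : lspan S (x - y) -> lpi x = lpi y.
Proof.
move=> h; apply/eqP; rewrite /lpi -Quotient.idealrBE.
exact/asboolP.
Qed.

Lemma lpiD x y : lpi (x + y) = lpi x + lpi y.
Proof. by rewrite /lpi [LHS]raddfD. Qed.

Lemma lpi_repr (x : lquot) : lpi (repr (x : Quotient.quot lspanb)) = x.
Proof. exact: reprK. Qed.

Lemma lpiZ a x : lpi (a *: x) = lquot_scale a (lpi x).
Proof.
apply: lpi_eq; rewrite -scalerBr -[_ *: _]addr0; apply: lspanZD; last exact: LSpan0.
apply/asboolP; rewrite -[asbool _]/(_ \in lspanb) Quotient.idealrBE.
by rewrite reprK.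
Qed.

Fact lquot_scaleA a c x :
  lquot_scale a (lquot_scale c x) = lquot_scale (a * c) x.
Proof. by rewrite -[x]lpi_repr -!lpiZ scalerA. Qed.
Fact lquot_scale1 : left_id 1 lquot_scale.
Proof. by move=> x; rewrite -[x]lpi_repr -!lpiZ scale1r. Qed.
Fact lquot_scaleDr : right_distributive lquot_scale +%R.
Proof.
move=> a x y; rewrite -[x]lpi_repr -[y]lpi_repr -lpiD -!lpiZ scalerDr.
exact: lpiD.
Qed.
Fact lquot_scaleDl x : {morph lquot_scale^~ x : a c / a + c}.
Proof. by move=> a c; rewrite -[x]lpi_repr -!lpiZ scalerDl lpiD. Qed.

HB.instance Definition _ := GRing.Zmodule_isLmodule.Build R lquot
  lquot_scaleA lquot_scale1 lquot_scaleDr lquot_scaleDl.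

End LQuot.

(* Countable direct sums: families that vanish from some index on.            *)
Section DSum.
Variables (R : nzRingType) (V : nat -> lmodType R).

Record dsum := DSum {
  dproj :> forall k, V k;
  dsumP : exists n, forall k, (n <= k)%N -> dproj k = 0 }.

HB.instance Definition _ := gen_eqMixin dsum.
HB.instance Definition _ := gen_choiceMixin dsum.

Implicit Types x y : dsum.

Lemma dsum_eq x y : (forall k, x k = y k) -> x = y.
Proof.
case: x y => [x xP] [y yP] /= e.
have {}e : x = y by exact: functional_extensionality_dep.
by case: y / e yP => yP; congr DSum; exact: Prop_irrelevance.
Qed.

Fact dzero_fin : exists n, forall k, (n <= k)%N -> (0 : V k) = 0.
Proof. by exists 0%N. Qed.
Fact dadd_fin x y : exists n, forall k, (n <= k)%N -> x k + y k = 0.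
Proof.
have [[n xn] [m ym]] := (dsumP x, dsumP y); exists (n + m)%N => k nk.
by rewrite xn ?ym ?addr0//; lia.
Qed.
Fact dopp_fin x : exists n, forall k, (n <= k)%N -> - x k = 0.
Proof. by have [n xn] := dsumP x; exists n => k /xn ->; rewrite oppr0. Qed.
Fact dscale_fin a x : exists n, forall k, (n <= k)%N -> a *: x k = 0.
Proof. by have [n xn] := dsumP x; exists n => k /xn ->; rewrite scaler0. Qed.
Fact dinj_fin k (v : V k) : exists n, forall j, (n <= j)%N ->
  (if k =P j is ReflectT e then ecast j (V j) e v else 0) = 0.
Proof. by exists k.+1 => j kj; case: eqP => // e; rewrite e ltnn in kj. Qed.

Definition dzero := DSum dzero_fin.
Definition dadd x y := DSum (dadd_fin x y).
Definition dopp x := DSum (dopp_fin x).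
Definition dscale a x := DSum (dscale_fin a x).
Definition dinj k (v : V k) := DSum (dinj_fin v).

Fact daddA : associative dadd.
Proof. by move=> *; apply: dsum_eq => k /=; rewrite addrA. Qed.
Fact daddC : commutative dadd.
Proof. by move=> *; apply: dsum_eq => k /=; rewrite addrC. Qed.
Fact dadd0 : left_id dzero dadd.
Proof. by move=> *; apply: dsum_eq => k /=; rewrite add0r. Qed.
Fact daddN : left_inverse dzero dopp dadd.
Proof. by move=> *; apply: dsum_eq => k /=; rewrite addNr. Qed.

HB.instance Definition _ := GRing.isZmodule.Build dsum daddA daddC dadd0 daddN.

Fact dscaleA a c x : dscale a (dscale c x) = dscale (a * c) x.
Proof. by apply: dsum_eq => k /=; rewrite scalerA. Qed.
Fact dscale1 : left_id 1 dscale.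
Proof. by move=> *; apply: dsum_eq => k /=; rewrite scale1r. Qed.
Fact dscaleDr : right_distributive dscale +%R.
Proof. by move=> *; apply: dsum_eq => k /=; rewrite scalerDr. Qed.
Fact dscaleDl x : {morph dscale^~ x : a c / a + c}.
Proof. by move=> *; apply: dsum_eq => k /=; rewrite scalerDl. Qed.

HB.instance Definition _ := GRing.Zmodule_isLmodule.Build R dsum
  dscaleA dscale1 dscaleDr dscaleDl.

End DSum.

(* x_{i,k} and s_{i,k} are indexed by i.-1 : 'I_k.                            *)
Definition Omega (k : nat) := extalg {mpoly rat[k]} k.

(* Omega_{k,k+1}; the last of the k+1 even variables is xi_{k+1}.             *)
Definition OmegaB (k : nat) := extalg {mpoly rat[k.+1]} k.+1.

HB.instance Definition _ k := GRing.NzRing.on (Omega k).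
HB.instance Definition _ k := GRing.NzRing.on (OmegaB k).

Section Homogeneous.
Variables (m n : nat) (w : 'I_m -> int).

(* The bidegree of x^a s_U when x_i has q-degree w i.                         *)
Definition mon_deg (a : 'X_{1..m}) (U : {set 'I_n}) : bideg :=
  (\sum_(i < m) w i *+ a i - \sum_(j in U) (2 * j.+1)%:Z, (2 * #|U|)%:Z).

Definition ext_hom (d : bideg) (p : bool) (f : extalg {mpoly rat[m]} n) : Prop :=
  forall U a, a \in msupp (f U) -> mon_deg a U = d /\ odd #|U| = p.

End Homogeneous.

Definition Omega_hom k : bideg -> bool -> Omega k -> Prop :=
  @ext_hom k k (fun i => (2 * i.+1)%:Z).

Definition OmegaB_hom k : bideg -> bool -> OmegaB k -> Prop :=
  @ext_hom k.+1 k.+1 (fun i => if (i < k)%N then (2 * i.+1)%:Z else 2).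

(* The algebra morphism given by the images of the generators.                *)
Definition ext_eval m n (T : nzRingType) (c : rat -> T)
    (y : 'I_m -> T) (t : 'I_n -> T) (f : extalg {mpoly rat[m]} n) : T :=
  \sum_(U : {set 'I_n}) mmap c y (f U) * \prod_(j in U) t j.

Section Bimodule.
Variable k : nat.

Definition Bconst (c : rat) : OmegaB k := ext_const k.+1 c%:MP.
Definition Bx (i : 'I_k.+1) : OmegaB k := ext_const k.+1 'X_i.
Definition Bs (j : 'I_k.+1) : OmegaB k := ext_gen {mpoly rat[k.+1]} j.
Definition Bxi : OmegaB k := Bx ord_max.

(* x_{i,k} with x_{0,k} = 1 and x_{k+1,k} = 0.                                *)
Definition Bxk (i : nat) : OmegaB k :=
  if i is j.+1 then (if (j < k)%N then Bx (inord j) else 0) else 1.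

Definition Omega_lo : Omega k -> OmegaB k :=
  ext_eval Bconst (fun i : 'I_k => Bxk i.+1)
    (fun j : 'I_k => Bs (inord j) + Bxi * Bs (inord j.+1)).

Definition Omega_hi : Omega k.+1 -> OmegaB k :=
  ext_eval Bconst (fun i : 'I_k.+1 => Bxk i.+1 + Bxi * Bxk i) Bs.

End Bimodule.

(* V is the direct sum of its subgroups of bidegree d and parity p.           *)
Record bigrading (V : zmodType) (hom : bideg -> bool -> V -> Prop) : Prop := {
  hom0 : forall d p, hom d p 0;
  homB : forall d p x y, hom d p x -> hom d p y -> hom d p (x - y);
  hom_span : forall x, exists2 s : seq (bideg * bool * V),
    (forall z, z \in s -> hom z.1.1 z.1.2 z.2) & x = \sum_(z <- s) z.2;
  hom_indep : forall (s : seq (bideg * bool)) (c : bideg * bool -> V), uniq s ->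
    (forall z, hom z.1 z.2 (c z)) -> \sum_(z <- s) c z = 0 ->
    forall z, z \in s -> c z = 0 }.

Definition graded_action k (M : lmodType (Omega k))
    (hom : bideg -> bool -> M -> Prop) : Prop :=
  forall d p e o r x, @Omega_hom k d p r -> hom e o x ->
    hom (d + e) (p (+) o) (r *: x).

(* Bigraded left supermodules.                                                *)
Record gsmod k := Gsmod {
  gcar :> lmodType (Omega k);
  ghom : bideg -> bool -> gcar -> Prop;
  gbigrading : bigrading ghom;
  gaction : graded_action ghom }.

Lemma bigrading_reindex (V : zmodType) (hom : bideg -> bool -> V -> Prop)
    (g h : bideg * bool -> bideg * bool) : cancel g h -> cancel h g ->
  bigrading hom -> bigrading (fun d p => hom (g (d, p)).1 (g (d, p)).2).
Proof.
move=> gK hK [h0 hB hs hi]; split=> [d p|d p x y|x|s c us hc c0 z zs].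
- exact: h0.
- exact: hB.
- have [s sh ->] := hs x; exists [seq (h z.1, z.2) | z <- s].
    by move=> _ /mapP[z zs ->] /=; rewrite -surjective_pairing hK; apply: sh.
  by rewrite big_map.
have hmap := hi (map g s) (fun z => c (h z)).
have := hmap _ _ _ (g z); rewrite gK; apply.
- by rewrite (map_inj_uniq (can_inj gK)).
- by move=> z'; have := hc (h z'); rewrite -surjective_pairing hK.
- by rewrite big_map -[RHS]c0; apply: eq_bigr => ? _; rewrite gK.
exact: map_f.
Qed.

Section Modules.
Variable k : nat.
Implicit Types M N P T : gsmod k.

Definition is_gmor M N (f : M -> N) : Prop :=
  (forall r x y, f (r *: x + y) = r *: f x + f y) /\
  (forall d p x, ghom d p x -> ghom d p (f x)).

Definition giso M N : Prop := exists2 f : M -> N, is_gmor f & bijective f.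

Section Shift.
Variables (c : bideg) (M : gsmod k).

Fact gshift_bigrading : bigrading (fun d p (x : M) => ghom (d - c) p x).
Proof.
apply: (@bigrading_reindex M _ (fun z => (z.1 - c, z.2)) (fun z => (z.1 + c, z.2))
  _ _ (gbigrading M)) => [[d p]|[d p]] /=; first by rewrite subrK.
by rewrite addrK.
Qed.

Fact gshift_action : graded_action (fun d p (x : M) => ghom (d - c) p x).
Proof. by move=> d p e o r x hr hx; rewrite -addrA; apply: gaction. Qed.

(* The shift M<c.1, c.2>.                                                     *)
Definition gshift : gsmod k := Gsmod gshift_bigrading gshift_action.
End Shift.

Section Parity.
Variable M : gsmod k.

Definition pi_car : Type := M.
HB.instance Definition _ := GRing.Zmodule.on pi_car.

Definition pi_scale (r : Omega k) (x : pi_car) : pi_car :=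
  (ext_par r : Omega k) *: (x : M).

Fact pi_scaleA a c x : pi_scale a (pi_scale c x) = pi_scale (a * c) x.
Proof. by rewrite /pi_scale scalerA -[(a * c)%R]/((a : extalg _ _) * c) ext_parM. Qed.
Fact pi_scale1 : left_id 1 pi_scale.
Proof. by move=> x; rewrite /pi_scale ext_par1 scale1r. Qed.
Fact pi_scaleDr : right_distributive pi_scale +%R.
Proof. by move=> a x y; rewrite /pi_scale scalerDr. Qed.
Fact pi_scaleDl x : {morph pi_scale^~ x : a c / a + c}.
Proof. by move=> a c; rewrite /pi_scale ext_parD scalerDl. Qed.

HB.instance Definition _ := GRing.Zmodule_isLmodule.Build (Omega k) pi_car
  pi_scaleA pi_scale1 pi_scaleDr pi_scaleDl.

Definition pi_hom (d : bideg) (p : bool) (x : pi_car) : Prop :=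
  ghom d (~~ p) (x : M).

Fact pi_bigrading : bigrading pi_hom.
Proof.
apply: (@bigrading_reindex M _ (fun z => (z.1, ~~ z.2)) (fun z => (z.1, ~~ z.2))
  _ _ (gbigrading M)) => [[d p]|[d p]] /=; by rewrite negbK.
Qed.

Fact pi_action : graded_action pi_hom.
Proof.
move=> d p e o r x hr hx; rewrite /pi_hom -addbN; apply: gaction => //.
move=> U a; rewrite ffunE -signr_odd mulr_sign => aU; apply: hr.
by move: aU; case: ifP; rewrite // (perm_mem (msuppN _)).
Qed.

(* The parity shift Pi M, with r . pi(x) = (-1)^{p(r)} pi(r x).               *)
Definition gpi : gsmod k := Gsmod pi_bigrading pi_action.
End Parity.

Section Regular.

Definition Omega_reg_hom (d : bideg) (p : bool) (f : (Omega k)^o) : Prop :=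
  Omega_hom d p f.

Fact Omega_bigrading : bigrading Omega_reg_hom.
Proof.
split=> [d p U a|d p f g hf hg U a|f|s c us hc c0 z zs].
- by rewrite ffunE msupp0.
- rewrite !ffunE => /msuppD_le; rewrite mem_cat (perm_mem (msuppN _)) => /orP[]; [exact: hf|exact: hg].
- pose t U a : extalg {mpoly rat[k]} k := [ffun V => if V == U then (f U)@_a *: 'X_[a] else 0].
  exists [seq (mon_deg (fun i : 'I_k => (2 * i.+1)%:Z) x.2 x.1, odd #|x.1|, t x.1 x.2)
     | x <- [seq (U, a) | U <- enum {set 'I_k}, a <- msupp (f U)]].
    move=> _ /mapP[[U a] _ ->] /= V b; rewrite ffunE; case: eqP => [->|_].
      by move=> /msuppZ_le; rewrite msuppX inE => /eqP ->.
    by rewrite msupp0.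
  rewrite !big_map /= big_allpairs_dep big_enum /=.
  apply/ffunP => V; rewrite sum_ffunE (bigD1 V)//= [X in _ + X]big1 ?addr0.
    rewrite sum_ffunE [LHS]mpolyE; apply: eq_bigr => a _.
    by rewrite ffunE eqxx.
  move=> U /negPf UV; rewrite sum_ffunE big1// => a _.
  by rewrite ffunE eq_sym UV.
apply/ffunP => U; apply/mpolyP => a; rewrite ffunE mcoeff0.
case: (boolP (a \in msupp (c z U))) => [az|/memN_msupp_eq0//].
have /ffunP/(_ U)/(congr1 (mcoeff a)) := c0.
rewrite sum_ffunE ffunE raddf_sum mcoeff0 (bigD1_seq z)//= [X in _ + X]big1 ?addr0//.
move=> z' z'z; case: (boolP (a \in msupp (c z' U))) => [az'|]; last first.
  by move/memN_msupp_eq0.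
have [d1 p1] := hc z' U a az'; have [d2 p2] := hc z U a az.
case/eqP: z'z; rewrite [z']surjective_pairing [z]surjective_pairing.
by rewrite -d1 -p1 -d2 -p2.
Qed.

Fact Omega_action : @graded_action k (Omega k)^o Omega_reg_hom.
Proof.
move=> d p e o r f hr hf U a; rewrite ffunE => /msupp_sum_le /flattenP[? /mapP[V _ ->]].
move=> /msupp_sum_le /flattenP[? /mapP[W]]; rewrite mem_filter => /andP[/eqP <- _] -> {U}.
rewrite /ext_sign; case: ifP => dVW; last by rewrite mul0r msupp0.
rewrite -signr_odd mulr_sign => h.
have {h} : a \in msupp (r V * f W).
  by move: h; case: ifP => // _; rewrite (perm_mem (msuppN _)).
move=> /msuppM_le /allpairsP[[b c] [/= /hr[<- <-] /hf[<- <-] ->]].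
have cVW : #|V :|: W| = (#|V| + #|W|)%N by apply/eqP; rewrite (leq_card_setU V W).2.
rewrite /mon_deg cVW oddD mulnDr; split=> //; congr (_, _).
rewrite /= addrACA -opprD; congr (_ - _).
  by rewrite -big_split; apply: eq_bigr => i _; rewrite mnmDE mulrnDr.
by rewrite -bigU//; apply: eq_bigl => i; rewrite !inE.
Qed.

Definition gOmega : gsmod k := Gsmod Omega_bigrading Omega_action.
End Regular.

Section Simple.

Definition simple_car : Type := rat.
HB.instance Definition _ := GRing.Zmodule.on simple_car.

Definition simple_scale (r : Omega k) (x : simple_car) : simple_car :=
  (r set0)@_0 * x.

Fact simple_scaleA a c x :
  simple_scale a (simple_scale c x) = simple_scale (a * c) x.
Proof.
rewrite /simple_scale -[(a * c)%R]/((a : extalg _ _) * c) ext_mul_set0.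
by rewrite [(_ * _)@_0]rmorphM mulrA.
Qed.
Fact simple_scale1 : left_id 1 simple_scale.
Proof. by move=> x; rewrite /simple_scale ffunE eqxx mcoeff1 eqxx mul1r. Qed.
Fact simple_scaleDr : right_distributive simple_scale +%R.
Proof. by move=> a x y; rewrite /simple_scale mulrDr. Qed.
Fact simple_scaleDl x : {morph simple_scale^~ x : a c / a + c}.
Proof. by move=> a c; rewrite /simple_scale ffunE mcoeffD mulrDl. Qed.

HB.instance Definition _ := GRing.Zmodule_isLmodule.Build (Omega k) simple_car
  simple_scaleA simple_scale1 simple_scaleDr simple_scaleDl.

Definition simple_hom (d : bideg) (p : bool) (x : simple_car) : Prop :=
  x = 0 \/ (d = 0 /\ p = false).

Fact simple_bigrading : bigrading simple_hom.
Proof.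
split=> [d p|d p x y|x|s c us hc c0 z zs]; first by left.
- by case=> [->|dp [->|_]]; [case=> [->|]; [left; rewrite subr0|right]|right..].
- exists [:: (0, false, x)]; last by rewrite big_seq1.
  by move=> z; rewrite inE => /eqP->; right.
have [//|[z1 z2]] := hc z; move: c0; rewrite (bigD1_seq z)//= big1 ?addr0//.
move=> z' z'z; have [//|[w1 w2]] := hc z'; case/eqP: z'z.
by rewrite [z']surjective_pairing [z]surjective_pairing z1 z2 w1 w2.
Qed.

Fact simple_action : graded_action simple_hom.
Proof.
move=> d p e o r x hr [->|[-> ->]]; first by left; exact: scaler0.
rewrite addr0 addbF /simple_hom.
case: (boolP (0%MM \in msupp (r set0))) => [/hr|/memN_msupp_eq0 r0].
  rewrite /mon_deg cards0 big_set0 subr0 muln0 /= => -[<- <-]; right; split=> //.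
  by congr (_, _); apply: big1 => i _; rewrite mnm0E.
by left; rewrite /GRing.scale /= /simple_scale r0 mul0r.
Qed.

(* The simple module S_k = Q in degree 0, on which the generators act by 0.   *)
Definition gsimple : gsmod k := Gsmod simple_bigrading simple_action.
End Simple.

End Modules.

(* Tensor products with Omega_{j,j+1} over its two subrings, through their    *)
(* universal property: l gives the left and r the right action.               *)
Section Tensor.
Variables (j k' k : nat) (l : Omega k' -> OmegaB j) (r : Omega k -> OmegaB j).
Variable M : gsmod k.

Definition balanced (V : zmodType) (t : OmegaB j -> M -> V) : Prop :=
  [/\ forall b b' x, t (b + b') x = t b x + t b' x,
      forall b x x', t b (x + x') = t b x + t b x' &
      forall b a x, t (b * r a) x = t b (a *: x)].

Definition is_tensor (N : gsmod k') (t : OmegaB j -> M -> N) : Prop :=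
  [/\ balanced t,
      forall a b x, t (l a * b) x = a *: t b x,
      forall d p e o b x, OmegaB_hom d p b -> ghom e o x ->
        ghom (d + e) (p (+) o) (t b x) &
      forall (V : zmodType) (u : OmegaB j -> M -> V), balanced u ->
        exists2 f : {additive N -> V}, (forall b x, f (t b x) = u b x) &
          forall g : {additive N -> V}, (forall b x, g (t b x) = u b x) -> g =1 f].

End Tensor.

(* N = F_k(M) and N = E_k(M), up to the choice of the tensor product.         *)
Definition functorF k (M : gsmod k) (N : gsmod k.+1) : Prop :=
  exists (T : gsmod k.+1) (t : OmegaB k -> M -> T),
    is_tensor (@Omega_hi k) (@Omega_lo k) t /\ N = gshift (- k%:Z, 0) T.

Definition functorE k (M : gsmod k.+1) (N : gsmod k) : Prop :=
  exists (T : gsmod k) (t : OmegaB k -> M -> T),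
    is_tensor (@Omega_lo k) (@Omega_hi k) t /\ N = gshift (k%:Z + 2, -1) T.

Section Multiplicities.
Variable k : nat.
Implicit Types M N P T : gsmod k.

Definition gsubmod M (U : M -> Prop) : Prop :=
  [/\ U 0, forall r x y, U x -> U y -> U (r *: x + y) &
    forall x, U x -> exists2 s : seq (bideg * bool * M),
      (forall z, z \in s -> U z.2 /\ ghom z.1.1 z.1.2 z.2) &
      x = \sum_(z <- s) z.2].

(* W / U is isomorphic to T.                                                  *)
Definition subquotient_iso M (U W : M -> Prop) T : Prop :=
  exists f : M -> T,
  [/\ forall r x y, W x -> W y -> f (r *: x + y) = r *: f x + f y,
      forall d p x, W x -> ghom d p x -> ghom d p (f x),
      forall t, exists2 x, W x & f x = t &
      forall x, W x -> (f x = 0 <-> U x)].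

(* M has a finite filtration by graded submodules with at least n             *)
(* subquotients isomorphic to T.                                              *)
Definition has_factors M T (n : nat) : Prop :=
  exists (h : nat) (U : nat -> M -> Prop) (J : {set 'I_h}),
  [/\ (forall i, gsubmod (U i)) /\ (forall i x, U i x -> U i.+1 x),
      forall x, U 0%N x <-> x = 0,
      forall x, U h x,
      #|J| = n &
      forall i, i \in J -> subquotient_iso (U i) (U i.+1) T].

(* The multiplicity [M : T] of a simple module T.                             *)
Definition jh_mult M T : nat := xget 0%N
  (fun n => has_factors M T n /\ forall m, has_factors M T m -> (m <= n)%N).

(* P is the direct sum of the T_i, i in I, with injections iota_i.            *)
Definition is_direct_sum (I : eqType) (T : I -> gsmod k) P
    (iota : forall i, T i -> P) : Prop :=
  [/\ forall i, is_gmor (iota i),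
      forall x, exists (s : seq I) (c : forall i, T i),
        x = \sum_(i <- s) iota i (c i) &
      forall (s : seq I) (c : forall i, T i), uniq s ->
        \sum_(i <- s) iota i (c i) = 0 -> forall i, i \in s -> c i = 0].

Definition parity_pow (p : bool) M : gsmod k := if p then gpi M else M.

(* P is isomorphic to the direct sum of m d p copies of Pi^p Omega_k<d>.      *)
Definition free_decomp P (m : bideg -> bool -> nat) : Prop :=
  exists iota : forall i : {i : bideg * bool * nat | (i.2 < m i.1.1 i.1.2)%N},
      gshift (val i).1.1 (parity_pow (val i).1.2 (gOmega k)) -> P,
    is_direct_sum iota.

Definition free_mult P : bideg -> bool -> nat :=
  xget (fun _ _ => 0%N) (free_decomp P).

Definition projective P : Prop :=
  forall (M N : gsmod k) (g : M -> N) (f : P -> N),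
    is_gmor g -> (forall y, exists x, g x = y) -> is_gmor f ->
    exists2 h : P -> M, is_gmor h & forall x, g (h x) = f x.

Definition gsupp M (d : bideg) : Prop := exists p x, ghom (g := M) d p x /\ x <> 0.

Definition locally_finite M : Prop := forall d p,
  exists (n : nat) (b : 'I_n -> M), forall x, ghom d p x ->
    exists c : 'I_n -> rat,
      x = \sum_(i < n) (ext_const k (c i)%:MP : Omega k) *: b i.

Definition smod_lf M : Prop := locally_finite M /\ cone_bounded (gsupp M).
Definition smod_lf_lambda M : Prop := smod_lf M /\ lambda_bounded (gsupp M).
Definition psmod_lambda M : Prop := smod_lf_lambda M /\ projective M.

Definition short_exact M1 M M2 : Prop :=
  exists (f : M1 -> M) (g : M -> M2),
  [/\ is_gmor f /\ is_gmor g, injective f, forall y, exists x, g x = y &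
      forall x, g x = 0 <-> exists y, f y = x].

Definition split_exact M1 M M2 : Prop :=
  exists (f1 : M1 -> M) (f2 : M2 -> M),
  [/\ is_gmor f1, is_gmor f2 & bijective (fun y : M1 * M2 => f1 y.1 + f2 y.2)].

End Multiplicities.

(* Z_pi = Z[pi] / (pi^2 - 1) and its specialization at pi = -1.               *)
Definition Zpi := {poly %/ ('X^2 - 1 : {poly int})}.
HB.instance Definition _ := GRing.ComNzRing.on Zpi.
Definition Zpi_gen : Zpi := in_qpoly ('X^2 - 1) 'X.
Definition Zpi_spec (z : Zpi) : rat := ((z : {poly int}).[-1])%:~R.

Lemma Zpi_spec0 : Zpi_spec 0 = 0.
Proof. by rewrite /Zpi_spec horner0. Qed.

Fact spec_supp b (f : laurent b Zpi) :
  laurent_supp b (fun d => Zpi_spec (f d) <> 0).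
Proof.
by apply: laurent_supp_sub (lcoefP f) => d fd e; apply: fd; rewrite e Zpi_spec0.
Qed.

Definition spec b (f : laurent b Zpi) : laurent b rat := Laurent (spec_supp f).

(* An additive or exact category of bigraded supermodules over each Omega_k,  *)
(* with the multiplicities defining its topological Grothendieck group over   *)
(* laurent b Zpi.                                                             *)
Record gcat (b : bool) := Gcat {
  gobj : forall k, gsmod k -> Prop;
  gexact : forall k, gsmod k -> gsmod k -> gsmod k -> Prop;
  gmult : forall k, gsmod k -> bideg -> bool -> nat }.

Definition simple_mult k (M : gsmod k) (d : bideg) (p : bool) : nat :=
  jh_mult M (gshift d (parity_pow p (gsimple k))).

Definition cat_Ghat : gcat false := Gcat false smod_lf short_exact simple_mult.
Definition cat_G : gcat true := Gcat true smod_lf_lambda short_exact simple_mult.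
Definition cat_K : gcat true := Gcat true psmod_lambda split_exact free_mult.

(* Modules with a carrier in Set. A locally finite module is countable, hence *)
(* isomorphic to one of these; they form a type small enough to generate a    *)
(* free abelian group.                                                        *)
Record small_lmod k := SmallLmod {
  scar : Set;
  szero : scar;
  sopp : scar -> scar;
  sadd : scar -> scar -> scar;
  sscale : Omega k -> scar -> scar;
  saddA : associative sadd;
  saddC : commutative sadd;
  sadd0 : left_id szero sadd;
  saddN : left_inverse szero sopp sadd;
  sscaleA : forall a c x, sscale a (sscale c x) = sscale (a * c) x;
  sscale1 : left_id 1 sscale;
  sscaleDr : right_distributive sscale sadd;
  sscaleDl : forall x, {morph sscale^~ x : a c / a + c >-> sadd a c} }.

Section SmallLmod.
Variables (k : nat) (X : small_lmod k).
HB.instance Definition _ := gen_eqMixin (scar X).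
HB.instance Definition _ := gen_choiceMixin (scar X).
HB.instance Definition _ := GRing.isZmodule.Build (scar X)
  (@saddA k X) (@saddC k X) (@sadd0 k X) (@saddN k X).
HB.instance Definition _ := GRing.Zmodule_isLmodule.Build (Omega k) (scar X)
  (@sscaleA k X) (@sscale1 k X) (@sscaleDr k X) (@sscaleDl k X).
End SmallLmod.

Record smallmod k := Smallmod {
  slmod :> small_lmod k;
  shom : bideg -> bool -> scar slmod -> Prop;
  sbigrading : bigrading shom;
  saction : graded_action shom }.

Coercion small_gsmod k (X : smallmod k) : gsmod k :=
  Gsmod (sbigrading X) (saction (s := X)).

Section Grothendieck.
Variables (b : bool) (C : gcat b).

Section Rank.
Variable k : nat.

Definition gob := {classic {X : smallmod k | gobj C X}}.
Definition gfree := {freeg gob / int}.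

Definition gseries (M : gsmod k) : laurent b Zpi := mk_laurent b (fun d =>
  (gmult C M d false)%:R + (gmult C M d true)%:R * Zpi_gen).

Definition gfree_series (x : gfree) : laurent b Zpi :=
  \sum_(X <- dom x) gseries (sval X) *~ coeff X x.

(* Relators of the topological Grothendieck group: those of the usual one,    *)
(* and the kernel of the multiplicity map.                                    *)
Definition top_relator (x : gfree) : Prop :=
  (exists X1 X X2 : gob, gexact C (sval X1) (sval X) (sval X2) /\
     x = << X >> - (<< X1 >> + << X2 >>)) \/
  gfree_series x = 0.

Definition top_groth : lmodType int := lquot top_relator.

Definition top_pi (x : gfree) : top_groth := lpi top_relator x.

(* y = s x for the action of laurent b Zpi on top_groth under which q,        *)
(* lambda, pi act by <1, 0>, <0, 1>, Pi; y is determined by s and x because   *)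
(* gfree_series separates the elements of top_groth.                          *)
Definition top_scale (s : laurent b Zpi) (x y : top_groth) : Prop :=
  exists X Y : gfree, [/\ x = top_pi X, y = top_pi Y &
    gfree_series Y = s * gfree_series X].

(* Extension of scalars along spec : laurent b Zpi -> laurent b rat.          *)
Definition ext_relator (z : {freeg top_groth / laurent b rat}) : Prop :=
  (exists x y : top_groth, z = << (x + y) >> - (<< x >> + << y >>)) \/
  (exists s x y, top_scale s x y /\ z = << y >> - spec s *: << x >>).

Definition groth_at : lmodType (laurent b rat) := lquot ext_relator.

(* The class of a module of C in the topological Grothendieck group.          *)
Definition top_class (M : gsmod k) : top_groth := xget 0
  (fun x => exists X : gob, giso (sval X) M /\ x = top_pi << X >>).

Definition class_at (M : gsmod k) : groth_at :=
  lpi ext_relator << top_class M >>.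

End Rank.

Definition groth : lmodType (laurent b rat) := dsum groth_at.

Definition gclass k (M : gsmod k) : groth := dinj (class_at M).

End Grothendieck.

Notation QL := (laurent false rat).  (* Q((q,lambda)) *)
Notation AL := (laurent true rat).   (* A = Q[[q]][q^-1, lambda^{+-1}] *)

(* q^a lambda^c                                                               *)
Definition ql b (a c : int) : laurent b rat := lmon b rat (a, c).

Fact incl_supp (f : AL) : laurent_supp false (fun d => f d <> 0).
Proof. by have [cf _] := lcoefP f; split. Qed.

Definition incl (f : AL) : QL := Laurent (incl_supp f).

Section Relations.
Variables (b : bool) (V : lmodType (laurent b rat)).

Definition Uq_relations (E F K Ki : V -> V) : Prop :=
  [/\ (forall x, K (Ki x) = x) /\ (forall x, Ki (K x) = x),
      forall x, K (E x) = ql b 2 0 *: E (K x),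
      forall x, K (F x) = ql b (-2) 0 *: F (K x) &
      forall x, E (F x) - F (E x) = (ql b 1 0 - ql b (-1) 0)^-1 *: (K x - Ki x)].

(* The action of the idempotented algebra, e n being the projection onto the  *)
(* weight space of weight lambda q^n.                                         *)
Definition Udot_relations (E F K : V -> V) (e : int -> V -> V) : Prop :=
  [/\ forall m n x, e m (e n x) = if m == n then e n x else 0,
      forall n x, K (e n x) = ql b n 1 *: e n x /\ e n (K x) = ql b n 1 *: e n x,
      forall n x, E (e n x) = e (n + 2) (E x),
      forall n x, F (e n x) = e (n - 2) (F x) &
      forall n x, E (F (e n x)) - F (E (e n x)) =
        ((ql b n 1 - ql b (- n) (-1)) / (ql b 1 0 - ql b (-1) 0)) *: e n x].

Definition weight_projections (K : V -> V) (e : int -> V -> V) : Prop :=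
  (forall n x, K x = ql b n 1 *: x -> e n x = x) /\
  (forall x, exists2 s : seq int, uniq s & x = \sum_(n <- s) e n x).

End Relations.

(* The Verma module M(mu), mu = lambda q^c.                                   *)
Definition verma : lmodType QL := {freeg nat / QL}.

Definition qnum (a : int) : QL :=
  (ql false a 0 - ql false (- a) 0) / (ql false 1 0 - ql false (-1) 0).

Section Verma.
Variable c : int.

Definition mu : QL := ql false c 1.

Definition vm (i : nat) : verma := << i >>.

Definition verma_F : verma -> verma :=
  fglift (fun i => qnum i.+1%:Z *: vm i.+1).

Definition verma_E : verma -> verma :=
  fglift (fun i => if i is j.+1 then
      ((mu * ql false (1 - i%:Z) 0 - mu^-1 * ql false (i%:Z - 1) 0) /
       (ql false 1 0 - ql false (-1) 0)) *: vm j
    else 0).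

Definition verma_K : verma -> verma :=
  fglift (fun i => (mu * ql false (- 2 * i%:Z) 0) *: vm i).

(* Projection onto the weight space of weight lambda q^n.                     *)
Definition verma_e (n : int) : verma -> verma :=
  fglift (fun i => if n == c - 2 * i%:Z then vm i else 0).

(* The dual canonical basis.                                                  *)
Definition vmd (k : nat) : verma :=
  (\prod_(1 <= s < k.+1)
     (qnum s%:Z * (ql false 1 0 - ql false (-1) 0) /
      (mu * ql false (1 - 2 * s%:Z) 0 *
       (mu * ql false (1 - s%:Z) 0 - mu^-1 * ql false (s%:Z - 1) 0)))) *: vm k.

End Verma.

(* The A-span of a family in a Q((q,lambda))-vector space.                    *)
Definition A_span (V : lmodType QL) (v : nat -> V) (x : V) : Prop :=
  exists (n : nat) (a : nat -> AL), x = \sum_(i < n) incl (a i) *: v i.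

Definition A_iso_onto (G : lmodType AL) (V : lmodType QL) (S : V -> Prop)
    (phi : G -> V) : Prop :=
  [/\ forall a x y, phi (a *: x + y) = incl a *: phi x + phi y,
      injective phi &
      forall v, S v <-> exists x, phi x = v].

Section Action.
Variables (b : bool) (C : gcat b).
Local Notation G := (groth C).

(* E, F, K are induced by the functors E_k, F_k and the shifts <-2k-1, 1>.    *)
Definition functorial_action (E F K : G -> G) : Prop :=
  [/\ forall k (M : gsmod k), gobj C M ->
        (exists N, functorF M N) /\
        (forall N, functorF M N -> gobj C N /\ F (gclass C M) = gclass C N),
      forall k (M : gsmod k.+1), gobj C M ->
        (exists N, functorE M N) /\
        (forall N, functorE M N -> gobj C N /\ E (gclass C M) = gclass C N),
      forall M : gsmod 0, gobj C M -> E (gclass C M) = 0,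
      forall k (M : gsmod k), gobj C M ->
        K (gclass C M) = gclass C (gshift (- 2 * k%:Z - 1, 1) M) &
      forall k (x : groth_at C k),
        K (dinj x) = ql b (- 1 - 2 * k%:Z) 1 *: (dinj x : G)].

End Action.

Definition intertwines (T U : Type) (phi : T -> U) (f : T -> T) (g : U -> U) :=
  forall x, phi (f x) = g (phi x).

(* Main.v *)
From HB Require Import structures.
Require Import Defs.
From mathcomp Require Import all_boot all_order all_algebra.
From mathcomp Require Import boolp classical_sets.
From mathcomp Require Import freeg mpoly zify ring.
From mathcomp Require Import finset.
Set Implicit Arguments.
Unset Strict Implicit.
Unset Printing Implicit Defensive.
Import Order.TTheory GRing.Theory Num.Theory.
Local Open Scope ring_scope.

(** The functors F_k and E_k are tensor products with the bimodule Omega_{k,k+1}, and the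
whole statement rests on its being free over each of its two subrings: over Omega_{k+1} with
basis the powers xi^i, i <= k, and over Omega_k with basis the xi^a s^e, where a is any
natural number, e is 0 or 1 and s is the last odd generator ([gdecomp_hi_left],
[gdecomp_lo_left] and their right-handed versions). As a graded vector space a tensor product
is therefore a direct sum of shifted copies of M ([gdecomp_tensor]). With the character
ch M = sum_d (dim M_{d,0} - dim M_{d,1}) q^{d_1} lambda^{d_2}, this says that F_k and E_k
multiply characters by explicit series,
   coefF k = q^{-k} (1 - lambda^2 q^{-2k-2}) / (1 - q^2),
   coefE k = lambda^{-1} q^{2k+2} [k+1]
([functorF_ch], [functorE_ch]). Their product is
[k+1] (lambda q^{-1-k} - lambda^{-1} q^{k+1}) / (q - q^{-1}), and the commutation relation of
E and F becomes an identity between quantum integers ([qint_vermaE]).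

Characters are enough because each Grothendieck group is, for every k, a free module of rank
one over the ring of series ([groth_generator]): a class is its multiplicity series times the
class of one module, and this series, at pi = -1, is a character up to a fixed factor. For
the multiplicities of simple modules it is the character itself, since the multiplicity of a
shift of S_k in a locally finite module is the dimension of the corresponding homogeneous
component ([simple_multE]). For projective modules it is ch P / ch Omega_k, since a graded
form of the Nakayama lemma shows that a bounded projective module has a homogeneous basis
([gen_hbasis], [ch_free]); the relevant notion of height is the one for which x_i and s_i
both become positive ([hgt]).

Finally, computing the character of F_k(Omega_k) from its basis over Omega_{k+1} gives
[k+1] ch Omega_{k+1} = coefF k * ch Omega_k ([ch_Omega_rec]). This is the recursion between
the canonical and the dual canonical basis, which thus differ by the factor ch Omega_k
([vmd_Omega]), and all three isomorphisms are given by the same formula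
   [M] |-> (ch M / ch Omega_k) m_k     for M a module over Omega_k
([category_action]): it sends [Omega_k] to m_k and, as ch S_k = 1, it sends [S_k] to m^k. *)

(** * Finite dimension of predicates *)

Section Dimension.
Variables (F : fieldType) (V : lmodType F).
Implicit Types (P Q : V -> Prop).

Definition subspace P : Prop := P 0 /\ forall a x y, P x -> P y -> P (a *: x + y).

Definition lincomb n (b : 'I_n -> V) (c : 'I_n -> F) : V := \sum_(i < n) c i *: b i.

(** A basis of P modulo Q, for subspaces Q and P that need not be nested. *)
Definition basis_mod P Q n (b : 'I_n -> V) : Prop :=
  [/\ forall i, P (b i), forall x, P x -> exists c, Q (x - lincomb b c) &
      forall c, Q (lincomb b c) -> forall i, c i = 0].

Definition has_dim P n : Prop := exists b : 'I_n -> V, basis_mod P (fun x => x = 0) b.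

Lemma subspaceZ P : subspace P -> forall a x, P x -> P (a *: x).
Proof. by move=> [P0 PZD] a x Px; rewrite -[_ *: _]addr0; apply: PZD. Qed.

Lemma subspaceD P : subspace P -> forall x y, P x -> P y -> P (x + y).
Proof. by move=> [P0 PZD] x y Px Py; rewrite -[x]scale1r; apply: PZD. Qed.

Lemma subspaceB P : subspace P -> forall x y, P x -> P y -> P (x - y).
Proof. by move=> [P0 PZD] x y Px Py; rewrite addrC -scaleN1r; apply: PZD. Qed.

Lemma subspace_sum P I (s : seq I) (E : I -> V) : subspace P ->
  (forall i, P (E i)) -> P (\sum_(i <- s) E i).
Proof.
move=> sP PE; elim: s => [|i s IH]; first by rewrite big_nil; case: sP.
by rewrite big_cons; apply: subspaceD.
Qed.

Lemma subspace_lincomb P n (b : 'I_n -> V) c : subspace P ->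
  (forall i, P (b i)) -> P (lincomb b c).
Proof. by move=> sP Pb; apply: subspace_sum => // i; apply: subspaceZ. Qed.

Lemma subspace0 : subspace (fun x => x = 0).
Proof. by split=> // a x y -> ->; rewrite scaler0 addr0. Qed.

Lemma lincombB n (b : 'I_n -> V) c d :
  lincomb b (fun i => c i - d i) = lincomb b c - lincomb b d.
Proof. by rewrite /lincomb -sumrB; apply: eq_bigr => i _; rewrite scalerBl. Qed.

(** The rank of the matrix of coefficients is less than its number of rows, so that it has a
nonzero left kernel. *)
Lemma dependent n m (a : 'I_m -> V) (b : 'I_n -> V) : (m < n)%N ->
  (forall i, exists c, b i = lincomb a c) ->
  exists2 c, lincomb b c = 0 & exists i, c i != 0.
Proof.
move=> mn /choice[C bC].
pose A : 'M[F]_(n, m) := \matrix_(i, j) C i j.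
have : kermx A != 0.
  rewrite kermx_eq0 /row_free neq_ltn (leq_ltn_trans (rank_leq_col A) mn)//.
case/rowV0Pn => v /sub_kermxP vA v0.
exists (fun i => v 0 i); last first.
  apply: contrapT => nv; case/eqP: v0; apply/rowP => i; rewrite mxE.
  by apply: contrapT => /eqP vi; apply: nv; exists i.
rewrite /lincomb; under eq_bigr => i _ do rewrite bC /lincomb scaler_sumr.
rewrite exchange_big big1 //= => j _.
under eq_bigr => i _ do rewrite scalerA.
rewrite -scaler_suml; move/rowP/(_ j): vA; rewrite !mxE => vA.
have -> : \sum_i v 0 i * C i j = 0.
  by rewrite -[RHS]vA; apply: eq_bigr => i _; rewrite mxE.
exact: scale0r.
Qed.

Lemma free_le n m (a : 'I_m -> V) (b : 'I_n -> V) :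
  (forall i, exists c, b i = lincomb a c) ->
  (forall c, lincomb b c = 0 -> forall i, c i = 0) -> (n <= m)%N.
Proof.
move=> ba fb; rewrite leqNgt; apply/negP => mn.
have [c /fb c0 [i /eqP]] := dependent mn ba; exact.
Qed.

Lemma has_dim_free_le P n m (b : 'I_m -> V) : has_dim P n ->
  (forall i, P (b i)) -> (forall c, lincomb b c = 0 -> forall i, c i = 0) ->
  (m <= n)%N.
Proof.
move=> [a [_ sa _]] Pb fb; apply: (free_le (a := a)) fb => i.
by have [c /eqP] := sa _ (Pb i); rewrite subr_eq0 => /eqP ->; exists c.
Qed.

Lemma has_dim_unique P n m : has_dim P n -> has_dim P m -> n = m.
Proof.
move=> hn hm; apply/eqP; rewrite eqn_leq.
case: (hn) (hm) => a [Pa _ fa] [b [Pb _ fb]].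
by rewrite (has_dim_free_le hm Pa fa) (has_dim_free_le hn Pb fb).
Qed.

Lemma lincomb_rcons n (b : 'I_n -> V) x (c : 'I_n.+1 -> F) :
  lincomb (fun i => if unlift ord_max i is Some j then b j else x) c =
  lincomb b (fun j => c (fintype.lift ord_max j)) + c ord_max *: x.
Proof.
rewrite /lincomb big_ord_recr /= unlift_none; congr (_ + _).
apply: eq_bigr => j _.
have -> : widen_ord (leqnSn n) j = fintype.lift ord_max j.
  by apply: val_inj; rewrite /= /bump leqNgt ltn_ord.
by rewrite liftK.
Qed.

(** A maximal family independent modulo Q is a basis modulo Q; it exists because
the length of such a family is bounded by that of the spanning family. *)
Lemma basis_mod_exists P Q m (a : 'I_m -> V) : subspace Q ->
  (forall x, P x -> exists c, x = lincomb a c) ->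
  exists n (b : 'I_n -> V), basis_mod P Q b.
Proof.
move=> sQ Pa.
pose indep n := exists b : 'I_n -> V, (forall i, P (b i)) /\
  forall c, Q (lincomb b c) -> forall i, c i = 0.
have le_m n : indep n -> (n <= m)%N.
  move=> [b [Pb fb]]; apply: (free_le (a := a) (b := b)) => [i|c c0].
    exact: Pa.
  by apply: fb; rewrite c0; case: sQ.
have i0 : `[< indep 0%N >].
  by apply/asboolP; exists (fun=> 0); split=> [[]|c _ []].
have ub i : `[< indep i >] -> (i <= m)%N by move=> /asboolP/le_m.
have ex : exists i, `[< indep i >] by exists 0%N.
case: (ex_maxnP ex ub) => n /asboolP[b [Pb fb]] nmax.
exists n, b; split=> // x Px; apply: contrapT => nx.
have /nmax : `[< indep n.+1 >]; last by rewrite ltnn.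
apply/asboolP; exists (fun i => if unlift ord_max i is Some j then b j else x).
split=> [i|c]; first by case: unliftP.
rewrite lincomb_rcons => Qc.
have cm : c ord_max = 0.
  apply: contrapT => /eqP cm; apply: nx.
  exists (fun j => - (c ord_max)^-1 * c (fintype.lift ord_max j)).
  have -> : x - lincomb b (fun j => - (c ord_max)^-1 * c (fintype.lift ord_max j)) =
      (c ord_max)^-1 *: (lincomb b (fun j => c (fintype.lift ord_max j)) + c ord_max *: x).
    rewrite scalerDr scalerA mulVf// scale1r addrC; congr (_ + _).
    rewrite /lincomb scaler_sumr -sumrN; apply: eq_bigr => j _.
    by rewrite scalerA mulNr scaleNr opprK.
  exact: subspaceZ.
move: Qc; rewrite cm scale0r addr0 => /fb c0 i.
by case: (unliftP ord_max i) => [j|] -> //; exact: c0.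
Qed.

Lemma has_dim_exists P m (a : 'I_m -> V) :
  (forall x, P x -> exists c, x = lincomb a c) -> exists n, has_dim P n.
Proof.
move=> /(basis_mod_exists subspace0)[n [b Pb]]; by exists n, b.
Qed.

Lemma lincomb_split n m (a : 'I_n -> V) (b : 'I_m -> V) (c : 'I_(n + m) -> F) :
  lincomb (fun i => match split i with inl j => a j | inr j => b j end) c =
  lincomb a (fun j => c (lshift m j)) + lincomb b (fun j => c (rshift n j)).
Proof.
rewrite /lincomb big_split_ord /=; congr (_ + _); apply: eq_bigr => j _.
  by rewrite -[lshift m j]/(unsplit (inl j)) unsplitK.
by rewrite -[rshift n j]/(unsplit (inr j)) unsplitK.
Qed.

(** The rank formula, in the form used for short exact sequences: Q is the image of the
submodule and b lifts a basis of the quotient. *)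
Lemma has_dim_mod P Q n m (b : 'I_n -> V) : subspace Q ->
  (forall x, Q x -> P x) ->
  basis_mod P Q b -> has_dim Q m -> has_dim P (m + n).
Proof.
move=> sQ QP [Pb sb fb] [a [Qa sa fa]].
exists (fun i => match split i with inl j => a j | inr j => b j end); split.
- by move=> i; case: (split i) => j; [apply: QP|].
- move=> x /sb[c /sa[d /eqP]]; rewrite subr_eq0 => /eqP e.
  exists (fun i => match split i with inl j => d j | inr j => c j end).
  rewrite lincomb_split.
  have -> : lincomb a (fun j => match split (lshift n j) with inl j => d j
      | inr j => c j end) = lincomb a d.
    by apply: eq_bigr => j _; rewrite -[lshift n j]/(unsplit (inl j)) unsplitK.
  have -> : lincomb b (fun j => match split (rshift m j) with inl j => d j
      | inr j => c j end) = lincomb b c.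
    by apply: eq_bigr => j _; rewrite -[rshift m j]/(unsplit (inr j)) unsplitK.
  by rewrite -e subrK subrr.
move=> c; rewrite lincomb_split => e.
have cb : forall j, c (rshift m j) = 0.
  apply: fb.
  have -> : lincomb b (fun j => c (rshift m j)) =
            lincomb a (fun j => - c (lshift n j)).
    move/eqP: e; rewrite addrC addr_eq0 => /eqP ->.
    by rewrite /lincomb -sumrN; apply: eq_bigr => j _; rewrite scaleNr.
  exact: subspace_lincomb.
have ca : forall j, c (lshift n j) = 0.
  apply: fa; rewrite -[RHS]e [X in _ = _ + X]big1 ?addr0// => j _.
  by rewrite cb scale0r.
by move=> i; rewrite -(splitK i); case: (split i) => j /=.
Qed.

End Dimension.

Section DimensionTransport.
Variables (F : fieldType) (V W : lmodType F).

Lemma has_dim_inj (P : V -> Prop) (Q : W -> Prop) (f : V -> W) n :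
  (forall a x y, f (a *: x + y) = a *: f x + f y) ->
  (forall x, P x -> Q (f x)) -> (forall y, Q y -> exists2 x, P x & f x = y) ->
  (forall x, f x = 0 -> x = 0) -> has_dim P n -> has_dim Q n.
Proof.
move=> lf PQ sf fI [b [Pb sb fb]].
have f0 : f 0 = 0 by have := lf (-1) 0 0; rewrite scaler0 addr0 scaleN1r addNr.
have flc c : f (lincomb b c) = lincomb (f \o b) c.
  rewrite /lincomb; elim: (index_enum _) => [|i s IH]; first by rewrite !big_nil.
  by rewrite !big_cons lf IH.
exists (f \o b); split=> [i|y /sf[x /sb[c /eqP]]|c].
- exact: PQ.
- by rewrite subr_eq0 => /eqP -> <-; exists c; rewrite flc subrr.
by rewrite -flc => /fI; apply: fb.
Qed.

Lemma has_dim_ext (P Q : V -> Prop) n : (forall x, P x <-> Q x) ->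
  has_dim P n -> has_dim Q n.
Proof. by move=> PQ; have -> : P = Q by apply/funext => x; apply/propext. Qed.

End DimensionTransport.

(** * Finitely supported sums, gradings and graded decompositions *)

Section FinSum.
Variables (I : eqType) (V : zmodType).
Implicit Types (f g : I -> V) (x y : V).

Definition fin_sum f x : Prop :=
  exists s : seq I, [/\ uniq s, forall i, i \notin s -> f i = 0 &
    x = \sum_(i <- s) f i].

Lemma sum_supp f (s t : seq I) : uniq s -> uniq t ->
  (forall i, i \in s -> i \notin t -> f i = 0) ->
  (forall i, i \in t -> i \notin s -> f i = 0) ->
  \sum_(i <- s) f i = \sum_(i <- t) f i.
Proof.
move=> us ut sf tf.
rewrite (bigID (mem t)) [RHS](bigID (mem s)) /=.
rewrite [X in _ + X]big1_seq ?[X in _ = _ + X]big1_seq ?addr0.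
- rewrite -big_filter -[RHS]big_filter; apply: perm_big.
  by apply: uniq_perm; rewrite ?filter_uniq// => i; rewrite !mem_filter /= andbC.
- by move=> i /andP[]; auto.
- by move=> i /andP[]; auto.
Qed.

Lemma fin_sum_seq f x (s : seq I) : fin_sum f x -> uniq s ->
  (forall i, i \notin s -> f i = 0) -> x = \sum_(i <- s) f i.
Proof.
by move=> [t [ut ft ->]] us fs; apply: sum_supp => // i _; auto.
Qed.

Lemma fin_sum_eq f x y : fin_sum f x -> fin_sum f y -> x = y.
Proof. by move=> fx [s [us fs ->]]; exact: fin_sum_seq fx us fs. Qed.

Lemma eq_fin_sum f g x : f =1 g -> fin_sum f x -> fin_sum g x.
Proof. by move=> /funext ->. Qed.

Lemma fin_sum_sub f x (s : seq I) : fin_sum f x ->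
  exists t, [/\ uniq t, {subset s <= t}, forall i, i \notin t -> f i = 0 &
    x = \sum_(i <- t) f i].
Proof.
move=> fx; have [t [ut ft _]] := fx; exists (undup (s ++ t)).
have ft' i : i \notin undup (s ++ t) -> f i = 0.
  by rewrite mem_undup mem_cat negb_or => /andP[_ /ft].
split=> //; first exact: undup_uniq.
  by move=> i si; rewrite mem_undup mem_cat si.
by apply: fin_sum_seq => //; exact: undup_uniq.
Qed.

Lemma fin_sumB f g x y : fin_sum f x -> fin_sum g y ->
  fin_sum (fun i => f i - g i) (x - y).
Proof.
move=> [s [us fs ->]] gy.
have [t [ut st gt ->]] := fin_sum_sub s gy; exists t; split=> //.
  move=> i it; rewrite gt// fs ?subr0//; apply: contra it; exact: st.
rewrite sumrB; congr (_ - _); apply: sum_supp => // i ; last by move=> _ /fs.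
by move=> /st ->.
Qed.

Lemma fin_sum0 : fin_sum (fun=> 0) 0.
Proof. by exists [::]; split=> //; rewrite big_nil. Qed.

Lemma fin_sumN f x : fin_sum f x -> fin_sum (fun i => - f i) (- x).
Proof.
move=> fx; have := fin_sumB fin_sum0 fx; rewrite sub0r; apply: eq_fin_sum => i.
exact: sub0r.
Qed.

Lemma fin_sumD f g x y : fin_sum f x -> fin_sum g y ->
  fin_sum (fun i => f i + g i) (x + y).
Proof.
move=> fx /fin_sumN gy; have := fin_sumB fx gy; rewrite opprK.
by apply: eq_fin_sum => i; rewrite opprK.
Qed.

Lemma fin_sum1 i x : fin_sum (fun j => if j == i then x else 0) x.
Proof.
exists [:: i]; split=> // [j|]; last by rewrite big_seq1 eqxx.
by rewrite inE => /negPf ->.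
Qed.

Lemma fin_sum_of_seq f (s : seq I) : uniq s ->
  fin_sum (fun i => if i \in s then f i else 0) (\sum_(i <- s) f i).
Proof.
move=> us; exists s; split=> // [i /negPf -> //|].
by apply: eq_big_seq => i ->.
Qed.

End FinSum.

Section FinSumMorph.
Variables (V W : zmodType) (g : V -> W).
Hypothesis gB : forall x y, g (x - y) = g x - g y.

Lemma morph0 : g 0 = 0. Proof. by rewrite -(subr0 0) gB subrr. Qed.
Lemma morphN x : g (- x) = - g x. Proof. by rewrite -sub0r gB morph0 sub0r. Qed.
Lemma morphD x y : g (x + y) = g x + g y.
Proof. by rewrite -[y]opprK gB !morphN opprK. Qed.
Lemma morph_sum J (s : seq J) (P : pred J) (E : J -> V) :
  g (\sum_(i <- s | P i) E i) = \sum_(i <- s | P i) g (E i).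
Proof.
elim: s => [|i s IH]; first by rewrite !big_nil morph0.
by rewrite !big_cons; case: ifP; rewrite ?morphD IH.
Qed.

Lemma fin_sum_morph (I : eqType) (f : I -> V) x :
  fin_sum f x -> fin_sum (fun i => g (f i)) (g x).
Proof.
move=> [s [us fs ->]]; exists s; split=> // [i /fs ->|]; first exact: morph0.
exact: morph_sum.
Qed.

End FinSumMorph.

Lemma fin_sum_pair (I J : eqType) (V : zmodType) (f : I -> J -> V) (g : I -> V) x :
  (forall i, fin_sum (f i) (g i)) -> (exists s : seq I, forall i j, i \notin s -> f i j = 0) ->
  fin_sum g x -> fin_sum (fun z => f z.1 z.2) x.
Proof.
move=> fg [s0 fs0] /(fin_sum_sub s0)[s [us s0s gs ->]].
have [t [ut ft]] : exists t, uniq t /\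
    forall i, i \in s -> forall j, j \notin t -> f i j = 0.
  elim: s {us s0s gs} => [|i s [t [ut ft]]]; first by exists [::].
  have [r [ur fr _]] := fg i; exists (undup (r ++ t)); split.
    exact: undup_uniq.
  move=> i'; rewrite inE => i's j.
  rewrite mem_undup mem_cat negb_or => /andP[jr jt].
  by case/orP: i's => [/eqP ->|/ft]; [apply: fr|apply].
exists [seq (i, j) | i <- s, j <- t]; split.
- by apply: allpairs_uniq => // -[? ?] [? ?] _ _ [-> ->].
- move=> [i j] /= h; case: (boolP (i \in s)) => is_; last first.
    by rewrite fs0//; apply: contra is_; exact: s0s.
  case: (boolP (j \in t)) => jt; last exact: ft is_ _ jt.
  by case/negP: h; apply/allpairsP; exists (i, j).
rewrite big_allpairs_dep /=; apply: eq_big_seq => i is_.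
by apply: fin_sum_seq (fg i) ut _ => j; exact: ft.
Qed.

Lemma fin_sum_reindex (I J : eqType) (V : zmodType) (f : I -> V) (h : J -> I)
    (h' : I -> J) x :
  cancel h h' -> cancel h' h -> fin_sum f x -> fin_sum (f \o h) x.
Proof.
move=> hK h'K [s [us fs ->]]; exists (map h' s); split.
- by rewrite map_inj_uniq//; exact: can_inj h'K.
- move=> j js; apply: fs; apply: contra js => hs.
  by apply/mapP; exists (h j).
- by rewrite big_map; apply: eq_bigr => i _ /=; rewrite h'K.
Qed.

Section Gradings.
Variables (V : zmodType) (hom : bideg -> bool -> V -> Prop).
Hypothesis gV : bigrading hom.

Lemma homD d p x y : hom d p x -> hom d p y -> hom d p (x + y).
Proof.
move=> hx hy; rewrite -[y]opprK; apply: (homB gV) => //.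
by rewrite -sub0r; apply: (homB gV) => //; exact: hom0.
Qed.

Lemma hom_sum d p I (s : seq I) (P : pred I) (E : I -> V) :
  (forall i, P i -> hom d p (E i)) -> hom d p (\sum_(i <- s | P i) E i).
Proof.
move=> hE; elim: s => [|i s IH]; first by rewrite big_nil; exact: hom0.
by rewrite big_cons; case: ifP => // Pi; apply: homD => //; apply: hE.
Qed.

Lemma components_exist (x : V) : exists c : bideg * bool -> V,
  (forall z, hom z.1 z.2 (c z)) /\ fin_sum c x.
Proof.
have [s hs ->] := hom_span gV x.
elim: s hs => [|w s IH] hs.
  by exists (fun=> 0); split=> [z|]; [exact: hom0|rewrite big_nil; exact: fin_sum0].
have [|c [hc sc]] := IH; first by move=> z zs; apply: hs; rewrite inE zs orbT.
exists (fun z => (if z == w.1 then w.2 else 0) + c z); split.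
  move=> z; apply: homD => //; case: eqP => [->|_]; last exact: hom0.
  by apply: hs; rewrite inE eqxx.
by rewrite big_cons; apply: fin_sumD => //; exact: fin_sum1.
Qed.

Definition gcomp (z : bideg * bool) (x : V) : V := projT1 (cid (components_exist x)) z.

Lemma gcomp_hom z x : hom z.1 z.2 (gcomp z x).
Proof. by rewrite /gcomp; case: cid => c /= []. Qed.

Lemma gcomp_sum x : fin_sum (gcomp^~ x) x.
Proof. by rewrite /gcomp; case: cid => c /= []. Qed.

Lemma gcomp_unique x c : (forall z, hom z.1 z.2 (c z)) -> fin_sum c x ->
  forall z, gcomp z x = c z.
Proof.
move=> hc sc z; apply/eqP; rewrite -subr_eq0; apply/eqP.
have := fin_sumB (gcomp_sum x) sc; rewrite subrr => /(fin_sum_sub [:: z]).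
move=> [s [us zs _ /esym s0]].
apply: (hom_indep gV us _ s0); last by apply: zs; rewrite inE.
by move=> w; apply: (homB gV) => //; exact: gcomp_hom.
Qed.

Lemma gcompB z x y : gcomp z (x - y) = gcomp z x - gcomp z y.
Proof.
apply: (gcomp_unique (c := fun z => gcomp z x - gcomp z y)) => [w|].
  by apply: (homB gV); exact: gcomp_hom.
by apply: fin_sumB; exact: gcomp_sum.
Qed.

Lemma gcomp_of_hom d p x : hom d p x ->
  forall z, gcomp z x = if z == (d, p) then x else 0.
Proof.
move=> hx z.
apply: (gcomp_unique (c := fun z => if z == (d, p) then x else 0)) => [w|].
  by case: eqP => [->|_] //; exact: hom0.
exact: fin_sum1.
Qed.

Lemma gcomp_id d p x : hom d p x -> gcomp (d, p) x = x.
Proof. by move=> /gcomp_of_hom ->; rewrite eqxx. Qed.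

End Gradings.

Definition shift_deg (z w : bideg * bool) : bideg * bool := (z.1 + w.1, z.2 (+) w.2).
Definition unshift_deg (z w : bideg * bool) : bideg * bool := (z.1 - w.1, z.2 (+) w.2).

Lemma shiftK w : cancel (shift_deg^~ w) (unshift_deg^~ w).
Proof. by move=> [d p]; rewrite /unshift_deg /shift_deg /= addrK addbK. Qed.
Lemma unshiftK w : cancel (unshift_deg^~ w) (shift_deg^~ w).
Proof. by move=> [d p]; rewrite /unshift_deg /shift_deg /= subrK addbK. Qed.

Section ShiftMorph.
Variables (V W : zmodType) (homV : bideg -> bool -> V -> Prop).
Variables (homW : bideg -> bool -> W -> Prop).
Hypotheses (gV : bigrading homV) (gW : bigrading homW).
Variables (f : V -> W) (w : bideg * bool).
Hypothesis fB : forall x y, f (x - y) = f x - f y.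
Hypothesis fhom : forall d p x, homV d p x -> homW (d + w.1) (p (+) w.2) (f x).

(** Homogeneous components are unique, so a map that shifts degrees commutes with taking them. *)
Lemma gcomp_morph z x : gcomp gW z (f x) = f (gcomp gV (unshift_deg z w) x).
Proof.
apply: (gcomp_unique gW (c := fun z => f (gcomp gV (unshift_deg z w) x))) => [u|].
  have := fhom (gcomp_hom gV (unshift_deg u w) x).
  by rewrite /= subrK addbK.
apply: (fin_sum_reindex (h := unshift_deg^~ w) (h' := shift_deg^~ w)
  (f := fun z => f (gcomp gV z x))).
- exact: unshiftK.
- exact: shiftK.
- exact/(fin_sum_morph fB)/gcomp_sum.
Qed.

End ShiftMorph.

(** Y is the direct sum of the images of copies of X, the i-th one shifted by
deg i. *)
Definition gdecomp (I : eqType) (X Y : zmodType)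
    (homX : bideg -> bool -> X -> Prop) (homY : bideg -> bool -> Y -> Prop)
    (deg : I -> bideg * bool) (iota : I -> X -> Y) : Prop :=
  [/\ forall i x y, iota i (x - y) = iota i x - iota i y,
      forall i d p x, homX d p x ->
        homY (d + (deg i).1) (p (+) (deg i).2) (iota i x),
      forall y, exists c, fin_sum (fun i => iota i (c i)) y &
      forall c, fin_sum (fun i => iota i (c i)) 0 -> forall i, c i = 0].

Section Decompositions.
Variables (I : eqType) (X Y : zmodType).
Variables (homX : bideg -> bool -> X -> Prop) (homY : bideg -> bool -> Y -> Prop).
Variables (deg : I -> bideg * bool) (iota : I -> X -> Y).
Hypothesis D : gdecomp homX homY deg iota.

Let iotaB : forall i x y, iota i (x - y) = iota i x - iota i y.
Proof. by case: D. Qed.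

Lemma gcoord_exists (y : Y) : exists c, fin_sum (fun i => iota i (c i)) y.
Proof. by case: D. Qed.

Definition gcoord (i : I) (y : Y) : X := projT1 (cid (gcoord_exists y)) i.

Lemma gcoord_sum y : fin_sum (fun i => iota i (gcoord i y)) y.
Proof. by rewrite /gcoord; case: cid. Qed.

Lemma gcoord_unique y c : fin_sum (fun i => iota i (c i)) y ->
  forall i, gcoord i y = c i.
Proof.
move=> sc i; apply/eqP; rewrite -subr_eq0; apply/eqP.
have := fin_sumB (gcoord_sum y) sc; rewrite subrr.
case: D => _ _ _ /(_ (fun i => gcoord i y - c i)) h s0; apply: h.
by apply: eq_fin_sum s0 => j; rewrite iotaB.
Qed.

Lemma gcoordB i x y : gcoord i (x - y) = gcoord i x - gcoord i y.
Proof.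
apply: (gcoord_unique (c := fun i => gcoord i x - gcoord i y)).
apply: eq_fin_sum (fin_sumB (gcoord_sum x) (gcoord_sum y)) => j.
by rewrite iotaB.
Qed.

Lemma gcoord_iota i j x : gcoord j (iota i x) = if j == i then x else 0.
Proof.
apply: (gcoord_unique (c := fun j => if j == i then x else 0)).
apply: eq_fin_sum (fin_sum1 i (iota i x)) => k.
by case: eqP => [->|_] //; rewrite (morph0 (iotaB k)).
Qed.

Lemma gcoord_supp y : exists2 s : seq I, uniq s & forall i, i \notin s -> gcoord i y = 0.
Proof.
have [s [us ys _]] := gcoord_sum y; exists s => // i /ys e.
by have := gcoord_iota i i (gcoord i y); rewrite e eqxx => <-; rewrite (morph0 (gcoordB i)).
Qed.

Lemma gcoord_inj x y : (forall i, gcoord i x = gcoord i y) -> x = y.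
Proof.
move=> e; apply: fin_sum_eq (gcoord_sum x) _.
by apply: eq_fin_sum (gcoord_sum y) => i; rewrite e.
Qed.

(** The homogeneous components of the coordinates of y are the coordinates of the components
of y. *)
Lemma gcoord_hom (gX : bigrading homX) (gY : bigrading homY) d p y i :
  homY d p y -> homX (d - (deg i).1) (p (+) (deg i).2) (gcoord i y).
Proof.
move=> hy.
rewrite (gcoord_unique (c := fun i => gcomp gX (unshift_deg (d, p) (deg i)) (gcoord i y))).
  exact: gcomp_hom.
rewrite -[X in fin_sum _ X](gcomp_id gY hy).
apply: eq_fin_sum (fin_sum_morph (gcompB gY (d, p)) (gcoord_sum y)) => j.
have [_ ih _ _] := D.
exact: gcomp_morph (iotaB j) (ih j) _ _.
Qed.

(** On an odd basis element, the left and the right action of Omega_k differ by the parity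
automorphism; this lemma passes from a decomposition for one to a decomposition for the
other. *)
Lemma gdecomp_precomp (h : I -> X -> X) :
  (forall i x y, h i (x - y) = h i x - h i y) -> (forall i x, h i (h i x) = x) ->
  (forall i d p x, homX d p x -> homX d p (h i x)) ->
  gdecomp homX homY deg (fun i x => iota i (h i x)).
Proof.
move=> hB hK hh; split=> [i x y|i d p x hx|y|c c0 i].
- by rewrite hB iotaB.
- by case: D => _ + _ _; apply; apply: hh.
- exists (fun i => h i (gcoord i y)); apply: eq_fin_sum (gcoord_sum y) => i.
  by rewrite hK.
have {}c0 : h i (c i) = 0 by case: D => _ _ _ /(_ (fun i => h i (c i)))-> .
by rewrite -[c i](hK i) c0 (morph0 (hB i)).
Qed.

End Decompositions.

Section Composition.
Variables (I J : eqType) (X Y Z : zmodType).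
Variables (homX : bideg -> bool -> X -> Prop) (homY : bideg -> bool -> Y -> Prop).
Variables (homZ : bideg -> bool -> Z -> Prop).
Variables (degI : I -> bideg * bool) (iota : I -> Y -> Z).
Variables (degJ : J -> bideg * bool) (kappa : J -> X -> Y).
Hypotheses (D : gdecomp homY homZ degI iota) (E : gdecomp homX homY degJ kappa).

Lemma gdecomp_comp : gdecomp homX homZ
  (fun z : I * J => shift_deg (degJ z.2) (degI z.1)) (fun z x => iota z.1 (kappa z.2 x)).
Proof.
have [iB ih is_ ii] := D; have [kB kh ks ki] := E.
split=> [[i j] x y|[i j] d p x hx|z|c c0 [i j]] /=.
- by rewrite kB iB.
- by rewrite addrA addbA; apply: ih; apply: kh.
- exists (fun w => gcoord E w.2 (gcoord D w.1 z)).
  apply: (fin_sum_pair (f := fun i j => iota i (kappa j (gcoord E j (gcoord D i z))))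
    (g := fun i => iota i (gcoord D i z))); last exact: gcoord_sum.
    by move=> i; apply: (fin_sum_morph (iB i)); exact: gcoord_sum.
  have [s _ sz] := gcoord_supp D z; exists s => i j /sz ->.
  by rewrite (morph0 (gcoordB E j)) (morph0 (kB j)) (morph0 (iB i)).
have [s [us cs /esym s0]] := c0.
have c0' i' j' : (i', j') \notin s -> c (i', j') = 0.
  move=> /cs /= e; have := ki (fun j => if j == j' then c (i', j') else 0).
  move=> /(_ _ j'); rewrite eqxx; apply.
  have := ii (fun i => if i == i' then kappa j' (c (i', j')) else 0).
  move=> /(_ _ i'); rewrite eqxx => h.
  have k0 : kappa j' (c (i', j')) = 0.
    apply: h; rewrite -e; apply: eq_fin_sum (fin_sum1 i' _) => k.
    by case: eqP => [->|_] //; rewrite (morph0 (iB k)).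
  rewrite -k0; apply: eq_fin_sum (fin_sum1 j' _) => k.
  by case: eqP => [->|_] //; rewrite (morph0 (kB k)).
pose t := undup (map snd s).
pose y i := \sum_(j <- t) kappa j (c (i, j)).
have jt i' j' : j' \notin t -> c (i', j') = 0.
  move=> j't; apply: c0'; apply: contra j't => ij.
  by rewrite mem_undup; apply/mapP; exists (i', j').
have sy i' : fin_sum (fun j => kappa j (c (i', j))) (y i').
  exists t; split=> //; first exact: undup_uniq.
  by move=> j' /jt ->; exact: (morph0 (kB j')).
have y0 : forall i, y i = 0.
  apply: ii.
  pose r := undup (map fst s); exists r; split.
  - exact: undup_uniq.
  - move=> i' i'r; rewrite /y big1 ?(morph0 (iB i'))// => j' _.
    rewrite c0' ?(morph0 (kB j'))//; apply: contra i'r => ij.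
    by rewrite mem_undup; apply/mapP; exists (i', j').
  rewrite -[LHS]s0 /y; under [RHS]eq_bigr => i' _ do rewrite (morph_sum (iB i')).
  transitivity (\sum_(z <- [seq (i, j) | i <- r, j <- t]) iota z.1 (kappa z.2 (c z)));
    last by rewrite big_allpairs_dep.
  apply: sum_supp => // [|[i' j'] ij|[i' j'] _ /cs//].
  - apply: allpairs_uniq; try exact: undup_uniq.
    by move=> [? ?] [? ?] _ _ [-> ->].
  - case/negP; apply/allpairsP; exists (i', j'); split=> //=.
      by rewrite mem_undup; apply/mapP; exists (i', j').
    by rewrite mem_undup; apply/mapP; exists (i', j').
by apply: (ki (fun j => c (i, j))); rewrite -(y0 i).
Qed.

End Composition.

(** * Dimensions and characters of graded modules *)

Section DecompositionDimension.
Variables (F : fieldType) (I : eqType) (X Y : lmodType F).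
Variables (homX : bideg -> bool -> X -> Prop) (homY : bideg -> bool -> Y -> Prop).
Variables (deg : I -> bideg * bool) (iota : I -> X -> Y).
Hypotheses (gX : bigrading homX) (gY : bigrading homY).
Hypothesis D : gdecomp homX homY deg iota.
Hypothesis iotaZ : forall i a x, iota i (a *: x) = a *: iota i x.
Hypothesis subY : forall d p, subspace (homY d p).
Variable N : bideg -> bool -> nat.
Hypothesis dimX : forall d p, has_dim (homX d p) (N d p).

(** Only the copies whose index lies in s contribute in degree (d, p); a basis is obtained by
listing bases of their components. *)
Lemma has_dim_gdecomp d p (s : seq I) : uniq s ->
  (forall i, i \notin s -> N (d - (deg i).1)%R (p (+) (deg i).2) = 0%N) ->
  has_dim (homY d p) (\sum_(i <- s) N (d - (deg i).1)%R (p (+) (deg i).2)).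
Proof.
move=> us sN.
pose P (t : seq I) (y : Y) := homY d p y /\ forall i, i \notin t -> gcoord D i y = 0.
have iB i : forall x y, iota i (x - y) = iota i x - iota i y by case: D.
have ih i e o x : homX e o x -> homY (e + (deg i).1) (o (+) (deg i).2) (iota i x).
  by case: D => _ h _ _; exact: h.
have iZ n (b : 'I_n -> X) i c : iota i (lincomb b c) = lincomb (iota i \o b) c.
  rewrite /lincomb (morph_sum (iB i)); apply: eq_bigr => j _; exact: iotaZ.
suff {sN} : forall t, uniq t ->
    has_dim (P t) (\sum_(i <- t) N (d - (deg i).1)%R (p (+) (deg i).2)).
  move=> /(_ s us); apply: has_dim_ext => y; split=> [[]//|hy]; split=> // i /sN Ni.
  have := gcoord_hom D gX gY i hy.
  have [b [_ sb _]] := dimX (d - (deg i).1)%R (p (+) (deg i).2).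
  move=> /sb[c /eqP]; rewrite subr_eq0 => /eqP ->.
  by move: b sb c; rewrite Ni => b _ c; rewrite /lincomb big_ord0.
elim=> [_|i t IH /=/andP[it ut]].
  rewrite big_nil; exists (fun=> 0); split=> [[]//|y [_ y0]|c _ []//].
  exists (fun=> 0); rewrite /lincomb big_ord0 subr0.
  apply: (gcoord_inj (D := D)) => i; rewrite y0// (morph0 (gcoordB D i))//.
rewrite big_cons addnC.
have [b [hb sb fb]] := dimX (d - (deg i).1)%R (p (+) (deg i).2).
apply: (has_dim_mod (b := iota i \o b) _ _ _ (IH ut)).
- split=> [|a x y [hx x0] [hy y0]].
    by split=> [|j _]; [exact: hom0|exact: (morph0 (gcoordB D j))].
  split=> [|j jt]; first by case: (subY d p) => _; apply.
  rewrite (morphD (gcoordB D j)) y0// addr0.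
  rewrite (gcoord_unique D (c := fun j => a *: gcoord D j x)) ?x0 ?scaler0//.
  have aB : forall x y : Y, a *: (x - y) = a *: x - a *: y by exact: scalerBr.
  apply: eq_fin_sum (fin_sum_morph aB (gcoord_sum D x)) => k.
  by rewrite iotaZ.
- by move=> y [hy y0]; split=> // j; rewrite inE negb_or => /andP[_ /y0].
split=> [j|y [hy y0]|c].
- split=> [|l]; first by have := ih i _ _ _ (hb j); rewrite subrK addbK.
  by rewrite inE negb_or gcoord_iota => /andP[/negPf -> _].
- have /sb[c /eqP] := gcoord_hom D gX gY i hy; rewrite subr_eq0 => /eqP e.
  exists c; rewrite -iZ -e; split=> [|j jt].
    apply: (homB gY) => //; have := ih i _ _ _ (gcoord_hom D gX gY i hy).
    by rewrite subrK addbK.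
  rewrite gcoordB gcoord_iota; case: eqP => [->|/eqP ji]; first exact: subrr.
  by rewrite y0 ?subr0// inE negb_or ji.
rewrite -iZ => -[_ /(_ i it)]; rewrite gcoord_iota eqxx; exact: fb.
Qed.

End DecompositionDimension.

(** An alias, which keeps the rational structure apart from the action of Omega_k. *)
Definition qmod k (M : lmodType (Omega k)) : Type := M.

Definition Oconst k (c : rat) : Omega k := ext_const k c%:MP.

Section ExtConst.
Variables (R : comNzRingType) (n : nat).

Lemma ext_constM (a c : R) : ext_const n (a * c) = ext_const n a * ext_const n c :> extalg R n.
Proof.
apply/ffunP => U; rewrite [RHS](ext_mulE _ _ U) (bigD1 set0)//= [X in _ + X]big1 => [|V /negPf V0].
  rewrite addr0 (bigD1 set0)//= [X in _ + X]big1 => [|W /negPf W0].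
    rewrite addr0 set0U ext_sign0l !ffunE eqxx mul1r eq_sym.
    by case: eqP; rewrite ?mul1r ?mul0r.
  by rewrite [ext_const _ _ W]ffunE W0 !mulr0.
by rewrite big1// => W _; rewrite [ext_const _ _ V]ffunE V0 mul0r !mulr0.
Qed.

Lemma ext_constD (a c : R) : ext_const n (a + c) = ext_const n a + ext_const n c.
Proof. by apply/ffunP => U; rewrite !ffunE; case: eqP; rewrite ?addr0. Qed.

Lemma ext_constB (a c : R) : ext_const n (a - c) = ext_const n a - ext_const n c.
Proof. by apply/ffunP => U; rewrite !ffunE; case: eqP; rewrite ?subr0. Qed.

Lemma ext_constE (a : R) (f : extalg R n) (U : {set 'I_n}) :
  (ext_const n a * f) U = a * f U.
Proof.
rewrite [LHS](ext_mulE _ _ U) (bigD1 set0)//= [X in _ + X]big1 => [|V /negPf V0].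
  rewrite addr0 (bigD1 U)//= [X in _ + X]big1 => [|W /negPf W0].
    by rewrite addr0 set0U eqxx ext_sign0l !mul1r ffunE eqxx.
  by rewrite set0U W0 mul0r.
by rewrite big1// => W _; rewrite [ext_const _ _ V]ffunE V0 mul0r !mulr0.
Qed.

Lemma ext_constC (a : R) (f : extalg R n) : ext_const n a * f = f * ext_const n a.
Proof.
apply/ffunP => U; rewrite ext_constE [RHS](ext_mulE _ _ U) exchange_big.
rewrite (bigD1 set0)//= [X in _ + X]big1 => [|V /negPf V0].
  rewrite addr0 (bigD1 U)//= [X in _ + X]big1 => [|W /negPf W0].
    by rewrite addr0 setU0 eqxx ext_sign0r !mul1r ffunE eqxx mulrC.
  by rewrite setU0 W0 mul0r.
by rewrite big1// => W _; rewrite [ext_const _ _ V]ffunE V0 !mulr0.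
Qed.

End ExtConst.

Section QMod.
Variables (k : nat) (M : lmodType (Omega k)).

HB.instance Definition _ := GRing.Zmodule.on (qmod M).

Definition qscale (c : rat) (x : qmod M) : qmod M := (Oconst k c : Omega k) *: (x : M).

Fact qscaleA a c x : qscale a (qscale c x) = qscale (a * c) x.
Proof. by rewrite /qscale scalerA /Oconst mpolyCM ext_constM. Qed.
Fact qscale1 : left_id 1 qscale.
Proof. by move=> x; rewrite /qscale /Oconst mpolyC1; exact: scale1r. Qed.
Fact qscaleDr : right_distributive qscale +%R.
Proof. by move=> a x y; rewrite /qscale scalerDr. Qed.
Fact qscaleDl x : {morph qscale^~ x : a c / a + c}.
Proof. by move=> a c; rewrite /qscale /Oconst mpolyCD ext_constD scalerDl. Qed.

HB.instance Definition _ := GRing.Zmodule_isLmodule.Build rat (qmod M)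
  qscaleA qscale1 qscaleDr qscaleDl.

Lemma qscaleE (c : rat) (x : qmod M) : c *: x = ((Oconst k c : Omega k) *: (x : M)).
Proof. by []. Qed.

End QMod.

Definition qhom k (M : gsmod k) (d : bideg) (p : bool) : qmod M -> Prop :=
  @ghom k M d p.
Arguments qhom {k} M d p.

Lemma Oconst_hom k c : Omega_hom 0 false (Oconst k c).
Proof.
move=> U a; rewrite ffunE; case: eqP => [->|_]; last by rewrite msupp0.
rewrite msuppC; case: eqP => // _; rewrite inE => /eqP ->.
rewrite /mon_deg cards0 big_set0 subr0 muln0; split=> //.
by congr (_, _); rewrite big1// => i _; rewrite mnm0E.
Qed.

Section ModuleDimension.
Variable k : nat.
Implicit Types (M N : gsmod k).

Lemma qhom_subspace M d p : subspace (qhom M d p).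
Proof.
split=> [|a x y hx hy]; first exact: (hom0 (gbigrading M)).
apply: (homD (gbigrading M)) => //; rewrite qscaleE.
by have := gaction (@Oconst_hom k a) hx; rewrite add0r addFb.
Qed.

Definition gdim M d p : nat := xget 0%N (has_dim (qhom M d p)).

Lemma gdimP M d p n : has_dim (qhom M d p) n -> gdim M d p = n.
Proof.
move=> h; rewrite /gdim; case: xgetP => [m _ hm|/(_ n)//].
exact: has_dim_unique hm h.
Qed.

Lemma locally_finiteP M :
  locally_finite M <-> forall d p, has_dim (qhom M d p) (gdim M d p).
Proof.
split=> [lf d p|h d p].
  have [n [b hb]] := lf d p.
  have [|m hm] := @has_dim_exists _ (qmod M) (qhom M d p) n b; last by rewrite (gdimP hm).
  exact: hb.
have [b [_ sb _]] := h d p; exists (gdim M d p), b => x /sb[c /eqP].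
by rewrite subr_eq0 => /eqP e; exists c.
Qed.

Lemma gdim_gsupp M d p : locally_finite M -> gdim M d p <> 0%N -> gsupp M d.
Proof.
move=> /locally_finiteP/(_ d p)[b [hb _ fb]] n0.
have i0 : 'I_(gdim M d p) by apply: (Ordinal (n := gdim M d p) (m := 0)); case: gdim n0.
exists p, (b i0); split; first exact: hb.
move=> e; have := fb (fun i => (i == i0)%:R) _ i0; rewrite eqxx => h.
have /eqP : (1 : rat) = 0 by apply: h; rewrite /lincomb (bigD1 i0)//= e scaler0 add0r
  big1// => i /negPf ->; rewrite scale0r.
by rewrite oner_eq0.
Qed.

Lemma not_gsupp_gdim M d p : locally_finite M -> ~ gsupp M d -> gdim M d p = 0%N.
Proof. by move=> lf nd; apply: contrapT => /(gdim_gsupp lf). Qed.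

(** The specialization at pi = -1 of the graded dimension. *)
Definition ch b M : laurent b rat :=
  mk_laurent b (fun d => (gdim M d false)%:R - (gdim M d true)%:R).

End ModuleDimension.

Lemma mk_laurentE b (R : zmodType) (f : bideg -> R) d :
  laurent_supp b (fun d => f d <> 0) -> mk_laurent b f d = f d.
Proof. by rewrite /mk_laurent; case: pselect. Qed.

(** For b = false these are the modules counted by Ghat_0, for b = true those counted by G_0. *)
Definition admissible b k (M : gsmod k) : Prop :=
  locally_finite M /\ laurent_supp b (gsupp M).

Lemma chE b k (M : gsmod k) d : admissible b M ->
  ch b M d = (gdim M d false)%:R - (gdim M d true)%:R.
Proof.
move=> [lf sM]; apply: mk_laurentE; apply: laurent_supp_sub sM => e.
have [//|ne] := pselect (gsupp M e).
by rewrite !(not_gsupp_gdim _ lf ne) subrr.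
Qed.

Definition index_series b (n : bideg -> bool -> nat) : laurent b rat :=
  mk_laurent b (fun d => (n d false)%:R - (n d true)%:R).

Section DecompositionCharacter.
Variables (b : bool) (k k' : nat) (I : eqType) (M : gsmod k) (N : gsmod k').
Variables (deg : I -> bideg * bool) (iota : I -> M -> N).
Hypothesis D : gdecomp (@ghom k M) (@ghom k' N) deg iota.
Hypothesis iotaZ : forall i a x, iota i (Oconst k a *: x) = Oconst k' a *: iota i x.
Hypothesis aM : admissible b M.
Hypothesis sI : laurent_supp b (fun e => exists i, (deg i).1 = e).
Variable fibre : bideg -> bool -> seq I.
Hypothesis fibre_uniq : forall e o, uniq (fibre e o).
Hypothesis fibreP : forall e o i, (i \in fibre e o) = (deg i == (e, o)).

Let dec_dim d (S : seq bideg) : uniq S ->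
  (forall e, (exists i, (deg i).1 = e) -> gsupp M (d - e)%R -> e \in S) ->
  forall p, has_dim (qhom N d p) (\sum_(e <- S) \sum_(o <- [:: false; true])
     size (fibre e o) * gdim M (d - e)%R (p (+) o)).
Proof.
move=> uS hS p; have [lf _] := aM.
pose T := [seq (e, o) | e <- S, o <- [:: false; true]].
have uT : uniq T by apply: allpairs_uniq => // -[? ?] [? ?] _ _ [-> ->].
pose s := flatten [seq fibre z.1 z.2 | z <- T].
have us : uniq s.
  rewrite /s; elim: {s}T uT => //= z T IH /andP[zT uT].
  rewrite cat_uniq fibre_uniq IH// andbT; apply/hasPn => i /flatten_mapP[w wT].
  rewrite fibreP => /eqP iw; apply/negP; rewrite fibreP iw => /eqP e.
  by case/negP: zT; rewrite [z]surjective_pairing -e -surjective_pairing.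
have -> : (\sum_(e <- S) \sum_(o <- [:: false; true])
     size (fibre e o) * gdim M (d - e)%R (p (+) o) =
   \sum_(i <- s) gdim M (d - (deg i).1)%R (p (+) (deg i).2))%N.
  rewrite /s big_flatten big_map /T big_allpairs_dep /=.
  apply: eq_bigr => e _; apply: eq_bigr => o _.
  rewrite big_seq (eq_bigr (fun=> gdim M (d - e)%R (p (+) o))).
    by rewrite -big_seq big_const_seq count_predT iter_addn_0 mulnC.
  by move=> i; rewrite fibreP => /eqP ->.
apply: (@has_dim_gdecomp _ I (qmod M) (qmod N) (qhom M) (qhom N) deg iota
  (gbigrading M) (gbigrading N) D iotaZ (@qhom_subspace k' N) (@gdim k M)) => //.
  exact/locally_finiteP.
move=> i is_; apply: (not_gsupp_gdim _ lf) => sd; case/negP: is_.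
apply/flatten_mapP; exists (deg i); last by rewrite fibreP -surjective_pairing.
apply/allpairsP; exists (deg i); split; last by case: (deg i).
  by apply: hS => //; exists i.
by case: (deg i).2; rewrite !inE.
Qed.

Lemma gdecomp_admissible : admissible b N.
Proof.
have [lf sM] := aM; split.
  apply/locally_finiteP => d p; have [S uS hS] := laurent_conv_fin d sI sM.
  by have h := dec_dim uS hS p; rewrite (gdimP h).
apply: laurent_supp_sub (laurent_supp_add sI sM) => d [p [x [hx x0]]].
apply: contrapT => nd; apply: x0; apply: (gcoord_inj (D := D)) => i.
rewrite (morph0 (gcoordB D i)); apply: contrapT => c0; apply: nd.
exists (deg i).1; split; first by exists i.
exists (p (+) (deg i).2), (gcoord D i x); split=> //.
exact: (gcoord_hom D (gbigrading M) (gbigrading N) i hx).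
Qed.

(** A fibre lists the finitely many copies with a given shift, so the dimensions of Y are
convolutions of those of X with the sizes of the fibres. *)
Lemma ch_gdecomp :
  ch b N = index_series b (fun e o => size (fibre e o)) * ch b M.
Proof.
apply: laurent_eq => d; have [lf sM] := aM.
have fib0 e o : ~ (exists i, (deg i).1 = e) -> fibre e o = [::].
  move=> ne; case: (fibre e o) (fibreP e o) => // i s /(_ i).
  by rewrite inE eqxx => /esym/eqP de; case: ne; exists i; rewrite de.
have iE e : index_series b (fun e o => size (fibre e o)) e =
    (size (fibre e false))%:R - (size (fibre e true))%:R.
  apply: mk_laurentE; apply: laurent_supp_sub sI => e' h.
  by apply: contrapT => ne; apply: h; rewrite !fib0// subrr.
have [S uS hS] := laurent_conv_fin d sI sM.
rewrite [RHS](lconvE (s := S))//; last first.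
  move=> e fe Me; apply: hS.
    apply: contrapT => ne; apply: fe; rewrite iE.
    by rewrite !fib0// subrr.
  apply: contrapT => ne; apply: Me; rewrite chE//.
  by rewrite !(not_gsupp_gdim _ lf ne) subrr.
rewrite (chE _ gdecomp_admissible) !(gdimP (dec_dim uS hS _)).
rewrite !natr_sum -sumrB; apply: eq_bigr => e _.
rewrite iE chE// !big_cons !big_nil /= !natrD !natrM; ring.
Qed.

End DecompositionCharacter.

(** * Exterior algebras and their homomorphisms *)

Section ExtAlgebra.
Variables (R : comNzRingType) (n : nat).
Implicit Types (U V W : {set 'I_n}) (f g : extalg R n).

Fact ext_const_is_zmod_morphism : zmod_morphism (ext_const n : R -> extalg R n).
Proof. exact: ext_constB. Qed.
Fact ext_const_is_monoid_morphism : monoid_morphism (ext_const n : R -> extalg R n).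
Proof. by split=> // a c; exact: ext_constM. Qed.

HB.instance Definition _ := GRing.isZmodMorphism.Build R (extalg R n)
  (ext_const n : R -> extalg R n) ext_const_is_zmod_morphism.
HB.instance Definition _ := GRing.isMonoidMorphism.Build R (extalg R n)
  (ext_const n : R -> extalg R n) ext_const_is_monoid_morphism.

Definition ext_mono U : extalg R n := [ffun V => (V == U)%:R].

Lemma ext_mono0 : ext_mono set0 = 1.
Proof. by apply/ffunP => U; rewrite !ffunE; case: eqP. Qed.

Lemma ext_mono_gen j : ext_mono [set j] = ext_gen R j.
Proof. by []. Qed.

Lemma ext_expand f : f = \sum_U ext_const n (f U) * ext_mono U.
Proof.
apply/ffunP => V; rewrite sum_ffunE (bigD1 V)//= [X in _ + X]big1 => [|U /negPf UV].
  by rewrite ext_constE ffunE eqxx mulr1 addr0.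
by rewrite ext_constE ffunE eq_sym UV mulr0.
Qed.

Lemma ext_monoM V W :
  ext_mono V * ext_mono W = ext_const n (ext_sign R V W) * ext_mono (V :|: W).
Proof.
apply/ffunP => U; rewrite [LHS](ext_mulE _ _ U) (bigD1 V)//= [X in _ + X]big1 => [|A /negPf AV].
  rewrite addr0 (bigD1 W)//= [X in _ + X]big1 => [|B /negPf BW].
    by rewrite ext_constE !ffunE !eqxx !mulr1 addr0 mulrC eq_sym.
  by rewrite [ext_mono W B]ffunE BW !mulr0.
by rewrite big1// => B _; rewrite [ext_mono V A]ffunE AV mul0r !mulr0.
Qed.

Lemma ext_sign_min (j : 'I_n) V : (forall b, b \in V -> (j < b)%N) -> ext_sign R [set j] V = 1.
Proof.
move=> jV; rewrite /ext_sign disjoints1; case: (boolP (j \in V)) => [/jV|_ /=].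
  by rewrite ltnn.
rewrite /inversions big_set1 big1 ?expr0// => b /jV jb.
by rewrite ltnNge ltnW.
Qed.

(** Induction by insertion of a new least element, the order in which the monomials of the
exterior algebra are written. *)
Lemma set_min_ind (P : {set 'I_n} -> Prop) : P set0 ->
  (forall (j : 'I_n) V, (forall b, b \in V -> (j < b)%N) -> P V -> P (j |: V)) -> forall V, P V.
Proof.
move=> P0 PS V; have [m] := ubnP #|V|; elim: m V => // m IH V Vm.
have [->//|/set0Pn[i iV]] := eqVneq V set0.
case: (arg_minnP (fun j : 'I_n => j : nat) iV) => j jV jmin.
rewrite -(setD1K jV); apply: PS => [b|].
  by rewrite !inE => /andP[bj bV]; rewrite ltn_neqAle jmin// eq_sym andbT.
by apply: IH; move: Vm; rewrite (cardsD1 j V) [j \in V]jV.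
Qed.

End ExtAlgebra.

Arguments ext_mono R {n} U.

(** ** The homomorphism given by anticommuting images of the generators *)
Section Universal.
Variables (R R' : comNzRingType) (n n' : nat).
Variables (phi : {rmorphism R -> R'}) (t : 'I_n -> extalg R' n').
Hypothesis tC : forall i j, t i * t j = - (t j * t i).
Hypothesis tt : forall i, t i * t i = 0.

Definition ext_prod (U : {set 'I_n}) : extalg R' n' := \prod_(j in U) t j.

Let tprod_seq (V : {set 'I_n}) j (r : seq 'I_n) :
  t j * \prod_(i <- r | i \in V) t i =
  (-1) ^+ count (mem V) r * \prod_(i <- r | i \in V) t i * t j.
Proof.
elim: r => [|i r IH]; first by rewrite !big_nil expr0 !mul1r mulr1.
rewrite !big_cons /=; case: ifP => iV /=; last by rewrite add0n IH.
set Q := \prod_(i <- r | i \in V) t i in IH *.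
have -> : t j * (t i * Q) = - (t i * (t j * Q)) by rewrite mulrA tC mulNr mulrA.
rewrite IH add1n exprS mulN1r !mulNr; congr (- _).
by rewrite !mulrA; congr (_ * _ * _); rewrite commr_sign.
Qed.

Let index_enum_split (j : 'I_n) : exists r1 r2, index_enum 'I_n = r1 ++ j :: r2 /\
  (forall i, i \in r1 -> (i < j)%N) /\ (forall i, i \in r2 -> (j < i)%N).
Proof.
have : sorted (fun a b : 'I_n => (a < b)%N) (index_enum 'I_n).
  by have := iota_ltn_sorted 0 n; rewrite -val_enum_ord enumT sorted_map.
rewrite sorted_pairwise; last by move=> a b c; exact: ltn_trans.
case/splitPr: (mem_index_enum j) => r1 r2; rewrite pairwise_cat /= => /and3P[ar _ /andP[jr _]].
exists r1, r2; split=> //; split=> i ir; last by move/allP/(_ i ir): jr.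
by move/allrelP/(_ i j ir): ar; apply; rewrite inE eqxx.
Qed.

(** Moving t j to its place past the smaller factors produces the sign that defines the
product of the exterior algebra. *)
Lemma gen_ext_prod j V :
  t j * ext_prod V = ext_const n' (ext_sign R' [set j] V) * ext_prod (j |: V).
Proof.
have [r1 [r2 [e [lt1 lt2]]]] := index_enum_split j.
rewrite /ext_prod e !big_cat /= mulrA tprod_seq -!mulrA !big_cons.
have q1 : \prod_(i <- r1 | i \in j |: V) t i = \prod_(i <- r1 | i \in V) t i.
  rewrite big_seq_cond [RHS]big_seq_cond; apply: eq_bigl => i; rewrite !inE.
  by case: (boolP (i \in r1)) => //= /lt1; case: eqP => // ->; rewrite ltnn.
have q2 : \prod_(i <- r2 | i \in j |: V) t i = \prod_(i <- r2 | i \in V) t i.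
  rewrite big_seq_cond [RHS]big_seq_cond; apply: eq_bigl => i; rewrite !inE.
  by case: (boolP (i \in r2)) => //= /lt2; case: eqP => // ->; rewrite ltnn.
rewrite q1 q2 setU11 /ext_sign disjoints1; case: (boolP (j \in V)) => jV /=.
  by rewrite (mulrA (t j)) tt mul0r !mulr0 rmorph0 mul0r.
rewrite rmorphXn rmorphN1; congr (_ ^+ _ * _).
rewrite /inversions big_set1 e big_cat big_cons /= (negPf jV).
rewrite [X in (_ + X)%N]big1_seq ?addn0; last first.
  by move=> i /andP[_ /lt2 ij]; rewrite ltnNge ltnW.
rewrite -sum1_count big_seq_cond [RHS]big_seq_cond.
by apply: eq_bigr => i /andP[/lt1 ->].
Qed.

Lemma ext_prodM V W :
  ext_prod V * ext_prod W = ext_const n' (ext_sign R' V W) * ext_prod (V :|: W).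
Proof.
elim/set_min_ind: V => [|j V jV IH].
  by rewrite ext_sign0l set0U rmorph1 mul1r /ext_prod big_set0 mul1r.
have jp : ext_prod (j |: V) = t j * ext_prod V.
  by rewrite gen_ext_prod ext_sign_min// rmorph1 mul1r.
rewrite jp -mulrA IH mulrA -ext_constC -mulrA gen_ext_prod mulrA -rmorphM setUA.
congr (ext_const _ _ * _).
by have := ext_signA R' [set j] V W; rewrite ext_sign_min// mul1r => ->.
Qed.

Definition ext_map (f : extalg R n) : extalg R' n' :=
  \sum_U ext_const n' (phi (f U)) * ext_prod U.

Fact ext_map_is_zmod_morphism : zmod_morphism ext_map.
Proof.
move=> f g; rewrite /ext_map -sumrB; apply: eq_bigr => U _.
by rewrite !ffunE !rmorphB mulrBl.
Qed.

Let ext_map_collapse (V : {set 'I_n}) (E : {set 'I_n} -> extalg R' n') :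
  \sum_U (V == U)%:R * E U = E V.
Proof.
rewrite (bigD1 V)//= eqxx mul1r big1 ?addr0// => U /negPf.
by rewrite eq_sym => ->; rewrite mul0r.
Qed.

Fact ext_map_is_monoid_morphism : monoid_morphism ext_map.
Proof.
split=> [|f g].
  rewrite /ext_map (bigD1 set0)//= big1 => [|U /negPf U0]; last first.
    by rewrite ffunE U0 !rmorph0 mul0r.
  by rewrite ffunE eqxx !rmorph1 /ext_prod big_set0 mul1r addr0.
rewrite /ext_map mulr_suml.
transitivity (\sum_V \sum_W \sum_U (V :|: W == U)%:R *
   (ext_const n' (ext_sign R' V W * phi (f V) * phi (g W)) * ext_prod U)).
  under eq_bigr => U _.
    rewrite [(f * g) U](ext_mulE f g U) !rmorph_sum mulr_suml.
    under eq_bigr => V _.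
      rewrite !rmorph_sum mulr_suml.
      under eq_bigr => W _.
        rewrite !rmorphM !rmorph_nat.
        have -> : phi (ext_sign R V W) = ext_sign R' V W.
          rewrite /ext_sign; case: ifP => _; last by rewrite rmorph0.
          by rewrite rmorphXn rmorphN1.
      over.
    over.
  over.
  rewrite exchange_big; apply: eq_bigr => V _; rewrite exchange_big.
  apply: eq_bigr => W _; apply: eq_bigr => U _ /=.
  by rewrite !rmorphM !mulrA.
apply: eq_bigr => V _; rewrite mulr_sumr; apply: eq_bigr => W _.
rewrite ext_map_collapse.
transitivity (ext_const n' (phi (f V)) * ext_const n' (phi (g W)) *
    (ext_prod V * ext_prod W)).
  by rewrite ext_prodM mulrA -!ext_constM; congr (ext_const _ _ * _); ring.
by rewrite -!mulrA; congr (_ * _); rewrite !mulrA ext_constC.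
Qed.

Lemma ext_map_const c : ext_map (ext_const n c) = ext_const n' (phi c).
Proof.
rewrite /ext_map (bigD1 set0)//= big1 => [|U /negPf U0]; last first.
  by rewrite ffunE U0 !rmorph0 mul0r.
by rewrite ffunE eqxx /ext_prod big_set0 mulr1 addr0.
Qed.

Lemma ext_map_mono U : ext_map (ext_mono R U) = ext_prod U.
Proof.
rewrite /ext_map (bigD1 U)//= big1 => [|V /negPf VU]; last first.
  by rewrite ffunE VU !rmorph0 mul0r.
by rewrite ffunE eqxx !rmorph1 mul1r addr0.
Qed.

Lemma ext_map_gen j : ext_map (ext_gen R j) = t j.
Proof. by rewrite -ext_mono_gen ext_map_mono /ext_prod big_set1. Qed.

End Universal.

Section Generators.
Variables (R : comNzRingType) (n : nat).

Lemma ext_genC (i j : 'I_n) : ext_gen R i * ext_gen R j = - (ext_gen R j * ext_gen R i).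
Proof.
rewrite -!ext_mono_gen !ext_monoM [in RHS]setUC -mulNr -rmorphN; congr (ext_const _ _ * _).
rewrite /ext_sign !disjoints1 !inE [j == i]eq_sym; case: eqVneq => [_|ij] /=.
  by rewrite oppr0.
rewrite /inversions !big_set1; move: ij; rewrite -val_eqE /=.
by case: ltngtP => // _ _; rewrite ?expr0 ?expr1 ?opprK.
Qed.

Lemma ext_gen_sqr (i : 'I_n) : ext_gen R i * ext_gen R i = 0.
Proof.
by rewrite -!ext_mono_gen ext_monoM /ext_sign disjoints1 inE eqxx rmorph0 mul0r.
Qed.

Lemma prod_ext_gen (U : {set 'I_n}) : \prod_(j in U) ext_gen R j = ext_mono R U.
Proof.
elim/set_min_ind: U => [|j V jV IH]; first by rewrite big_set0 ext_mono0.
have := gen_ext_prod ext_genC ext_gen_sqr j V.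
rewrite /ext_prod ext_sign_min// rmorph1 mul1r => <-.
by rewrite IH -ext_mono_gen ext_monoM ext_sign_min// rmorph1 mul1r.
Qed.

Lemma ext_hom_eq (S : nzRingType) (f g : {rmorphism extalg R n -> S}) :
  (forall c, f (ext_const n c) = g (ext_const n c)) ->
  (forall j, f (ext_gen R j) = g (ext_gen R j)) -> f =1 g.
Proof.
move=> fgc fgs x; rewrite [x]ext_expand !rmorph_sum; apply: eq_bigr => U _.
rewrite !rmorphM fgc; congr (_ * _).
by rewrite -prod_ext_gen !rmorph_prod; apply: eq_bigr => j _; exact: fgs.
Qed.

End Generators.

(** * Gradings of exterior algebras over polynomial rings *)

Section ExtRMorphism.
Variables (R R' : comNzRingType) (n n' : nat).
Variables (phi : {rmorphism R -> R'}) (t : 'I_n -> extalg R' n').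
Hypothesis tC : forall i j, t i * t j = - (t j * t i).
Hypothesis tt : forall i, t i * t i = 0.

Definition ext_rmorphism : {rmorphism extalg R n -> extalg R' n'} :=
  HB.pack (ext_map phi t)
   (GRing.isZmodMorphism.Build _ _ (ext_map phi t) (ext_map_is_zmod_morphism phi t))
   (GRing.isMonoidMorphism.Build _ _ (ext_map phi t) (ext_map_is_monoid_morphism phi tC tt)).

End ExtRMorphism.

Section Parity.
Variables (R : comNzRingType) (n : nat).

Lemma ext_const_mulACA c d (g h : extalg R n) :
  ext_const n c * g * (ext_const n d * h) = ext_const n (c * d) * (g * h).
Proof. by rewrite ext_constM -!mulrA; congr (_ * _); rewrite !mulrA ext_constC. Qed.

Fact ext_par_is_zmod_morphism : zmod_morphism (@ext_par R n).
Proof. by move=> f g; apply/ffunP => U; rewrite !ffunE mulrBr. Qed.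
Fact ext_par_is_monoid_morphism : monoid_morphism (@ext_par R n).
Proof. by split; [exact: ext_par1|exact: ext_parM]. Qed.

HB.instance Definition _ := GRing.isZmodMorphism.Build (extalg R n) (extalg R n)
  (@ext_par R n) ext_par_is_zmod_morphism.
HB.instance Definition _ := GRing.isMonoidMorphism.Build (extalg R n) (extalg R n)
  (@ext_par R n) ext_par_is_monoid_morphism.

Lemma ext_parK (f : extalg R n) : ext_par (ext_par f) = f.
Proof.
by apply/ffunP => U; rewrite !ffunE mulrA -exprD addnn -signr_odd odd_double mul1r.
Qed.

Lemma ext_par_const c : ext_par (ext_const n c) = ext_const n c :> extalg R n.
Proof.
by apply/ffunP => U; rewrite !ffunE; case: eqP => [->|]; rewrite ?mulr0// cards0 mul1r.
Qed.

Lemma ext_par_gen j : ext_par (ext_gen R j) = - ext_gen R j :> extalg R n.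
Proof.
apply/ffunP => U; rewrite !ffunE; case: eqP => [->|]; rewrite ?mulr0 ?oppr0//.
by rewrite cards1 mulN1r.
Qed.

Lemma ext_gen_par j (f : extalg R n) : ext_gen R j * f = ext_par f * ext_gen R j.
Proof.
have gm U : ext_gen R j * ext_mono R U = ext_par (ext_mono R U) * ext_gen R j.
  elim/set_min_ind: U => [|i V iV IH].
    by rewrite ext_mono0 rmorph1 mulr1 mul1r.
  have -> : ext_mono R (i |: V) = ext_gen R i * ext_mono R V.
    by rewrite -ext_mono_gen ext_monoM ext_sign_min// rmorph1 mul1r.
  rewrite mulrA ext_genC mulNr -[_ * _ * ext_mono R V]mulrA IH.
  by rewrite rmorphM /= ext_par_gen !mulNr mulrA.
rewrite [f]ext_expand mulr_sumr rmorph_sum mulr_suml; apply: eq_bigr => U _.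
by rewrite rmorphM /= ext_par_const mulrA -ext_constC -mulrA gm mulrA.
Qed.

End Parity.

Section ExtGrading.
Variables (m n : nat) (w : 'I_m -> int).
Notation hom := (@ext_hom m n w).
Notation T := (extalg {mpoly rat[m]} n).

Fact ext_hom_bigrading : bigrading hom.
Proof.
split=> [d p U a|d p f g hf hg U a|f|s c us hc c0 z zs].
- by rewrite ffunE msupp0.
- rewrite !ffunE => /msuppD_le; rewrite mem_cat (perm_mem (msuppN _)).
  by move=> /orP[]; [exact: hf|exact: hg].
- pose t U a : T := ext_const n ((f U)@_a *: 'X_[a]) * ext_mono {mpoly rat[m]} U.
  exists [seq (mon_deg w x.2 x.1, odd #|x.1|, t x.1 x.2)
     | x <- [seq (U, a) | U <- index_enum {set 'I_n}, a <- msupp (f U)]].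
    move=> _ /mapP[[U a] _ ->] /= V b; rewrite ext_constE ffunE; case: eqP => [->|_].
      by rewrite mulr1 => /msuppZ_le; rewrite msuppX inE => /eqP ->.
    by rewrite mulr0 msupp0.
  rewrite !big_map /= big_allpairs_dep /= [LHS]ext_expand; apply: eq_bigr => U _.
  by rewrite [f U in LHS]mpolyE rmorph_sum mulr_suml.
apply/ffunP => U; apply/mpolyP => a; rewrite ffunE mcoeff0.
case: (boolP (a \in msupp (c z U))) => [az|/memN_msupp_eq0//].
have /ffunP/(_ U)/(congr1 (mcoeff a)) := c0.
rewrite sum_ffunE ffunE raddf_sum mcoeff0 (bigD1_seq z)//= [X in _ + X]big1 ?addr0//.
move=> z' z'z; case: (boolP (a \in msupp (c z' U))) => [az'|]; last exact: memN_msupp_eq0.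
have [d1 p1] := hc z' U a az'; have [d2 p2] := hc z U a az.
case/eqP: z'z; rewrite [z']surjective_pairing [z]surjective_pairing.
by rewrite -d1 -p1 -d2 -p2.
Qed.

Lemma ext_homM d p e o (f g : T) : hom d p f -> hom e o g ->
  hom (d + e) (p (+) o) (f * g).
Proof.
move=> hf hg U a; rewrite [(f * g) U](ext_mulE f g U).
move=> /msupp_sum_le /flattenP[? /mapP[V _ ->]] /msupp_sum_le /flattenP[? /mapP[W _ ->]].
case: eqP => [<-|_]; last by rewrite mul0r msupp0.
rewrite mul1r /ext_sign; case: ifP => dVW; last by rewrite mul0r msupp0.
rewrite -signr_odd mulr_sign => h.
have {h} : a \in msupp (f V * g W).
  by move: h; case: ifP => // _; rewrite (perm_mem (msuppN _)).
move=> /msuppM_le /allpairsP[[b c] [/= /hf[<- <-] /hg[<- <-] ->]].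
have cVW : #|V :|: W| = (#|V| + #|W|)%N by apply/eqP; rewrite (leq_card_setU V W).2.
rewrite /mon_deg cVW oddD mulnDr; split=> //; congr (_, _).
rewrite /= addrACA -opprD; congr (_ - _).
  by rewrite -big_split; apply: eq_bigr => i _; rewrite mnmDE mulrnDr.
by rewrite -bigU//; apply: eq_bigl => i; rewrite !inE.
Qed.

Lemma ext_hom_const (c : rat) : hom 0 false (ext_const n c%:MP : T).
Proof.
move=> U a; rewrite ffunE; case: eqP => [->|_]; last by rewrite msupp0.
rewrite msuppC; case: eqP => // _; rewrite inE => /eqP ->.
rewrite /mon_deg cards0 big_set0 subr0 muln0; split=> //.
by congr (_, _); rewrite big1// => i _; rewrite mnm0E.
Qed.

Lemma ext_hom1 : hom 0 false (1 : T).
Proof.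
have : hom 0 false (ext_const n (1 : rat)%:MP : T) by exact: ext_hom_const.
by rewrite mpolyC1 rmorph1.
Qed.

Lemma ext_hom_var i : hom (w i, 0) false (ext_const n 'X_i : T).
Proof.
move=> U a; rewrite ffunE; case: eqP => [->|_]; last by rewrite msupp0.
rewrite msuppX inE => /eqP ->.
rewrite /mon_deg cards0 big_set0 subr0 muln0; split=> //.
congr (_, _); rewrite (bigD1 i)//= big1 => [|j /negPf ji].
  by rewrite mnm1E eqxx addr0.
by rewrite mnm1E eq_sym ji.
Qed.

Lemma ext_hom_gen (j : 'I_n) : hom (- (2 * j.+1)%:Z, 2) true (ext_gen _ j : T).
Proof.
move=> U a; rewrite ffunE; case: eqP => [->|_]; last by rewrite msupp0.
rewrite msupp1 inE => /eqP ->; rewrite /mon_deg cards1 big_set1; split=> //.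
by congr (_, _); rewrite big1 ?sub0r// => i _; rewrite mnm0E.
Qed.

Lemma ext_hom_prod J (s : seq J) (P : pred J) (d : J -> bideg) (o : J -> bool) (f : J -> T) :
  (forall j, hom (d j) (o j) (f j)) ->
  hom (\sum_(j <- s | P j) d j) (\big[addb/false]_(j <- s | P j) o j)
    (\prod_(j <- s | P j) f j).
Proof.
move=> hf; elim: s => [|j s IH]; first by rewrite !big_nil; exact: ext_hom1.
by rewrite !big_cons; case: ifP => // _; apply: ext_homM.
Qed.

Lemma ext_homX d (f : T) i : hom d false f -> hom (d *+ i) false (f ^+ i).
Proof.
move=> hf; elim: i => [|i IH]; first exact: ext_hom1.
by rewrite exprS mulrS -[false]/(false (+) false); apply: ext_homM.
Qed.

End ExtGrading.

Lemma pair_sum I (s : seq I) (P : pred I) (E : I -> bideg) :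
  \sum_(i <- s | P i) E i = (\sum_(i <- s | P i) (E i).1, \sum_(i <- s | P i) (E i).2).
Proof.
elim: s => [|i s IH]; first by rewrite !big_nil.
by rewrite !big_cons; case: ifP => // _; rewrite IH.
Qed.

Lemma pair_mulrn (d : bideg) i : d *+ i = (d.1 *+ i, d.2 *+ i).
Proof. by elim: i => [|i IH]; rewrite ?mulrS// IH. Qed.

Lemma big_addb_card n (U : {set 'I_n}) : \big[addb/false]_(j in U) true = odd #|U|.
Proof.
rewrite -sum1_card; apply/esym; apply: (big_morph odd) => //; exact: oddD.
Qed.

Section GradedExtMap.
Variables (m n m' n' : nat) (w : 'I_m -> int) (w' : 'I_m' -> int).
Variables (phi : {rmorphism {mpoly rat[m]} -> {mpoly rat[m']}}).
Variables (t : 'I_n -> extalg {mpoly rat[m']} n').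
Hypothesis phiC : forall c, phi c%:MP = c%:MP.
Hypothesis phiX : forall i, ext_hom w' (w i, 0) false (ext_const n' (phi 'X_i)).
Hypothesis tH : forall j : 'I_n, ext_hom w' (- (2 * j.+1)%:Z, 2) true (t j).

Lemma ext_map_hom d p f : ext_hom w d p f -> ext_hom w' d p (ext_map phi t f).
Proof.
move=> hf; have gB := @ext_hom_bigrading m' n' w'.
apply: (hom_sum gB) => U _.
rewrite [f U]mpolyE !rmorph_sum mulr_suml big_seq; apply: (hom_sum gB) => a aU.
have [<- <-] := hf _ _ aU; rewrite -mul_mpolyC !rmorphM phiC.
have -> : mon_deg w a U = 0 + \sum_(i < m) ((w i, 0) *+ a i)
   + \sum_(j in U) (- (2 * j.+1)%:Z, 2).
  rewrite add0r !pair_sum /mon_deg; congr (_, _) => /=.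
    by rewrite -sumrN; congr (_ + _); apply: eq_bigr => i _; rewrite pair_mulrn.
  rewrite big1 ?add0r => [|i _]; last by rewrite pair_mulrn /= mul0rn.
  by rewrite sumr_const -[RHS]mulr_natr !natz PoszM.
rewrite -[odd _]addFb -[X in X (+) _]addFb -big_addb_card.
apply: ext_homM; last exact: ext_hom_prod.
apply: ext_homM; first exact: ext_hom_const.
rewrite mpolyXE_id !rmorph_prod.
have -> : false = \big[addb/false]_(i < m) false by rewrite big1.
by apply: ext_hom_prod => i; rewrite !rmorphXn; exact: ext_homX.
Qed.

End GradedExtMap.

(** ** Linear forms in the generators *)
Section LinearForms.
Variables (R : comNzRingType) (n : nat).
Notation T := (extalg R n).

Definition linear_form (x : T) : Prop :=
  exists a : 'I_n -> R, x = \sum_j ext_const n (a j) * ext_gen R j.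

Lemma linear_form_gen j : linear_form (ext_gen R j).
Proof.
exists (fun i => (i == j)%:R); rewrite (bigD1 j)//= eqxx rmorph1 mul1r big1 ?addr0//.
by move=> i /negPf ->; rewrite rmorph0 mul0r.
Qed.

Lemma linear_formD x y : linear_form x -> linear_form y -> linear_form (x + y).
Proof.
move=> [a ->] [b ->]; exists (fun j => a j + b j); rewrite -big_split.
by apply: eq_bigr => j _; rewrite rmorphD mulrDl.
Qed.

Lemma linear_formZ c x : linear_form x -> linear_form (ext_const n c * x).
Proof.
move=> [a ->]; exists (fun j => c * a j); rewrite mulr_sumr.
by apply: eq_bigr => j _; rewrite rmorphM mulrA.
Qed.

Lemma linear_form_anticomm x y : linear_form x -> linear_form y -> x * y = - (y * x).
Proof.
move=> [a ->] [b ->].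
rewrite mulr_suml [in RHS]mulr_sumr -sumrN; apply: eq_bigr => i _.
rewrite mulr_sumr mulr_suml -sumrN; apply: eq_bigr => j _.
by rewrite !ext_const_mulACA ext_genC mulrN [b j * _]mulrC.
Qed.

(** The diagonal terms vanish because the generators square to zero, the others cancel in
pairs; the hypothesis says that 2 is regular. *)
Lemma linear_form_sqr x : (forall a : R, a = - a -> a = 0) ->
  linear_form x -> x * x = 0.
Proof.
move=> Ro lx; have := linear_form_anticomm lx lx; move: (x * x) => y e.
by apply/ffunP => U; rewrite ffunE; apply: Ro; rewrite {1}e ffunE.
Qed.

End LinearForms.

Lemma mpoly_rat_opp_eq m (a : {mpoly rat[m]}) : a = - a -> a = 0.
Proof.
move=> e; apply/mpolyP => b; rewrite mcoeff0.
have : a@_b = - a@_b by rewrite {1}e mcoeffN.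
by move/eqP; rewrite -addr_eq0 -mulr2n mulrn_eq0 /= => /eqP.
Qed.

(** * Freeness of a bimodule twisted by a unitriangular substitution *)

Section LowerFreeness.
Variables (R0 R1 : comNzRingType) (k : nat).
Variables (wd : {rmorphism R0 -> R1}) (xi : R1) (un : R1 -> {poly R0}).
Hypothesis opp_eq : forall a : R1, a = - a -> a = 0.
Hypothesis unB : forall p q, un (p - q) = un p - un q.
Hypothesis un_mono : forall c a, un (wd c * xi ^+ a) = c *: 'X^a.
Hypothesis un_expand : forall p, p = \sum_(a < size (un p)) wd (un p)`_a * xi ^+ a.
Notation T := (extalg R1 k.+1).
Notation const := (ext_const k.+1).
Notation gen := (@ext_gen R1 k.+1).
Notation wid := (widen_ord (leqnSn k)).

Definition gen_succ (j : nat) : T := if (j < k)%N then const xi * gen (inord j.+1) else 0.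

Definition shear_gen (j : 'I_k.+1) : T := gen j + gen_succ j.

(** Solving shear (s'_j) = s_j from the last generator down gives
s'_j = sum_{i >= j} (- xi)^{i-j} s_i. *)
Definition unshear_gen (j : 'I_k.+1) : T :=
  \sum_(i : 'I_k.+1 | (j <= i)%N) const ((- xi) ^+ (i - j)) * gen i.

Lemma gen_succ_linear j : linear_form (gen_succ j).
Proof.
rewrite /gen_succ; case: ifP => _; first exact/linear_formZ/linear_form_gen.
by exists (fun=> 0); rewrite big1// => i _; rewrite rmorph0 mul0r.
Qed.

Lemma shear_gen_linear j : linear_form (shear_gen j).
Proof. by apply: linear_formD; [exact: linear_form_gen|exact: gen_succ_linear]. Qed.

Lemma unshear_gen_linear j : linear_form (unshear_gen j).
Proof.
exists (fun i : 'I_k.+1 => if (j <= i)%N then (- xi) ^+ (i - j) else 0).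
rewrite /unshear_gen big_mkcond; apply: eq_bigr => i _.
by case: ifP => // _; rewrite rmorph0 mul0r.
Qed.

Lemma unshear_gen_rec (j : 'I_k.+1) : unshear_gen j =
  gen j - (if (j < k)%N then const xi * unshear_gen (inord j.+1) else 0).
Proof.
rewrite /unshear_gen (bigD1 j)//= subnn expr0 rmorph1 mul1r; congr (_ + _).
case: ifP => jk; last first.
  rewrite oppr0 big1// => i /andP[ji ij].
  have := ltn_ord i; have := ltn_ord j; move: ij; rewrite -val_eqE /=; lia.
rewrite inordK//; rewrite mulr_sumr -sumrN.
apply: eq_big => [i|i /andP[ji ij]]; first by rewrite ltn_neqAle eq_sym andbC -val_eqE.
rewrite mulrA -rmorphM -mulNr -rmorphN; congr (const _ * _).
have {ij ji} -> : (i - j = (i - j.+1).+1)%N.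
  by move: ij; rewrite -val_eqE /=; lia.
by rewrite exprS mulNr.
Qed.

Definition shear : {rmorphism T -> T} :=
  ext_rmorphism (idfun : {rmorphism R1 -> R1})
    (fun i j => linear_form_anticomm (shear_gen_linear i) (shear_gen_linear j))
    (fun i => linear_form_sqr opp_eq (shear_gen_linear i)).

Definition unshear : {rmorphism T -> T} :=
  ext_rmorphism (idfun : {rmorphism R1 -> R1})
    (fun i j => linear_form_anticomm (unshear_gen_linear i) (unshear_gen_linear j))
    (fun i => linear_form_sqr opp_eq (unshear_gen_linear i)).

Lemma shear_const c : shear (const c) = const c.
Proof. exact: ext_map_const. Qed.
Lemma unshear_const c : unshear (const c) = const c.
Proof. exact: ext_map_const. Qed.
Lemma shear_on_gen j : shear (gen j) = shear_gen j.
Proof. exact: ext_map_gen. Qed.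
Lemma unshear_on_gen j : unshear (gen j) = unshear_gen j.
Proof. exact: ext_map_gen. Qed.

Lemma shear_unshear_gen j : shear (unshear_gen j) = gen j.
Proof.
have [m] := ubnP (k - j); elim: m j => // m IH j jm.
rewrite unshear_gen_rec rmorphB shear_on_gen /shear_gen /gen_succ.
case: ifP => jk; last by rewrite rmorph0 addr0 subr0.
by rewrite rmorphM shear_const IH ?addrK// inordK//; lia.
Qed.

Lemma unshear_shear_gen j : unshear (shear_gen j) = gen j.
Proof.
rewrite /shear_gen /gen_succ rmorphD unshear_on_gen unshear_gen_rec.
case: ifP => jk; last by rewrite rmorph0 addr0 subr0.
by rewrite rmorphM unshear_const unshear_on_gen subrK.
Qed.

Lemma unshearK : cancel unshear shear.
Proof.
apply: (ext_hom_eq (f := shear \o unshear) (g := idfun)) => [c|j].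
  exact: etrans (congr1 shear (unshear_const c)) (shear_const c).
exact: etrans (congr1 shear (unshear_on_gen j)) (shear_unshear_gen j).
Qed.

Lemma shearK : cancel shear unshear.
Proof.
apply: (ext_hom_eq (f := unshear \o shear) (g := idfun)) => [c|j].
  exact: etrans (congr1 unshear (shear_const c)) (unshear_const c).
exact: etrans (congr1 unshear (shear_on_gen j)) (unshear_shear_gen j).
Qed.

Lemma shear_gen_max : shear (gen ord_max) = gen ord_max.
Proof. by rewrite shear_on_gen /shear_gen /gen_succ ltnn addr0. Qed.

Definition lo_gen (j : 'I_k) : T := shear_gen (wid j).

Lemma lo_genC i j : lo_gen i * lo_gen j = - (lo_gen j * lo_gen i).
Proof. exact: linear_form_anticomm (shear_gen_linear _) (shear_gen_linear _). Qed.

Lemma lo_gen_sqr i : lo_gen i * lo_gen i = 0.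
Proof. exact: linear_form_sqr opp_eq (shear_gen_linear _). Qed.

(** The embedding of Omega_k is the obvious one followed by the automorphism [shear], the
unitriangular substitution s_j |-> s_j + xi s_{j+1}; freeness thus reduces to the obvious
embedding. *)
Definition lo : {rmorphism extalg R0 k -> T} := ext_rmorphism wd lo_genC lo_gen_sqr.

Definition lo_basis (i : nat * bool) : T :=
  const (xi ^+ i.1) * (if i.2 then gen ord_max else 1).

Definition ext_set (e : bool) (U : {set 'I_k}) : {set 'I_k.+1} :=
  (wid @: U) :|: (if e then [set ord_max] else finset.set0).

Lemma max_notin_widen (U : {set 'I_k}) : (ord_max \in wid @: U) = false.
Proof.
by apply/imsetP => -[i _ /(congr1 val)/= e]; have := ltn_ord i; rewrite -e ltnn.
Qed.

Lemma wid_inj : injective wid.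
Proof. by move=> i j /(congr1 val) /= e; apply: val_inj. Qed.

Lemma ext_set_max e U : (ord_max \in ext_set e U) = e.
Proof. by rewrite inE max_notin_widen; case: e; rewrite inE ?eqxx. Qed.

Lemma ext_set_wid e U i : (wid i \in ext_set e U) = (i \in U).
Proof.
rewrite inE mem_imset; last exact: wid_inj.
case: e; rewrite inE ?orbF//; case: eqP => [/(congr1 val)/= e|]; rewrite ?orbF//.
by have := ltn_ord i; rewrite e ltnn.
Qed.

Lemma ext_set_eq e U e' U' : (ext_set e U == ext_set e' U') = (e == e') && (U == U').
Proof.
apply/eqP/andP => [h|[/eqP-> /eqP->]//]; split.
  by rewrite -(ext_set_max e U) h ext_set_max.
by apply/eqP/setP => i; rewrite -(ext_set_wid e U) h ext_set_wid.
Qed.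

Lemma ext_set_surj (W : {set 'I_k.+1}) :
  W = ext_set (ord_max \in W) [set i | wid i \in W].
Proof.
apply/setP => j; case: (unliftP ord_max j) => [i|] ->; last by rewrite ext_set_max.
have -> : fintype.lift ord_max i = wid i.
  by apply: val_inj; rewrite /= /bump leqNgt ltn_ord.
by rewrite ext_set_wid inE.
Qed.

Lemma const_mono_at (a : R1) e U e' U' :
  (const a * ext_mono R1 (ext_set e U)) (ext_set e' U') =
  if (e == e') && (U == U') then a else 0.
Proof.
rewrite ext_constE ffunE ext_set_eq [e' == e]eq_sym [U' == U]eq_sym.
by case: ifP; rewrite ?mulr1 ?mulr0.
Qed.

Lemma prod_wid_gen (U : {set 'I_k}) :
  \prod_(j in U) gen (wid j) = ext_mono R1 (ext_set false U).
Proof.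
have gC (i j : 'I_k) : gen (wid i) * gen (wid j) = - (gen (wid j) * gen (wid i)).
  exact: ext_genC.
have gs (i : 'I_k) : gen (wid i) * gen (wid i) = 0 by exact: ext_gen_sqr.
rewrite /ext_set finset.setU0.
elim/set_min_ind: U => [|j V jV IH]; first by rewrite big_set0 imset0 ext_mono0.
have := gen_ext_prod gC gs j V.
rewrite /ext_prod ext_sign_min// rmorph1 mul1r => <-.
rewrite IH -ext_mono_gen ext_monoM ext_sign_min ?rmorph1 ?mul1r ?imsetU1//.
by move=> _ /imsetP[b bV ->]; apply: jV.
Qed.

Lemma ext_mono_max e (U : {set 'I_k}) :
  ext_mono R1 (ext_set false U) * (if e then gen ord_max else 1) =
  ext_mono R1 (ext_set e U).
Proof.
case: e; last by rewrite mulr1.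
rewrite -ext_mono_gen ext_monoM {1 2}/ext_set finset.setU0.
rewrite /ext_sign -setI_eq0 finset.setIC setI_eq0 disjoints1 max_notin_widen /=.
rewrite /inversions big1 => [|i _]; first by rewrite expr0 rmorph1 mul1r.
by rewrite big_set1 ltnNge leq_ord.
Qed.

(** After undoing the shear, the multiples of a basis element are the obvious ones. *)
Lemma lo_basisE (c : extalg R0 k) (i : nat * bool) :
  unshear (lo c * lo_basis i) =
  \sum_U const (wd (c U) * xi ^+ i.1) * ext_mono R1 (ext_set i.2 U).
Proof.
apply: (can_inj shearK); rewrite unshearK.
rewrite rmorph_sum mulr_suml; apply: eq_bigr => U _.
have -> : ext_prod lo_gen U = shear (ext_mono R1 (ext_set false U)).
  rewrite -prod_wid_gen rmorph_prod; apply: eq_bigr => j _.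
  by rewrite shear_on_gen.
rewrite rmorphM shear_const ext_const_mulACA -(ext_mono_max i.2).
rewrite [shear (_ * (if _ then _ else _))]rmorphM.
by case: i.2; rewrite ?rmorph1 ?shear_gen_max.
Qed.

Lemma lo_span (y : T) : exists c : nat * bool -> extalg R0 k,
  fin_sum (fun i => lo (c i) * lo_basis i) y.
Proof.
have [z ez] : exists z, z = unshear y by exists (unshear y).
pose N := (\sum_W size (un (z W)))%N.
have zN W : (size (un (z W)) <= N)%N by rewrite /N (bigD1 W)//= leq_addr.
pose c (i : nat * bool) : extalg R0 k := [ffun U => (un (z (ext_set i.2 U)))`_i.1].
have cN (a : nat) e : (N <= a)%N -> c (a, e) = 0.
  move=> Na; apply/ffunP => U; rewrite !ffunE /= nth_default//.
  exact: leq_trans (zN _) Na.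
exists c; exists [seq (a, e) | a <- iota 0 N, e <- [:: false; true]]; split.
- by apply: allpairs_uniq; rewrite ?iota_uniq// => -[? ?] [? ?] _ _ [-> ->].
- move=> [a e] h; rewrite cN ?rmorph0 ?mul0r// leqNgt; apply: contra h => aN.
  by apply/allpairsP; exists (a, e); rewrite /= mem_iota; split=> //; case: (e).
apply: (can_inj unshearK); rewrite -ez rmorph_sum.
apply/ffunP => W; rewrite [W]ext_set_surj.
move: (ord_max \in W) [set i | wid i \in W]%SET => e U {W}.
rewrite [in RHS]sum_ffunE big_allpairs_dep.
have -> : z (ext_set e U) = \sum_(a <- iota 0 N) wd (c (a, e) U) * xi ^+ a.
  rewrite {1}[z _]un_expand -(big_mkord predT (fun a => wd (un (z (ext_set e U)))`_a * xi ^+ a)).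
  have -> : iota 0 N = index_iota 0 N by rewrite /index_iota subn0.
  rewrite (big_cat_nat (leq0n _) (zN (ext_set e U)))/=.
  rewrite [X in _ + X]big1_seq ?addr0 => [|a /andP[_]].
    by apply: eq_bigr => a _; rewrite ffunE.
  by rewrite mem_index_iota => /andP[h _]; rewrite ffunE nth_default// rmorph0 mul0r.
apply: eq_bigr => a _.
have ev e' : unshear (lo (c (a, e')) * lo_basis (a, e')) (ext_set e U) =
    if e' == e then wd (c (a, e) U) * xi ^+ a else 0.
  rewrite lo_basisE sum_ffunE; case: eqP => [->|/eqP ne].
    rewrite (bigD1 U)//= big1 => [|V /negPf VU]; last first.
      by rewrite const_mono_at VU andbF.
    by rewrite const_mono_at !eqxx addr0.
  by rewrite big1// => V _; rewrite const_mono_at (negPf ne).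
by rewrite big_cons big_seq1 !ev; case: (e); rewrite /= ?addr0 ?add0r.
Qed.

Lemma lo_indep (c : nat * bool -> extalg R0 k) :
  fin_sum (fun i => lo (c i) * lo_basis i) 0 -> forall i, c i = 0.
Proof.
move=> s0 [a e]; apply/ffunP => U; rewrite [RHS]ffunE.
(* The coordinate of index (a, e) and monomial U, read off after undoing the shear. *)
pose ev (y : T) : R0 := (un (unshear y (ext_set e U)))`_a.
have evB x y : ev (x - y) = ev x - ev y.
  by rewrite /ev rmorphB !ffunE unB coefB.
have := fin_sum_morph evB s0; rewrite (morph0 evB) => s1.
apply/esym; apply: fin_sum_eq s1 _.
apply: eq_fin_sum (fin_sum1 (a, e) (c (a, e) U)) => -[a' e'].
rewrite /ev lo_basisE sum_ffunE.
under eq_bigr => V _ do rewrite const_mono_at.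
rewrite xpair_eqE [(a', e').2]/= [(a', e').1]/=.
have [->|ne] := eqVneq e' e; last by rewrite andbF big1 ?(morph0 unB) ?coef0.
rewrite -big_mkcond big_pred1_eq un_mono coefZ coefXn andbT eq_sym.
by have [->|_] := eqVneq a a'; rewrite ?mulr1 ?mulr0.
Qed.

Lemma ext_par_linear_form (x : T) : linear_form x -> ext_par x = - x.
Proof.
move=> [a ->]; rewrite rmorph_sum -sumrN; apply: eq_bigr => j _.
by rewrite rmorphM /= ext_par_const ext_par_gen mulrN.
Qed.

Lemma lo_par (c : extalg R0 k) : lo (ext_par c) = ext_par (lo c).
Proof.
apply: (ext_hom_eq (f := lo \o @ext_par R0 k) (g := @ext_par R1 k.+1 \o lo)) => [a|j].
  rewrite -[LHS]/(lo (ext_par (ext_const k a))) -[RHS]/(ext_par (lo (ext_const k a))).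
  by rewrite ext_par_const [lo _]ext_map_const ext_par_const.
rewrite -[LHS]/(lo (ext_par (ext_gen R0 j))) -[RHS]/(ext_par (lo (ext_gen R0 j))).
rewrite ext_par_gen rmorphN [lo _]ext_map_gen.
by rewrite (ext_par_linear_form (shear_gen_linear _)).
Qed.

Lemma lo_basisC (c : extalg R0 k) (i : nat * bool) :
  lo_basis i * lo c = lo (if i.2 then ext_par c else c) * lo_basis i.
Proof.
rewrite /lo_basis mulrA -ext_constC -!mulrA; congr (_ * _).
case: i.2; last by rewrite mul1r mulr1.
by rewrite ext_gen_par lo_par.
Qed.

End LowerFreeness.

(** * Polynomial rings as free modules over subrings *)

Section MpolyClosure.
Variables (R : comNzRingType) (n : nat).

Lemma mpoly_closed_ind (P : {mpoly R[n]} -> Prop) :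
  (forall c, P c%:MP) -> (forall i, P 'X_i) ->
  (forall p q, P p -> P q -> P (p + q)) -> (forall p q, P p -> P q -> P (p * q)) ->
  forall p, P p.
Proof.
move=> hC hX hD hM p; rewrite [p]mpolyE.
have h0 : P 0 by rewrite -(mpolyC0 n R).
have h1 : P 1 by rewrite -(mpolyC1 n R).
elim: (msupp p : seq _) => [|m s IH]; first by rewrite big_nil.
rewrite big_cons; apply: (hD) => //; rewrite -mul_mpolyC; apply: (hM) => //.
rewrite mpolyXE_id; elim: (index_enum _) => [|i t IHt]; first by rewrite big_nil.
rewrite big_cons; apply: (hM) => //.
by elim: (m i) => [|j IHj]; rewrite ?expr0// exprS; apply: (hM).
Qed.

Lemma mpoly_hom_eq (S : nzRingType) (f g : {rmorphism {mpoly R[n]} -> S}) :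
  (forall c, f c%:MP = g c%:MP) -> (forall i, f 'X_i = g 'X_i) -> f =1 g.
Proof.
move=> fC fX; apply: mpoly_closed_ind => // p q fp fq.
  by rewrite !rmorphD fp fq.
by rewrite !rmorphM fp fq.
Qed.

End MpolyClosure.

Section LastVariable.
Variable k : nat.
Notation R0 := {mpoly rat[k]}.
Notation R1 := {mpoly rat[k.+1]}.

Definition xi_var : R1 := 'X_ord_max.

Definition un_poly : R1 -> {poly R0} :=
  mmap (polyC \o @mpolyC k rat)
    (fun i => if unlift ord_max i is Some j then ('X_j)%:P else 'X).

HB.instance Definition _ := GRing.RMorphism.on un_poly.

Lemma mwiden_var (i : 'I_k) : mwiden 'X_i = 'X_(widen_ord (leqnSn k) i) :> R1.
Proof. by rewrite mwidenX mnmwiden1. Qed.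

Lemma widen_lift (i : 'I_k) : widen_ord (leqnSn k) i = fintype.lift ord_max i.
Proof. by apply: val_inj; rewrite /= /bump leqNgt ltn_ord. Qed.

Lemma un_polyC c : un_poly c%:MP = (c%:MP)%:P.
Proof. exact: mmapC. Qed.

Lemma un_polyX i : un_poly 'X_i = if unlift ord_max i is Some j then ('X_j)%:P else 'X.
Proof. by rewrite /un_poly mmapX mmap1U. Qed.

Lemma un_poly_widen (c : R0) : un_poly (mwiden c) = c%:P.
Proof.
apply: (mpoly_hom_eq (f := un_poly \o @mwiden k rat) (g := polyC)) => [a|i].
  by rewrite -[LHS]/(un_poly (mwiden _)) mwidenC un_polyC.
by rewrite -[LHS]/(un_poly (mwiden _)) mwiden_var un_polyX widen_lift liftK.
Qed.

Lemma un_poly_xi : un_poly xi_var = 'X.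
Proof. by rewrite un_polyX unlift_none. Qed.

Lemma un_poly_mono (c : R0) a : un_poly (mwiden c * xi_var ^+ a) = c *: 'X^a.
Proof. by rewrite rmorphM rmorphXn /= un_poly_widen un_poly_xi mul_polyC. Qed.

Lemma un_polyB p q : un_poly (p - q) = un_poly p - un_poly q.
Proof. exact: rmorphB. Qed.

Definition re_poly (P : {poly R0}) : R1 := (map_poly (@mwiden k rat) P).[xi_var].

HB.instance Definition _ := GRing.RMorphism.copy re_poly
  (horner_eval xi_var \o map_poly (@mwiden k rat)).

Lemma un_poly_expand p :
  p = \sum_(a < size (un_poly p)) mwiden (un_poly p)`_a * xi_var ^+ a.
Proof.
have e : re_poly (un_poly p) = p.
  apply: (mpoly_hom_eq (f := re_poly \o un_poly) (g := idfun)) => [c|i].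
    by rewrite -[LHS]/(re_poly (un_poly _)) un_polyC /re_poly map_polyC hornerC /= mwidenC.
  rewrite -[LHS]/(re_poly (un_poly _)) un_polyX /re_poly.
  case: unliftP => [j ->|->]; last by rewrite map_polyX hornerX.
  by rewrite map_polyC hornerC /= mwiden_var widen_lift.
rewrite -{1}e /re_poly (horner_coef_wide _ (size_poly _ _)).
by apply: eq_bigr => i _; rewrite coef_map.
Qed.

End LastVariable.

(** ** Elementary symmetric functions of one more variable *)
Section UpperFreeness.
Variable k : nat.
Notation P := {mpoly rat[k.+1]}.
Notation xi := (xi_var k).

(** x_{i,k}, with x_{0,k} = 1 and x_{i,k} = 0 for i > k. *)
Definition yvar (i : nat) : P :=
  if i is j.+1 then (if (j < k)%N then 'X_(inord j) else 0) else 1.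

Definition hi_poly : P -> P :=
  mmap (@mpolyC k.+1 rat) (fun i : 'I_k.+1 => yvar i.+1 + xi * yvar i).

HB.instance Definition _ := GRing.RMorphism.on hi_poly.

(** The embedding of Omega_{k+1} is that of symmetric functions of the union of two sets of
variables, one of which consists of xi alone. *)
Lemma hi_polyX i : hi_poly 'X_i = yvar i.+1 + xi * yvar i.
Proof. by rewrite /hi_poly mmapX mmap1U. Qed.

Lemma hi_polyC c : hi_poly c%:MP = c%:MP.
Proof. exact: mmapC. Qed.

Definition hi_span (p : P) : Prop :=
  exists c : 'I_k.+1 -> P, p = \sum_i hi_poly (c i) * xi ^+ i.

Lemma hi_spanD p q : hi_span p -> hi_span q -> hi_span (p + q).
Proof.
move=> [c ->] [d ->]; exists (fun i => c i + d i); rewrite -big_split.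
by apply: eq_bigr => i _; rewrite rmorphD mulrDl.
Qed.

Lemma hi_spanZ a p : hi_span p -> hi_span (hi_poly a * p).
Proof.
move=> [c ->]; exists (fun i => a * c i); rewrite mulr_sumr.
by apply: eq_bigr => i _; rewrite rmorphM mulrA.
Qed.

Lemma hi_spanN p : hi_span p -> hi_span (- p).
Proof. by move=> /(hi_spanZ (-1)); rewrite rmorphN1 mulN1r. Qed.

Lemma hi_span_sum (s : seq nat) E : (forall i, i \in s -> hi_span (E i)) ->
  hi_span (\sum_(i <- s) E i).
Proof.
elim: s => [|i s IH] h.
  by rewrite big_nil; exists (fun=> 0); rewrite big1// => i _; rewrite rmorph0 mul0r.
rewrite big_cons; apply: hi_spanD; first by apply: h; rewrite inE eqxx.
by apply: IH => j js; apply: h; rewrite inE js orbT.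
Qed.

Lemma hi_span_xi_pow i : (i <= k)%N -> hi_span (xi ^+ i).
Proof.
move=> ik; exists (fun j => (j == inord i)%:R).
rewrite (bigD1 (inord i))//= eqxx rmorph1 mul1r inordK// big1 ?addr0//.
by move=> j /negPf ->; rewrite rmorph0 mul0r.
Qed.

(** Inverting (1 + xi t) in the generating series of the x_{i,k}. For j = k + 1 the left-hand
side vanishes, which is the monic equation of degree k + 1 of xi over Omega_{k+1}. *)
Lemma yvar_expand j : (j <= k.+1)%N ->
  yvar j = (- xi) ^+ j + \sum_(0 <= i < j) (- xi) ^+ (j - i.+1) * hi_poly 'X_(inord i).
Proof.
elim: j => [|j IH] jk; first by rewrite big_geq// expr0 addr0.
have -> : yvar j.+1 = hi_poly 'X_(inord j) - xi * yvar j.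
  by rewrite hi_polyX inordK// addrK.
rewrite IH 1?ltnW// big_nat_recr//= subnn expr0 mul1r exprS.
have -> : \sum_(0 <= i < j) (- xi) ^+ (j.+1 - i.+1) * hi_poly 'X_(inord i) =
    - (xi * \sum_(0 <= i < j) (- xi) ^+ (j - i.+1) * hi_poly 'X_(inord i)).
  rewrite mulr_sumr -sumrN; apply: eq_big_nat => i /andP[_ ij].
  by rewrite mulrA -mulNr -mulNr -exprS; congr (_ ^+ _ * _); lia.
by rewrite mulrDr opprD mulNr addrCA; congr (_ + _); rewrite addrC.
Qed.

Lemma hi_span_xi p : hi_span p -> hi_span (xi * p).
Proof.
have sxN i : (i <= k)%N -> hi_span ((- xi) ^+ i).
  move=> /hi_span_xi_pow h; rewrite exprNn -signr_odd.
  by case: odd; rewrite ?expr1 ?mulN1r ?expr0 ?mul1r//; exact: hi_spanN.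
(* The equation of xi over the subring, solved for its leading term. *)
have top : hi_span (xi ^+ k.+1).
  have /esym/eqP := yvar_expand (leqnn k.+1); rewrite /= ltnn addr_eq0 => /eqP e.
  have {e}e : xi ^+ k.+1 = (-1) ^+ k.+1 *
     - (\sum_(0 <= i < k.+1) (- xi) ^+ (k.+1 - i.+1) * hi_poly 'X_(inord i)).
    by rewrite -e -exprMn mulN1r opprK.
  rewrite e; have -> : (-1) ^+ k.+1 = hi_poly ((-1) ^+ k.+1) by rewrite rmorphXn rmorphN1.
  apply/hi_spanZ/hi_spanN/hi_span_sum => i _; rewrite mulrC; apply: hi_spanZ.
  by apply: sxN; rewrite subSS leq_subr.
move=> [c ->]; rewrite mulr_sumr.
have -> : \sum_i xi * (hi_poly (c i) * xi ^+ i) =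
   \sum_(i <- iota 0 k.+1) hi_poly (c (inord i)) * xi ^+ i.+1.
  rewrite -[iota _ _]/(index_iota 0 k.+1) big_mkord; apply: eq_bigr => i _.
  by rewrite inord_val mulrCA exprS.
apply: hi_span_sum => i; rewrite mem_iota => /= ik; apply: hi_spanZ.
by move: ik; rewrite ltnS leq_eqVlt => /orP[/eqP->//|]; exact: hi_span_xi_pow.
Qed.

(** The span is stable under multiplication by xi, hence by the x_{i,k}, which are polynomials
in xi over the subring. *)
Lemma hi_span_all p : hi_span p.
Proof.
suff h : forall q, hi_span q -> hi_span (p * q).
  by rewrite -[p]mulr1; apply: h; rewrite -(expr0 xi); apply: hi_span_xi_pow.
elim/mpoly_closed_ind: p => [c q|i q|p1 p2 h1 h2 q hq|p1 p2 h1 h2 q hq].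
- by rewrite -hi_polyC; exact: hi_spanZ.
- have hy j : (j <= k)%N -> forall q, hi_span q -> hi_span (yvar j * q).
    elim: j => [|j IH] jk r hr; first by rewrite mul1r.
    have -> : yvar j.+1 = hi_poly 'X_(inord j) - xi * yvar j.
      by rewrite hi_polyX inordK ?addrK// ltnW.
    rewrite mulrBl -mulrA; apply: hi_spanD; first exact: hi_spanZ.
    by apply/hi_spanN/hi_span_xi/IH => //; exact: ltnW.
  have := ltn_ord i; rewrite ltnS leq_eqVlt orbC => /orP[ik|/eqP ek].
  + have := hy i.+1 ik q; rewrite /= ik.
    by have -> : inord i = i :> 'I_k.+1 by exact: inord_val.
  + have -> : i = ord_max by exact: val_inj.
    exact: hi_span_xi.
- by rewrite mulrDl; apply: hi_spanD; auto.
- by rewrite -mulrA; auto.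
Qed.

(** The inverse substitution, valued in polynomials in an indeterminate that
stands for xi; ypoly k.+1 is up to sign the relation that xi satisfies. *)
Fixpoint ypoly (j : nat) : {poly P} :=
  if j is i.+1 then ('X_(inord i))%:P - 'X * ypoly i else 1.

Lemma size_ypoly j : size (ypoly j) = j.+1.
Proof.
elim: j => [|j IH]; first exact: size_poly1.
have y0 : ypoly j != 0 by rewrite -size_poly_eq0 IH.
have sX : size (- ('X * ypoly j)) = j.+2 by rewrite size_polyN mulrC size_mulX ?IH.
rewrite [ypoly _]/= addrC size_polyDl sX//.
exact: leq_ltn_trans (size_polyC_leq1 _) _.
Qed.

Definition lift_poly : P -> {poly P} :=
  mmap (polyC \o @mpolyC k.+1 rat) (fun i : 'I_k.+1 => if (i < k)%N then ypoly i.+1 else 'X).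

HB.instance Definition _ := GRing.RMorphism.on lift_poly.

Lemma lift_polyX i : lift_poly 'X_i = if (i < k)%N then ypoly i.+1 else 'X.
Proof. by rewrite /lift_poly mmapX mmap1U. Qed.

Lemma lift_poly_xi : lift_poly xi = 'X.
Proof. by rewrite lift_polyX ltnn. Qed.

Lemma lift_poly_yvar j : (j <= k)%N -> lift_poly (yvar j) = ypoly j.
Proof.
case: j => [|j] jk; first by rewrite rmorph1.
by rewrite [yvar _]/= jk lift_polyX inordK ?jk// ltnW.
Qed.

(** Modulo the equation of xi, the two substitutions are inverse to each other. *)
Lemma lift_hi_poly a : exists q, lift_poly (hi_poly a) = a%:P + ypoly k.+1 * q.
Proof.
elim/mpoly_closed_ind: a => [c|i|p1 p2 [q1 h1] [q2 h2]|p1 p2 [q1 h1] [q2 h2]].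
- by exists 0; rewrite hi_polyC mulr0 addr0 /lift_poly mmapC.
- rewrite hi_polyX rmorphD rmorphM /= lift_poly_xi.
  have := ltn_ord i; rewrite ltnS leq_eqVlt orbC => /orP[ik|/eqP ek].
  + exists 0; rewrite (lift_poly_yvar ik) (lift_poly_yvar (ltnW ik)) /= subrK mulr0 addr0.
    by rewrite inord_val.
  + exists (-1); rewrite ek ltnn rmorph0 add0r lift_poly_yvar//.
    by rewrite mulrN1 /= opprB [RHS]addrC -(inord_val i) ek subrK.
- exists (q1 + q2); rewrite !rmorphD mulrDr -[RHS]addrACA.
  by rewrite -h1 -h2.
- exists (p1%:P * q2 + q1 * p2%:P + q1 * (ypoly k.+1 * q2)).
  transitivity (lift_poly (hi_poly p1) * lift_poly (hi_poly p2)).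
    by rewrite !rmorphM.
  by rewrite h1 h2 polyCM; move: (ypoly _) p1%:P p2%:P => y a b; ring.
Qed.

(** A relation of degree at most k lifts to a multiple of ypoly k.+1, which has degree k + 1. *)
Lemma hi_indep (c : 'I_k.+1 -> P) : \sum_i hi_poly (c i) * xi ^+ i = 0 -> forall i, c i = 0.
Proof.
move=> c0.
have [q hq] := choice (fun i => lift_hi_poly (c i)).
pose S := \sum_(i < k.+1) (c i)%:P * 'X^i.
have e : S + ypoly k.+1 * (\sum_(i < k.+1) q i * 'X^i) = 0.
  rewrite mulr_sumr -big_split -[RHS](rmorph0 lift_poly) -c0 rmorph_sum.
  apply: eq_bigr => i _; rewrite rmorphM rmorphXn /= lift_poly_xi hq [RHS]mulrDl.
  by rewrite mulrA.
have SE : S = \poly_(i < k.+1) c (inord i).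
  by rewrite poly_def; apply: eq_bigr => i _; rewrite inord_val mul_polyC.
have S0 : S = 0.
  move: e; set Q := (\sum_(i < k.+1) q i * 'X^i) => e.
  have [Q0|Q0] := eqVneq Q 0; first by rewrite -e Q0 mulr0 addr0.
  have : (size S <= k.+1)%N by rewrite SE size_poly.
  move/eqP: e; rewrite addr_eq0 => /eqP ->; rewrite size_polyN size_mul//.
    rewrite size_ypoly; move: Q0; rewrite -size_poly_gt0; move: (size _) => n n0.
    by rewrite addSn /= -[X in (_ <= X)%N]addn0 leq_add2l leqNgt n0.
  by rewrite -size_poly_eq0 size_ypoly.
move=> i; have := congr1 (fun p : {poly P} => p`_i) S0.
by rewrite SE coef_poly ltn_ord inord_val coef0.
Qed.

End UpperFreeness.

(** * Freeness of the bimodule on both sides *)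

Section UpperExt.
Variables (R R1 : comNzRingType) (n m : nat) (phi : {rmorphism R -> R1}) (xi : R1).
Hypothesis span : forall p, exists c : 'I_m -> R, p = \sum_i phi (c i) * xi ^+ i.
Hypothesis indep : forall c : 'I_m -> R, \sum_i phi (c i) * xi ^+ i = 0 -> forall i, c i = 0.
Notation const := (ext_const n).

Definition hi : {rmorphism extalg R n -> extalg R1 n} :=
  ext_rmorphism phi (@ext_genC R1 n) (@ext_gen_sqr R1 n).

Lemma hiE c (U : {set 'I_n}) : hi c U = phi (c U).
Proof.
pose d : extalg R1 n := [ffun U => phi (c U)].
have -> : hi c = d; last by rewrite ffunE.
rewrite [RHS]ext_expand; apply: eq_bigr => V _.
by rewrite /ext_prod prod_ext_gen [d V]ffunE.
Qed.

Lemma hi_xiE c i (U : {set 'I_n}) : (hi c * const (xi ^+ i)) U = phi (c U) * xi ^+ i.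
Proof. by rewrite -ext_constC ext_constE hiE mulrC. Qed.

Lemma hi_ext_span (y : extalg R1 n) : exists c : 'I_m -> extalg R n,
  fin_sum (fun i => hi (c i) * const (xi ^+ i)) y.
Proof.
have [c yc] := choice (fun U => span (y U)).
pose d i : extalg R n := [ffun U => c U i].
exists d; exists (index_enum 'I_m); split.
- exact: index_enum_uniq.
- by move=> i; rewrite mem_index_enum.
apply/ffunP => U; rewrite [RHS]sum_ffunE yc; apply: eq_bigr => i _.
by rewrite hi_xiE [d i U]ffunE.
Qed.

Lemma hi_ext_indep (c : 'I_m -> extalg R n) :
  fin_sum (fun i => hi (c i) * const (xi ^+ i)) 0 -> forall i, c i = 0.
Proof.
move=> c0 i; apply/ffunP => U; rewrite [RHS]ffunE; apply: (indep (c := fun i => c i U)).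
have := fin_sum_seq c0 (index_enum_uniq 'I_m) => e.
transitivity ((\sum_i hi (c i) * const (xi ^+ i)) U).
  by rewrite [RHS]sum_ffunE; apply: eq_bigr => j _; rewrite hi_xiE.
by rewrite -e ?ffunE// => j; rewrite mem_index_enum.
Qed.

End UpperExt.

Section MmapConst.
Variables (m m' n : nat).

Lemma mmap_ext_const (y : 'I_m -> {mpoly rat[m']}) p :
  mmap (fun c => ext_const n c%:MP : extalg {mpoly rat[m']} n) (fun i => ext_const n (y i)) p =
  ext_const n (mmap (@mpolyC m' rat) y p).
Proof.
rewrite /mmap rmorph_sum; apply: eq_bigr => a _; rewrite rmorphM /mmap1 rmorph_prod.
by congr (_ * _); apply: eq_bigr => i _; rewrite rmorphXn.
Qed.

End MmapConst.

Section Bimodule.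
Variable k : nat.

Definition xiB : {mpoly rat[k.+1]} := xi_var k.

Definition loB : {rmorphism extalg {mpoly rat[k]} k -> extalg {mpoly rat[k.+1]} k.+1} :=
  lo k (@mwiden k rat : {rmorphism {mpoly rat[k]} -> {mpoly rat[k.+1]}}) xiB
    (@mpoly_rat_opp_eq k.+1).

Definition hiB : {rmorphism extalg {mpoly rat[k.+1]} k.+1 -> extalg {mpoly rat[k.+1]} k.+1} :=
  hi k.+1 (@hi_poly k : {rmorphism {mpoly rat[k.+1]} -> {mpoly rat[k.+1]}}).

Lemma Bxk_yvar i : Bxk k i = ext_const k.+1 (yvar k i).
Proof.
case: i => [|i]; first by rewrite rmorph1.
by rewrite /Bxk /yvar; case: ifP => // _; rewrite rmorph0.
Qed.

Lemma Omega_loE (f : Omega k) : Omega_lo f = loB f.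
Proof.
have e : (fun i : 'I_k => Bxk k i.+1) =
    (fun i => ext_const k.+1 'X_(widen_ord (leqnSn k) i)).
  apply/funext => i; rewrite Bxk_yvar /= ltn_ord.
  have -> // : inord i = widen_ord (leqnSn k) i.
  by apply: val_inj; rewrite /= inordK// ltnW// ltnS.
rewrite -[RHS]/(ext_map _ _ _) /Omega_lo e; apply: eq_bigr => U _.
rewrite mmap_ext_const; congr (ext_const _ _ * _).
apply: eq_bigr => j _.
rewrite /lo_gen /shear_gen /gen_succ (ltn_ord j : (widen_ord (leqnSn k) j < k)%N).
congr (Bs _ + _); by apply: val_inj; rewrite /= inordK// ltnW// ltnS.
Qed.

Lemma Omega_hiE (f : Omega k.+1) : Omega_hi f = hiB f.
Proof.
have e : (fun i : 'I_k.+1 => Bxk k i.+1 + Bxi k * Bxk k i) =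
    (fun i : 'I_k.+1 => ext_const k.+1 (yvar k i.+1 + xiB * yvar k i)).
  by apply/funext => i; rewrite !Bxk_yvar -ext_constM -ext_constD.
rewrite -[RHS]/(ext_map _ _ _) /Omega_hi e; apply: eq_bigr => U _.
by rewrite mmap_ext_const.
Qed.

Lemma hom_yvar i : @OmegaB_hom k ((2 * i)%:Z, 0) false (ext_const k.+1 (yvar k i)).
Proof.
case: i => [|i]; first by rewrite rmorph1; exact: ext_hom1.
rewrite /yvar; case: ifP => ik; last by rewrite rmorph0; apply: (hom0 (@ext_hom_bigrading _ _ _)).
have := @ext_hom_var k.+1 k.+1 (fun i => if (i < k)%N then (2 * i.+1)%:Z else 2) (inord i).
by rewrite inordK ?ik// ltnS ltnW.
Qed.

Lemma hom_xi : @OmegaB_hom k (2, 0) false (ext_const k.+1 xiB).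
Proof.
have := @ext_hom_var k.+1 k.+1 (fun i => if (i < k)%N then (2 * i.+1)%:Z else 2) ord_max.
by rewrite ltnn.
Qed.

Lemma Omega_lo_hom d p c : @Omega_hom k d p c -> @OmegaB_hom k d p (@Omega_lo k c).
Proof.
rewrite Omega_loE; apply: ext_map_hom => [a|i|j].
- exact: mwidenC.
- rewrite -[_ 'X_i]/(mwiden 'X_i) mwiden_var.
  have := @ext_hom_var k.+1 k.+1 (fun i => if (i < k)%N then (2 * i.+1)%:Z else 2)
    (widen_ord (leqnSn k) i).
  by rewrite /= ltn_ord.
rewrite /lo_gen /shear_gen /gen_succ (ltn_ord j : (widen_ord (leqnSn k) j < k)%N).
apply: (homD (@ext_hom_bigrading _ _ _)).
  exact: (@ext_hom_gen _ k.+1 _ (widen_ord (leqnSn k) j)).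
have := ext_homM hom_xi (@ext_hom_gen k.+1 k.+1
  (fun i => if (i < k)%N then (2 * i.+1)%:Z else 2) (inord j.+1)).
rewrite inordK ?ltnS//.
by congr (ext_hom _ _ _ _); congr (_, _) => //=; lia.
Qed.

Lemma Omega_hi_hom d p c : @Omega_hom k.+1 d p c -> @OmegaB_hom k d p (@Omega_hi k c).
Proof.
rewrite Omega_hiE; apply: ext_map_hom => [a|i|j]; last exact: ext_hom_gen.
- exact: hi_polyC.
rewrite -[_ 'X_i]/(hi_poly 'X_i) hi_polyX rmorphD rmorphM.
apply: (homD (@ext_hom_bigrading _ _ _)); first exact: hom_yvar.
have := ext_homM hom_xi (@hom_yvar i).
by congr (ext_hom _ _ _ _); congr (_, _) => //=; lia.
Qed.

Definition lo_beta (i : nat * bool) : OmegaB k := lo_basis k xiB i.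
Definition hi_beta (i : 'I_k.+1) : OmegaB k := ext_const k.+1 (xiB ^+ i).

Definition lo_deg (i : nat * bool) : bideg * bool :=
  ((2 * i.1%:Z - (if i.2 then (2 * k.+1)%:Z else 0), if i.2 then 2 else 0), i.2).
Definition hi_deg (i : 'I_k.+1) : bideg * bool := ((2 * i%:Z, 0), false).

Lemma hom_xi_pow a : @OmegaB_hom k (2 * a%:Z, 0) false (ext_const k.+1 (xiB ^+ a)).
Proof.
have -> : (2 * a%:Z, 0) = ((2, 0) : bideg) *+ a.
  by rewrite pair_mulrn; congr (_, _) => /=; rewrite ?mul0rn // -[RHS]mulr_natr !natz.
by rewrite rmorphXn; exact: ext_homX hom_xi.
Qed.

Lemma hi_beta_hom i : @OmegaB_hom k (hi_deg i).1 (hi_deg i).2 (hi_beta i).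
Proof. exact: hom_xi_pow. Qed.

Lemma lo_beta_hom i : @OmegaB_hom k (lo_deg i).1 (lo_deg i).2 (lo_beta i).
Proof.
case: i => a [] /=; rewrite /lo_beta /lo_basis /=.
  have := ext_homM (@hom_xi_pow a) (@ext_hom_gen k.+1 k.+1
    (fun i => if (i < k)%N then (2 * i.+1)%:Z else 2) ord_max).
  by congr (ext_hom _ _ _ _); congr (_, _) => //=; lia.
have := ext_homM (@hom_xi_pow a) (@ext_hom1 k.+1 k.+1
    (fun i => if (i < k)%N then (2 * i.+1)%:Z else 2)).
by congr (ext_hom _ _ _ _); congr (_, _) => //=; lia.
Qed.

Lemma gdecomp_lo_left : gdecomp (@Omega_hom k) (@OmegaB_hom k) lo_deg
  (fun i c => Omega_lo c * lo_beta i).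
Proof.
split=> [i x y|i d p x hx|y|c c0 i].
- by rewrite !Omega_loE rmorphB mulrBl.
- by apply: ext_homM; [exact: Omega_lo_hom|exact: lo_beta_hom].
- have [c cy] := lo_span (wd := @mwiden k rat) (xi := xiB) (@mpoly_rat_opp_eq k.+1)
    (@un_poly_expand k) y.
  by exists c; apply: eq_fin_sum cy => i; rewrite Omega_loE.
apply: (lo_indep (wd := @mwiden k rat) (xi := xiB) (opp_eq := @mpoly_rat_opp_eq k.+1)
  (@un_polyB k) (@un_poly_mono k)).
by apply: eq_fin_sum c0 => j; rewrite Omega_loE.
Qed.

Lemma gdecomp_hi_left : gdecomp (@Omega_hom k.+1) (@OmegaB_hom k) hi_deg
  (fun i c => Omega_hi c * hi_beta i).
Proof.
split=> [i x y|i d p x hx|y|c c0 i].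
- by rewrite !Omega_hiE rmorphB mulrBl.
- by apply: ext_homM; [exact: Omega_hi_hom|exact: hi_beta_hom].
- have [c cy] := hi_ext_span (phi := @hi_poly k) (xi := xiB) (@hi_span_all k) y.
  by exists c; apply: eq_fin_sum cy => i; rewrite Omega_hiE.
apply: (hi_ext_indep (phi := @hi_poly k) (xi := xiB) (@hi_indep k)).
by apply: eq_fin_sum c0 => j; rewrite Omega_hiE.
Qed.

Lemma Omega_par_hom d p (c : Omega k) : Omega_hom d p c -> Omega_hom d p (ext_par c).
Proof.
move=> hc U a; rewrite ffunE -signr_odd mulr_sign => aU; apply: hc.
by move: aU; case: ifP; rewrite // (perm_mem (msuppN _)).
Qed.

Lemma gdecomp_lo_right : gdecomp (@Omega_hom k) (@OmegaB_hom k) lo_deg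
  (fun i c => lo_beta i * Omega_lo c).
Proof.
have := gdecomp_precomp (h := fun i c => if i.2 then ext_par c else c) gdecomp_lo_left.
have -> : (fun (i : nat * bool) (c : Omega k) =>
    Omega_lo (if i.2 then ext_par c else c) * lo_beta i) =
  (fun i c => lo_beta i * Omega_lo c).
  by apply/funext => i; apply/funext => c; rewrite !Omega_loE lo_basisC.
apply=> [[a []] x y|[a []] x|[a []] d p x] //=.
- exact: rmorphB.
- exact: ext_parK.
exact: Omega_par_hom.
Qed.

Lemma gdecomp_hi_right : gdecomp (@Omega_hom k.+1) (@OmegaB_hom k) hi_deg
  (fun i c => hi_beta i * Omega_hi c).
Proof.
have -> : (fun i (c : Omega k.+1) => hi_beta i * Omega_hi c) =
   (fun i c => Omega_hi c * hi_beta i).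
  by apply/funext => i; apply/funext => c; rewrite /hi_beta ext_constC.
exact: gdecomp_hi_left.
Qed.

End Bimodule.

(** * Tensor products with a bimodule that is free on the right *)

Section FsFun.
Variables (I : eqType) (M : zmodType).

(** The tensor product with M will be realized as the families of elements of M with finite
support, indexed by a basis of the bimodule as a right module. *)
Record fsfun := Fsfun {
  fs_fun :> I -> M;
  fs_supp : exists s : seq I, forall i, i \notin s -> fs_fun i = 0 }.

HB.instance Definition _ := gen_eqMixin fsfun.
HB.instance Definition _ := gen_choiceMixin fsfun.

Implicit Types f g : fsfun.

Lemma fs_eq f g : (forall i, f i = g i) -> f = g.
Proof.
case: f g => [f fP] [g gP] /= /funext e; case: g / e gP => gP.
by congr Fsfun; exact: Prop_irrelevance.
Qed.

Fact fs_zero_supp : exists s : seq I, forall i, i \notin s -> (0 : M) = 0.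
Proof. by exists [::]. Qed.
Fact fs_opp_supp f : exists s : seq I, forall i, i \notin s -> - f i = 0.
Proof. by have [s fs] := fs_supp f; exists s => i /fs ->; rewrite oppr0. Qed.
Fact fs_add_supp f g : exists s : seq I, forall i, i \notin s -> f i + g i = 0.
Proof.
have [[s fs] [t gt]] := (fs_supp f, fs_supp g); exists (s ++ t) => i.
by rewrite mem_cat negb_or => /andP[/fs -> /gt ->]; rewrite addr0.
Qed.
Fact fs_single_supp (i : I) (x : M) :
  exists s : seq I, forall j, j \notin s -> (if j == i then x else 0) = 0.
Proof. by exists [:: i] => j; rewrite inE => /negPf ->. Qed.

Definition fs_zero := Fsfun fs_zero_supp.
Definition fs_opp f := Fsfun (fs_opp_supp f).
Definition fs_add f g := Fsfun (fs_add_supp f g).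
Definition fs_single i x := Fsfun (fs_single_supp i x).

Fact fs_addA : associative fs_add.
Proof. by move=> *; apply: fs_eq => i /=; rewrite addrA. Qed.
Fact fs_addC : commutative fs_add.
Proof. by move=> *; apply: fs_eq => i /=; rewrite addrC. Qed.
Fact fs_add0 : left_id fs_zero fs_add.
Proof. by move=> *; apply: fs_eq => i /=; rewrite add0r. Qed.
Fact fs_addN : left_inverse fs_zero fs_opp fs_add.
Proof. by move=> *; apply: fs_eq => i /=; rewrite addNr. Qed.

HB.instance Definition _ := GRing.isZmodule.Build fsfun fs_addA fs_addC fs_add0 fs_addN.

Lemma fs_subE f g i : (f - g) i = f i - g i.
Proof. by []. Qed.

Lemma fs_sumE J (s : seq J) (P : pred J) (E : J -> fsfun) i :
  (\sum_(j <- s | P j) E j) i = \sum_(j <- s | P j) E j i.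
Proof. exact: (morph_sum (fun f g => fs_subE f g i)). Qed.

Lemma fs_singleB i x y : fs_single i (x - y) = fs_single i x - fs_single i y.
Proof. by apply: fs_eq => j; rewrite fs_subE /=; case: eqP => _; rewrite ?subr0. Qed.

Lemma fs_expand f : fin_sum (fun i => fs_single i (f i)) f.
Proof.
have [s fs] := fs_supp f; exists (undup s); split.
- exact: undup_uniq.
- by move=> i; rewrite mem_undup => /fs ->; apply: fs_eq => j /=; case: eqP.
apply: fs_eq => i; rewrite fs_sumE /=.
case: (boolP (i \in s)) => is_.
  rewrite (bigD1_seq i)/= ?mem_undup ?undup_uniq// eqxx big1 ?addr0// => j /negPf ji.
  by rewrite eq_sym ji.
rewrite fs// big1_seq// => j /andP[_]; rewrite mem_undup => js.
by case: eqP => // e; rewrite -e (negPf is_) in js.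
Qed.

Lemma fs_fin_sum (E : I -> M -> fsfun) f : (forall i, E i 0 = 0) ->
  exists x, fin_sum (fun i => E i (f i)) x.
Proof.
move=> E0; have [s fs] := fs_supp f.
exists (\sum_(i <- undup s) E i (f i)); exists (undup s); split=> //.
  exact: undup_uniq.
by move=> i; rewrite mem_undup => /fs ->.
Qed.

Variable hom : bideg -> bool -> M -> Prop.
Variable deg : I -> bideg * bool.

Definition fs_hom (d : bideg) (p : bool) f : Prop :=
  forall i, hom (d - (deg i).1) (p (+) (deg i).2) (f i).

Lemma fs_bigrading : bigrading hom -> bigrading fs_hom.
Proof.
move=> gM; split=> [d p i|d p f g hf hg i|f|s c us hc c0 z zs].
- exact: hom0.
- by rewrite fs_subE; apply: (homB gM).
- pose sp g := exists2 s : seq (bideg * bool * fsfun),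
    (forall z, z \in s -> fs_hom z.1.1 z.1.2 z.2) & g = \sum_(z <- s) z.2.
  have spD g h : sp g -> sp h -> sp (g + h).
    move=> [s sh ->] [t th ->]; exists (s ++ t); last by rewrite big_cat.
    by move=> z; rewrite mem_cat => /orP[/sh|/th].
  have sp0 : sp 0 by exists [::] => //; rewrite big_nil.
  have sp1 i x : sp (fs_single i x).
    have [s sh ->] := hom_span gM x.
    exists [seq (shift_deg z.1 (deg i), fs_single i z.2) | z <- s].
      move=> _ /mapP[z zs ->] j /=; case: eqP => [->|_]; last exact: hom0.
      by rewrite addrK addbK; apply: sh.
    by rewrite big_map (morph_sum (fs_singleB i)).
  have [s [_ _ ->]] := fs_expand f.
  elim: s => [|i s IH]; first by rewrite big_nil.
  by rewrite big_cons; apply: spD.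
apply: fs_eq => i.
have := hom_indep gM (s := [seq unshift_deg z (deg i) | z <- s])
  (c := fun z => c (shift_deg z (deg i)) i).
move=> /(_ _ _ _ (unshift_deg z (deg i))); rewrite unshiftK; apply.
- by rewrite map_inj_uniq//; exact: can_inj (unshiftK _).
- move=> w; have := hc (shift_deg w (deg i)) i.
  by rewrite /= addrK addbK.
- rewrite big_map -[RHS](congr1 (fun f : fsfun => f i) c0) fs_sumE.
  by apply: eq_bigr => w _; rewrite unshiftK.
exact: map_f.
Qed.

End FsFun.

Definition additive_of (V W : zmodType) (f : V -> W)
    (fB : forall x y, f (x - y) = f x - f y) : {additive V -> W} :=
  HB.pack f (GRing.isZmodMorphism.Build V W f fB).

Section TensorConstruction.
Variables (n k' k : nat) (l : Omega k' -> OmegaB n) (r : Omega k -> OmegaB n).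
Hypothesis lB : forall x y, l (x - y) = l x - l y.
Hypothesis lM : forall x y, l (x * y) = l x * l y.
Hypothesis l1 : l 1 = 1.
Hypothesis rM : forall x y, r (x * y) = r x * r y.
Hypothesis r1 : r 1 = 1.
Hypothesis l_hom : forall d p c, @Omega_hom k' d p c -> @OmegaB_hom n d p (l c).
Variables (I : eqType) (deg : I -> bideg * bool) (beta : I -> OmegaB n).
Hypothesis beta_hom : forall i, @OmegaB_hom n (deg i).1 (deg i).2 (beta i).
Hypothesis D : gdecomp (@Omega_hom k) (@OmegaB_hom n) deg (fun i c => beta i * r c).
Variable M : gsmod k.

Let gO : bigrading (@Omega_hom k) := @ext_hom_bigrading _ _ _.
Let gB : bigrading (@OmegaB_hom n) := @ext_hom_bigrading _ _ _.

Fact tens_supp (b : OmegaB n) (x : M) :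
  exists s : seq I, forall i, i \notin s -> gcoord D i b *: x = 0.
Proof.
by have [s _ hs] := gcoord_supp D b; exists s => i /hs ->; rewrite scale0r.
Qed.

Definition tens (b : OmegaB n) (x : M) : fsfun I M := Fsfun (tens_supp b x).

Lemma tensBl x b c : tens (b - c) x = tens b x - tens c x.
Proof. by apply: fs_eq => i; rewrite fs_subE /= gcoordB scalerBl. Qed.

Lemma tensBr b x y : tens b (x - y) = tens b x - tens b y.
Proof. by apply: fs_eq => i; rewrite fs_subE /= scalerBr. Qed.

Lemma gcoord_mulr b a i : gcoord D i (b * r a) = gcoord D i b * a.
Proof.
apply: (gcoord_unique D (c := fun i => gcoord D i b * a)).
have mB (x y : OmegaB n) : (x - y) * r a = x * r a - y * r a by exact: mulrBl.
apply: eq_fin_sum (fin_sum_morph mB (gcoord_sum D b)) => j.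
by rewrite -mulrA rM.
Qed.

Lemma tens_mulr b a x : tens (b * r a) x = tens b (a *: x).
Proof. by apply: fs_eq => i /=; rewrite gcoord_mulr scalerA. Qed.

Lemma tens_beta i x : tens (beta i) x = fs_single i x.
Proof.
apply: fs_eq => j /=; rewrite -[beta i]mulr1 -r1 (gcoord_iota D).
by case: eqP => _; rewrite ?scale1r ?scale0r.
Qed.

(** The action of b on the family f, i.e. on the sum of the beta_i (x) f_i, is the sum of the
(b beta_i) (x) f_i, expanded in the basis again. *)
Lemma act_exists b (f : fsfun I M) :
  exists g, fin_sum (fun i => tens (b * beta i) (f i)) g.
Proof.
apply: (fs_fin_sum (E := fun i => tens (b * beta i))) => i.
exact: (morph0 (tensBr _)).
Qed.

Definition act (b : OmegaB n) (f : fsfun I M) : fsfun I M := projT1 (cid (act_exists b f)).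

Lemma act_sum b (f : fsfun I M) : fin_sum (fun i => tens (b * beta i) (f i)) (act b f).
Proof. by rewrite /act; case: cid. Qed.

Lemma actBl (f : fsfun I M) b c : act (b - c) f = act b f - act c f.
Proof.
apply: fin_sum_eq (act_sum (b - c) f) _.
apply: eq_fin_sum (fin_sumB (act_sum b f) (act_sum c f)) => i.
by rewrite mulrBl tensBl.
Qed.

Lemma actBr b (f g : fsfun I M) : act b (f - g) = act b f - act b g.
Proof.
apply: fin_sum_eq (act_sum b (f - g)) _.
apply: eq_fin_sum (fin_sumB (act_sum b f) (act_sum b g)) => i.
by rewrite tensBr.
Qed.

Lemma act_tens b c x : act b (tens c x) = tens (b * c) x.
Proof.
apply: fin_sum_eq (act_sum b (tens c x)) _.
have mB y z : tens (b * (y - z)) x = tens (b * y) x - tens (b * z) x.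
  by rewrite mulrBr tensBl.
apply: eq_fin_sum (fin_sum_morph mB (gcoord_sum D c)) => i.
by rewrite mulrA tens_mulr.
Qed.

Lemma tens_expand (f : fsfun I M) : fin_sum (fun i => tens (beta i) (f i)) f.
Proof. by apply: eq_fin_sum (fs_expand f) => i; rewrite tens_beta. Qed.

Lemma actA b c (f : fsfun I M) : act b (act c f) = act (b * c) f.
Proof.
apply: fin_sum_eq (fin_sum_morph (actBr b) (act_sum c f)) _.
by apply: eq_fin_sum (act_sum (b * c) f) => i; rewrite act_tens mulrA.
Qed.

Lemma act1 (f : fsfun I M) : act 1 f = f.
Proof.
by apply: fin_sum_eq (act_sum 1 f) _; apply: eq_fin_sum (tens_expand f) => i; rewrite mul1r.
Qed.

Definition tens_scale (a : Omega k') (f : fsfun I M) : fsfun I M := act (l a) f.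

Fact tens_scaleA a c f : tens_scale a (tens_scale c f) = tens_scale (a * c) f.
Proof. by rewrite /tens_scale actA lM. Qed.
Fact tens_scale1 : left_id 1 tens_scale.
Proof. by move=> f; rewrite /tens_scale l1 act1. Qed.
Fact tens_scaleDr : right_distributive tens_scale +%R.
Proof. by move=> a f g; exact: (morphD (actBr (l a))). Qed.
Fact tens_scaleDl f : {morph tens_scale^~ f : a c / a + c}.
Proof. by move=> a c; rewrite /tens_scale (morphD lB) (morphD (actBl f)). Qed.

Definition tens_lmod : lmodType (Omega k') :=
  HB.pack (fsfun I M) (GRing.Zmodule_isLmodule.Build (Omega k') (fsfun I M)
    tens_scaleA tens_scale1 tens_scaleDr tens_scaleDl).

Definition tens_hom : bideg -> bool -> tens_lmod -> Prop := fs_hom (@ghom k M) deg.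

Lemma tens_bigrading : bigrading tens_hom.
Proof. exact/fs_bigrading/gbigrading. Qed.

Lemma tens_is_hom d p e o b x : @OmegaB_hom n d p b -> ghom (g := M) e o x ->
  tens_hom (d + e) (p (+) o) (tens b x).
Proof.
move=> hb hx i; have := gaction (gcoord_hom D gO gB i hb) hx.
by rewrite [(d + e - _)%R]addrAC addbAC.
Qed.

Lemma tens_action : @graded_action k' tens_lmod tens_hom.
Proof.
move=> d p e o a f ha hf.
have [s [_ _ e1]] := act_sum (l a) f.
rewrite -[a *: f]/(act (l a) f) e1; apply: (hom_sum tens_bigrading) => i _.
have := tens_is_hom (ext_homM (l_hom ha) (@beta_hom i)) (hf i).
by rewrite addrACA subrr addr0 addbACA addbb addbF.
Qed.

Definition tens_gsmod : gsmod k' := Gsmod tens_bigrading tens_action.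

Lemma gdecomp_tens : gdecomp (@ghom k M) (@ghom k' tens_gsmod) deg
  (fun i x => tens (beta i) x : tens_gsmod).
Proof.
split=> [i x y|i d p x hx|y|c c0 i].
- exact: tensBr.
- have := tens_is_hom (@beta_hom i) hx; by rewrite addrC addbC.
- by exists y; exact: tens_expand.
have ev f g : (f - g : fsfun I M) i = f i - g i by [].
have := fin_sum_morph ev c0 => s0.
apply/esym; apply: fin_sum_eq s0 _.
apply: eq_fin_sum (fin_sum1 i (c i)) => j.
by rewrite tens_beta /= eq_sym; case: eqP => [->|].
Qed.

Lemma balanced_biadditive (V : zmodType) (u : OmegaB n -> M -> V) : balanced r u ->
  (forall x b c, u (b - c) x = u b x - u c x) /\ (forall b x y, u b (x - y) = u b x - u b y).
Proof.
move=> [uDl uDr _]; split=> [x b c|b x y]; apply/eqP; rewrite -subr_eq opprK.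
  by rewrite -uDl subrK.
by rewrite -uDr subrK.
Qed.

Lemma tens_universal (V : zmodType) (u : OmegaB n -> M -> V) : balanced r u ->
  exists2 f : {additive tens_gsmod -> V}, (forall b x, f (tens b x) = u b x) &
    forall g : {additive tens_gsmod -> V}, (forall b x, g (tens b x) = u b x) -> g =1 f.
Proof.
move=> bu; have [uBl uBr] := balanced_biadditive bu; have [_ _ ur] := bu.
have u0 b : u b 0 = 0 by exact: (morph0 (uBr b)).
have ex (f : fsfun I M) : exists v, fin_sum (fun i => u (beta i) (f i)) v.
  have [s fs] := fs_supp f; exists (\sum_(i <- undup s) u (beta i) (f i)).
  exists (undup s); split=> [|i|//]; first exact: undup_uniq.
  by rewrite mem_undup => /fs ->.
have [F Fsum] := choice ex.
have FB f g : F (f - g) = F f - F g.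
  apply: fin_sum_eq (Fsum (f - g)) _.
  by apply: eq_fin_sum (fin_sumB (Fsum f) (Fsum g)) => i; rewrite -uBr.
have Ft b x : F (tens b x) = u b x.
  apply: fin_sum_eq (Fsum (tens b x)) _.
  apply: eq_fin_sum (fin_sum_morph (uBl x) (gcoord_sum D b)) => i.
  by rewrite ur.
exists (additive_of (V := tens_gsmod) FB) => [//|g gt f].
apply/esym; apply: fin_sum_eq (Fsum f) _.
apply: eq_fin_sum (fin_sum_morph (raddfB g) (tens_expand f)) => i.
by rewrite gt.
Qed.

Lemma tens_is_tensor : is_tensor l r (tens : OmegaB n -> M -> tens_gsmod).
Proof.
split=> [|a b x|d p e o b x hb hx|]; last exact: tens_universal.
- split=> [b c x|b x y|b a x]; last exact: tens_mulr.
  + exact: (morphD (tensBl x)).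
  + exact: (morphD (tensBr b)).
- by rewrite -[RHS]/(act (l a) (tens b x)) act_tens.
exact: tens_is_hom.
Qed.

(** ** Uniqueness of the tensor product *)
Section AnyTensor.
Variables (T : gsmod k') (t : OmegaB n -> M -> T).
Hypothesis tT : is_tensor l r t.

(** Two objects with the same universal property are isomorphic, compatibly with the
balanced maps. *)
Lemma tensor_comparison : exists (F : tens_gsmod -> T) (G : T -> tens_gsmod),
  [/\ forall x y, F (x - y) = F x - F y, forall x y, G (x - y) = G x - G y,
      forall b x, F (tens b x) = t b x & cancel G F /\ cancel F G].
Proof.
have [bt _ _ ut] := tT.
have [F Ft _] := tens_universal bt.
have [tb _ _ _] := tens_is_tensor.
have [G Gt _] := ut _ _ tb.
exists F, G; split=> //; [exact: raddfB|exact: raddfB|split=> x].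
- have [H Ht Hu] := ut _ _ bt.
  have := Hu (F \o G : {additive T -> T}) => /(_ _ x) /= ->.
    by apply/esym; apply: (Hu (idfun : {additive T -> T})).
  by move=> b y /=; rewrite Gt Ft.
have [H Ht Hu] := tens_universal tb.
have := Hu (G \o F : {additive tens_gsmod -> tens_gsmod}) => /(_ _ x) /= ->.
  by apply/esym; apply: (Hu (idfun : {additive tens_gsmod -> tens_gsmod})).
by move=> b y /=; rewrite Ft Gt.
Qed.

Lemma gdecomp_tensor : gdecomp (@ghom k M) (@ghom k' T) deg (fun i x => t (beta i) x).
Proof.
have [F [G [FB GB Ft [GK FK]]]] := tensor_comparison.
have [_ _ ts ti] := gdecomp_tens.
have [bt _ tht _] := tT; have [_ uBr] := balanced_biadditive bt.
split=> [i x y|i d p x hx|y|c c0].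
- exact: uBr.
- by have := tht _ _ _ _ _ _ (@beta_hom i) hx; rewrite addrC addbC.
- have [c sc] := ts (G y); exists c; rewrite -[y]GK.
  by apply: eq_fin_sum (fin_sum_morph FB sc) => i; rewrite Ft.
apply: ti; rewrite -(morph0 GB).
by apply: eq_fin_sum (fin_sum_morph GB c0) => i; rewrite -Ft FK.
Qed.

Variables (I' J : eqType) (deg' : I' -> bideg * bool) (beta' : I' -> OmegaB n).
Hypothesis D' : gdecomp (@Omega_hom k') (@OmegaB_hom n) deg' (fun i c => l c * beta' i).
Variables (degJ : J -> bideg * bool) (g : J -> M).
Hypothesis DM : gdecomp (@Omega_hom k) (@ghom k M) degJ (fun j c => c *: g j).

(** A homogeneous basis of M gives one of the tensor product: both are sums of
copies of the bimodule, which is also free on the left. *)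
Lemma gdecomp_tensor_basis : gdecomp (@Omega_hom k') (@ghom k' T)
  (fun z : J * I' => shift_deg (deg' z.2) (degJ z.1))
  (fun z c => c *: t (beta' z.2) (g z.1)).
Proof.
have [bt tl tht _] := tT; have [uBl uBr] := balanced_biadditive bt; have [_ _ tr] := bt.
have [gB1 gh _ gi] := DM.
suff E : gdecomp (@OmegaB_hom n) (@ghom k' T) degJ (fun j b => t b (g j)).
  have := gdecomp_comp E D'.
  by congr gdecomp; apply/funext => z; apply/funext => c; rewrite tl.
have ghomj j : ghom (degJ j).1 (degJ j).2 (g j).
  have := gh j _ _ _ (@ext_hom1 k k (fun i => (2 * i.+1)%:Z)).
  by rewrite add0r addFb scale1r.
split=> [j b c|j d p b hb|y|c c0 j].
- exact: uBl.
- exact: tht.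
- pose sp y := exists c, fin_sum (fun j => t (c j) (g j)) y.
  have spD x z : sp x -> sp z -> sp (x + z).
    move=> [c hc] [d hd]; exists (fun j => c j + d j).
    by apply: eq_fin_sum (fin_sumD hc hd) => j; rewrite (morphD (uBl _)).
  have sp0 : sp 0.
    by exists (fun=> 0); apply: eq_fin_sum (fin_sum0 _ _) => j; rewrite (morph0 (uBl _)).
  have spt b x : sp (t b x).
    exists (fun j => b * r (gcoord DM j x)).
    apply: eq_fin_sum (fin_sum_morph (uBr b) (gcoord_sum DM x)) => j.
    by rewrite tr.
  have [_ _ ts _] := gdecomp_tensor; have [c [s [_ _ ->]]] := ts y.
  elim: s => [|i s IH]; first by rewrite big_nil.
  by rewrite big_cons; apply: spD.
apply: (gcoord_inj (D := D)) => i; rewrite (morph0 (gcoordB D i)).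
have DT := gdecomp_tensor.
have cT b x : gcoord DT i (t b x) = gcoord D i b *: x.
  apply: (gcoord_unique DT (c := fun i => gcoord D i b *: x)).
  apply: eq_fin_sum (fin_sum_morph (uBl x) (gcoord_sum D b)) => i'.
  by rewrite tr.
apply: (gi (fun j => gcoord D i (c j))).
rewrite -(morph0 (gcoordB DT i)).
by apply: eq_fin_sum (fin_sum_morph (gcoordB DT i) c0) => j'; rewrite cT.
Qed.

End AnyTensor.

End TensorConstruction.

(** * Augmentation and heights *)

Section Augmentation.
Variable k : nat.

Definition aug (r : Omega k) : rat := (r finset.set0)@_0.

Lemma augB r s : aug (r - s) = aug r - aug s.
Proof. by rewrite /aug ffunE mcoeffD ffunE mcoeffN. Qed.

Lemma aug0 : aug 0 = 0.
Proof. exact: (morph0 augB). Qed.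

Lemma augD r s : aug (r + s) = aug r + aug s.
Proof. exact: (morphD augB). Qed.

Lemma augM r s : aug (r * s) = aug r * aug s.
Proof. by rewrite /aug ext_mul_set0 [LHS]rmorphM. Qed.

Lemma aug_const c : aug (Oconst k c) = c.
Proof. by rewrite /aug ffunE eqxx mcoeffC eqxx mulr1. Qed.

Lemma aug_par r : aug (ext_par r) = aug r.
Proof. by rewrite /aug ffunE cards0 mul1r. Qed.

(** A positive grading of the augmentation ideal: x_i and s_i have heights 2i
and 4k+2-2i. *)
Definition hgt (d : bideg) : int := d.1 + (2 * k%:Z + 1) * d.2.

Notation mdeg2 := (mon_deg (fun i : 'I_k => (2 * i.+1)%:Z)).

Lemma mon_height (a : 'X_{1..k}) (U : {set 'I_k}) :
  hgt (mdeg2 a U) = \sum_(i < k) (2 * i.+1)%:Z *+ a i +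
                    \sum_(j in U) (4 * k%:Z + 2 - (2 * j.+1)%:Z).
Proof.
rewrite /hgt /mon_deg /= -addrA; congr (_ + _).
rewrite sumrB sumr_const addrC; congr (_ - _).
by rewrite -[RHS]mulr_natr !natz PoszM; ring.
Qed.

Let sval_gt0 (j : 'I_k) : 0 < 4 * k%:Z + 2 - (2 * j.+1)%:Z.
Proof. by have := ltn_ord j; lia. Qed.

Lemma mon_height_ge0 a (U : {set 'I_k}) : 0 <= hgt (mdeg2 a U).
Proof.
rewrite mon_height addr_ge0// sumr_ge0// => j _; first exact: mulrn_wge0.
exact/ltW/sval_gt0.
Qed.

Lemma mon_height_eq0 (a : 'X_{1..k}) (U : {set 'I_k}) :
  hgt (mdeg2 a U) = 0 -> a = 0%MM /\ U = finset.set0.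
Proof.
rewrite mon_height => /eqP; rewrite paddr_eq0; last 2 first.
- by rewrite sumr_ge0// => i _; exact: mulrn_wge0.
- by rewrite sumr_ge0// => j _; exact/ltW/sval_gt0.
move=> /andP[/eqP h1 /eqP h2]; split.
  apply/mnmP => i; rewrite mnm0E.
  have n0 (j : 'I_k) : true -> 0 <= (2 * j.+1)%:Z *+ a j by move=> _; exact: mulrn_wge0.
  have /eqP := psumr_eq0P n0 h1 (i := i) isT.
  by rewrite mulrn_eq0 orbF => /eqP.
apply/setP => j; rewrite inE; apply/negP => jU.
have n0 (i : 'I_k) : i \in U -> 0 <= 4 * k%:Z + 2 - (2 * i.+1)%:Z.
  by move=> _; exact/ltW/sval_gt0.
by have := psumr_eq0P n0 h2 jU; have := sval_gt0 j; lia.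
Qed.

Lemma hgt0 : hgt 0 = 0.
Proof. by rewrite /hgt mulr0. Qed.

(** The algebra is connected for the height: its part of height zero consists of constants. *)
Lemma Omega_hom_cases d p (r : Omega k) : Omega_hom d p r ->
  [\/ r = 0, (d, p) = (0, false) /\ r = Oconst k (aug r) | 0 < hgt d /\ aug r = 0].
Proof.
move=> hr; have [->|/eqP r0] := eqVneq r 0; first by constructor 1.
have [U [a aU]] : exists U a, a \in msupp (r U).
  apply: contrapT => nU; apply: r0; apply/ffunP => U; apply/mpolyP => a.
  rewrite ffunE mcoeff0; apply: memN_msupp_eq0; apply/negP => aU.
  by apply: nU; exists U, a.
have [dE pE] := hr U a aU.
have key V b : hgt d = 0 -> b \in msupp (r V) -> b = 0%MM /\ V = finset.set0.
  by move=> d0 /hr[e _]; apply: mon_height_eq0; rewrite e.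
have := mon_height_ge0 a U; rewrite dE le_eqVlt => /orP[/eqP/esym h0|hp].
  have [a0 U0] := key U a h0 aU.
  constructor 2; split.
    rewrite -dE -pE a0 U0 /mon_deg cards0 big_set0 subr0 muln0.
    by congr (_, _, _); rewrite big1// => i _; rewrite mnm0E.
  apply/ffunP => V; apply/mpolyP => b; rewrite ffunE.
  case: eqP => [->|V0]; last first.
    by rewrite mcoeff0; apply: memN_msupp_eq0; apply/negP => /(key _ _ h0)[].
  rewrite mcoeffC; case: eqVneq => [->|b0]; first by rewrite mulr1.
  rewrite mulr0; apply: memN_msupp_eq0; apply/negP => bV.
  have [b0' _] := key _ _ h0 bV.
  by rewrite b0' eqxx in b0.
constructor 3; split=> //; apply: memN_msupp_eq0; apply/negP => /hr[e _].
move: hp; rewrite -e /mon_deg /hgt cards0 big_set0 subr0 muln0 mulr0 addr0 big1//.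
by move=> i _; rewrite mnm0E.
Qed.

Lemma hgtB d e : hgt (d - e) = hgt d - hgt e.
Proof. by rewrite /hgt /=; ring. Qed.

Let gO : bigrading (@Omega_hom k) := @ext_hom_bigrading _ _ _.

Lemma gcomp_aug r : gcomp gO (0, false) r = Oconst k (aug r).
Proof.
have c0 : gcomp gO (0, false) r = Oconst k (aug (gcomp gO (0, false) r)).
  case: (Omega_hom_cases (gcomp_hom gO (0, false) r)) => [->|[_ //]|[]].
    by rewrite aug0 /Oconst mpolyC0; apply/esym; exact: rmorph0.
  by rewrite hgt0 ltxx.
rewrite c0; congr Oconst.
have := fin_sum_morph augB (gcomp_sum gO r) => s1.
apply/esym; apply: fin_sum_eq s1 _.
apply: eq_fin_sum (fin_sum1 (0, false) (aug (gcomp gO (0, false) r))) => z.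
case: eqP => [->//|z0].
case: (Omega_hom_cases (gcomp_hom gO z r)) => [->|[e _]|[]//]; first by rewrite aug0.
by case: z0; rewrite -e -surjective_pairing.
Qed.

Lemma aug_gcomp z r : aug (gcomp gO z r) = if z == (0, false) then aug r else 0.
Proof.
case: eqP => [->|z0]; first by rewrite gcomp_aug aug_const.
case: (Omega_hom_cases (gcomp_hom gO z r)) => [->|[e _]|[]//]; first by rewrite aug0.
by case: z0; rewrite -e -surjective_pairing.
Qed.

(** By the positivity of heights, only the constant term of r contributes to the component of
r v in the degree of v. *)
Lemma gcomp_scale (M : gsmod k) d p (r : Omega k) (v : M) : ghom d p v ->
  gcomp (gbigrading M) (d, p) (r *: v) = Oconst k (aug r) *: v.
Proof.
move=> hv; have sB (a c : Omega k) : (a - c) *: v = a *: v - c *: v by exact: scalerBl.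
rewrite (gcomp_morph gO (gbigrading M) (f := fun r => r *: v) (w := (d, p)) sB).
  by rewrite /unshift_deg /= subrr addbb gcomp_aug.
by move=> e o a ha; exact: gaction.
Qed.

End Augmentation.

(** * Multiplicities of simple modules *)

Section SimpleMultiplicity.
Variables (k : nat) (d : bideg) (p : bool).

Definition line : gsmod k := gshift d (parity_pow p (gsimple k)).

(** A shift of the simple module is a copy of the rationals, on which the
algebra acts through the augmentation. *)
Lemma line_coordinate : exists e : rat -> line,
  [/\ forall r c c', e (aug r * c + c') = r *: e c + e c',
      forall c e' o, ghom e' o (e c) <-> c = 0 \/ (e', o) = (d, p) &
      exists e' : line -> rat, cancel e e' /\ cancel e' e].
Proof.
rewrite /line; case: p => /=.
- exists (fun c => c : rat); split=> [r c c'|c e' o|]; last by exists (fun c => c : rat).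
    by rewrite -aug_par.
  rewrite /pi_hom /= /simple_hom; split=> [[->|[/eqP]]|[->|[-> ->]]]; [by left| |by left|].
    by rewrite subr_eq0 => /eqP -> /negbFE ->; right.
  by right; rewrite subrr.
exists (fun c => c : rat); split=> [r c c'//|c e' o|]; last by exists (fun c => c : rat).
rewrite /= /simple_hom; split=> [[->|[/eqP]]|[->|[-> ->]]]; [by left| |by left|].
  by rewrite subr_eq0 => /eqP -> ->; right.
by right; rewrite subrr.
Qed.

Variable M : gsmod k.
Implicit Types (U W : M -> Prop).

Lemma gsubmod_subspace U : gsubmod U -> subspace (U : qmod M -> Prop).
Proof. by move=> [U0 Ul _]; split=> // a x y Ux Uy; exact: Ul. Qed.

(** A preimage of a generator of the line has a homogeneous component outside U, and the
degree of that component is that of the line. *)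
Lemma factor_vector U W : gsubmod U -> gsubmod W -> subquotient_iso U W line ->
  exists w, [/\ W w, ghom d p w & ~ U w].
Proof.
move=> sU [W0 Wl Ws] [f [fl fh fs fk]].
have [e [el eh [e' [eK e'K]]]] := line_coordinate.
have f0 : f 0 = 0.
  by have := fl (-1) 0 0 W0 W0; rewrite scaler0 addr0 scaleN1r addNr.
have fD x y : W x -> W y -> f (x + y) = f x + f y.
  by move=> Wx Wy; have := fl 1 x y Wx Wy; rewrite !scale1r.
have e0 : e 0 = 0 by have := el (-1) 0 0; rewrite mulr0 addr0 scaleN1r addNr.
have e1 : e 1 <> 0 by rewrite -e0 => /(can_inj eK)/eqP; rewrite oner_eq0.
have [w Ww fw] := fs (e 1).
have [s hs ws] := Ws w Ww.
have sub t : {subset t <= s} -> W (\sum_(z <- t) z.2) /\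
    (f (\sum_(z <- t) z.2) = 0 \/ exists2 z, z \in t & f z.2 <> 0).
  elim: t => [|z t IH] ts; first by rewrite big_nil; split=> //; left.
  rewrite big_cons; have [|Wt ft] := IH; first by move=> y yt; apply: ts; rewrite inE yt orbT.
  have [|Wz _] := hs z; first by apply: ts; rewrite inE eqxx.
  split; first by rewrite -[z.2]scale1r; apply: Wl.
  rewrite fD//; have [fz|fz] := pselect (f z.2 = 0); last first.
    by right; exists z; rewrite ?inE ?eqxx.
  case: ft => [->|[y yt fy]]; first by left; rewrite fz addr0.
  by right; exists y; rewrite // inE yt orbT.
have [_ []] := sub s (fun _ h => h); first by rewrite -ws fw => /e1.
move=> [z zs fz]; have [Wz hz] := hs z zs.
exists z.2; split=> //; last by move=> /(fk _ Wz).
have := fh _ _ _ Wz hz; rewrite -[f z.2]e'K => /eh[e'0|].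
  by case: fz; rewrite -[f z.2]e'K e'0.
by move: hz; rewrite [z.1]surjective_pairing /= => + [<- <-].
Qed.

(** Vectors representing the factors are independent: in a relation, the vector of the largest
step that occurs would already belong to the smaller submodule of that step. *)
Lemma factors_le n N : has_dim (qhom M d p) N -> has_factors M line n -> (n <= N)%N.
Proof.
move=> hN [h [U [J [[sU Umono] _ _ <- UJ]]]].
have Ule i j x : (i <= j)%N -> U i x -> U j x.
  move=> /subnK <-; elim: (j - i)%N => [//|m IH] /IH; exact: Umono.
have [w hw] : exists w : 'I_h -> M, forall i, i \in J ->
    [/\ U i.+1 (w i), ghom d p (w i) & ~ U i (w i)].
  have ex (i : 'I_h) : exists x, i \in J -> [/\ U i.+1 x, ghom d p x & ~ U i x].
    have [iJ|] := boolP (i \in J); last by exists 0.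
    by have [x hx] := factor_vector (sU i) (sU i.+1) (UJ i iJ); exists x.
  by have [w hw] := choice ex; exists w.
pose b (j : 'I_#|J|) : qmod M := w (enum_val j).
apply: (has_dim_free_le hN (b := b)) => [j|c c0 j].
  by have [_] := hw _ (enum_valP j).
apply: contrapT => /eqP cj.
(* The largest step with a nonzero coefficient. *)
case: (arg_maxnP (fun j => enum_val j : nat) (P := fun j => c j != 0) cj) => m cm mmax.
have [_ _] := hw _ (enum_valP m); apply; rewrite -/(b m).
have sp := gsubmod_subspace (sU (enum_val m)).
have -> : b m = (c m)^-1 *: - \sum_(i | i != m) c i *: b i.
  move: c0; rewrite /lincomb (bigD1 m)//= => /eqP; rewrite addr_eq0 => /eqP <-.
  by rewrite scalerA mulVf// scale1r.
apply: (subspaceZ sp); rewrite -sub0r; apply: (subspaceB sp); first by case: sp.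
rewrite big_mkcond; apply: (subspace_sum _ sp) => i; case: eqP => [_|/eqP im] /=.
  by case: sp.
have [->|ci] := eqVneq (c i) 0; first by rewrite scale0r; case: sp.
apply: (subspaceZ sp); have [Ui _ _] := hw _ (enum_valP i).
apply: Ule Ui; rewrite ltn_neqAle (mmax i ci : (enum_val i <= enum_val m)%N) andbT.
by apply: contra im => /eqP/val_inj/enum_val_inj ->.
Qed.

(** These submodules grow with i by one line at a time, since the coefficients on the v_j are
determined modulo the augmentation ideal when the v_j are a basis of their degree. *)
Definition aug_filtration n (v : 'I_n -> M) (i : nat) (x : M) : Prop :=
  exists2 r : 'I_n -> Omega k, x = \sum_j r j *: v j & forall j : 'I_n, (i <= j)%N -> aug (r j) = 0.

Lemma aug_filtration_gsubmod n (v : 'I_n -> M) i : (forall j, ghom d p (v j)) ->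
  gsubmod (aug_filtration v i).
Proof.
move=> hv; split=> [|a _ _ [r -> r0] [s -> s0]|_ [r -> r0]].
- by exists (fun=> 0) => [|j _]; [rewrite big1// => j _; rewrite scale0r|exact: aug0].
- exists (fun j => a * r j + s j) => [|j ij]; last by rewrite augD augM r0// s0// mulr0 addr0.
  rewrite scaler_sumr -big_split; apply: eq_bigr => j _.
  by rewrite scalerA scalerDl.
pose gO : bigrading (@Omega_hom k) := @ext_hom_bigrading _ _ _.
pose sp x := exists2 s : seq (bideg * bool * M),
  (forall z, z \in s -> aug_filtration v i z.2 /\ ghom z.1.1 z.1.2 z.2) & x = \sum_(z <- s) z.2.
have spD x y : sp x -> sp y -> sp (x + y).
  move=> [s hs ->] [t ht ->]; exists (s ++ t); last by rewrite big_cat.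
  by move=> z; rewrite mem_cat => /orP[/hs|/ht].
have sp0 : sp 0 by exists [::] => //; rewrite big_nil.
suff spj j : sp (r j *: v j).
  by elim: (index_enum _) => [|j t IH]; rewrite ?big_nil// big_cons; apply: spD.
have [s [us _ rs]] := gcomp_sum gO (r j).
exists [seq (shift_deg z (d, p), gcomp gO z (r j) *: v j) | z <- s].
  move=> _ /mapP[z zs ->] /=; split; last exact: (gaction (gcomp_hom gO z (r j)) (hv j)).
  exists (fun l => if l == j then gcomp gO z (r j) else 0) => [|l il].
    rewrite (bigD1 j)//= eqxx big1 ?addr0// => l /negPf ->.
    by rewrite scale0r.
  case: eqP => [e|_]; last exact: aug0.
  by rewrite aug_gcomp r0 -?e//; case: ifP.
rewrite big_map /= -scaler_suml -rs//.
Qed.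

(** A basis of the component of degree (d, p) is turned into a filtration with that many
factors by [aug_filtration]; one more step at the top reaches all of M. *)
Lemma factors_ge N : has_dim (qhom M d p) N -> has_factors M line N.
Proof.
move=> [v [hv sv fv]].
have [e [el eh [e' [eK e'K]]]] := line_coordinate.
pose gM := gbigrading M.
have [cf cfE] : exists cf : M -> 'I_N -> rat, forall x,
    gcomp gM (d, p) x = lincomb (v : 'I_N -> qmod M) (cf x).
  have ex (x : M) : exists c, gcomp gM (d, p) x = lincomb (v : 'I_N -> qmod M) c.
    have [c /eqP] := sv _ (gcomp_hom gM (d, p) x).
    by rewrite subr_eq0 => /eqP ->; exists c.
  by have [c hc] := choice ex; exists c.
have cf_unique x c : gcomp gM (d, p) x = lincomb (v : 'I_N -> qmod M) c -> forall j, cf x j = c j.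
  rewrite cfE => ec j; apply/eqP; rewrite -subr_eq0; apply/eqP.
  by apply: (fv (fun j => cf x j - c j)); rewrite lincombB ec subrr.
have cf_aug (r : 'I_N -> Omega k) j : cf (\sum_i r i *: v i) j = aug (r j).
  apply: (cf_unique _ (fun j => aug (r j))).
  rewrite (morph_sum (gcompB gM (d, p))); apply: eq_bigr => i _.
  exact: gcomp_scale (hv i).
pose U i x := if i is i'.+1 then (N < i')%N \/ aug_filtration v i' x else x = 0.
exists N.+2, U, [set inord i.+1 | i : 'I_N]; split.
- split=> [[|i]|[|i] x] /=.
  + split=> //= [r x y -> ->|x ->]; first by rewrite scaler0 addr0.
    by exists [::]; rewrite ?big_nil.
  + have [Ni|Ni] := ltnP N i; last first.
      have [a1 a2 a3] := aug_filtration_gsubmod i hv.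
      have UE x : U i.+1 x -> aug_filtration v i x by case=> //; rewrite ltnNge Ni.
      split=> [|r x y /UE hx /UE hy|x /UE hx]; [by right|by right; apply: a2|].
      have [s hs ->] := a3 x hx; exists s => // z /hs[h1 h2]; by split=> //; right.
    split=> [|r x y _ _|x _]; [by left|by left|].
    have [s hs ->] := hom_span gM x; exists s => // z /hs h; by split=> //; left.
  + move=> ->; right; exists (fun=> 0) => [|j _]; last exact: aug0.
    by rewrite big1// => j _; rewrite scale0r.
  + case=> [Ni|[r -> r0]]; first by left; exact: leqW.
    by right; exists r => // j /ltnW; exact: r0.
- by [].
- by move=> x /=; left.
- rewrite card_imset ?card_ord// => i j /(congr1 val) /=.
  by rewrite !inordK ?ltnS ?(ltnW (ltn_ord _))// => -[] /val_inj.
move=> _ /imsetP[i _ ->]; rewrite inordK ?ltnS ?(ltnW (ltn_ord i))//.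
have WE x : U i.+2 x -> aug_filtration v i.+1 x.
  by case=> //; rewrite ltnNge ltn_ord.
have e0 : e 0 = 0 by have := el (-1) 0 0; rewrite mulr0 addr0 scaleN1r addNr.
exists (fun x => e (cf x i)); split.
- move=> r x y /WE[a -> _] /WE[b -> _]; rewrite -el; congr e.
  have -> : r *: (\sum_j a j *: v j) + \sum_j b j *: v j = \sum_j (r * a j + b j) *: v j.
    rewrite scaler_sumr -big_split; apply: eq_bigr => j _.
    by rewrite scalerA scalerDl.
  by rewrite !cf_aug augD augM.
- move=> d' p' x _ hx; apply/eh.
  have [->|ne] := eqVneq (d', p') (d, p); [by right|left].
  apply: (cf_unique _ (fun=> 0)); rewrite (gcomp_of_hom gM hx) eq_sym (negPf ne).
  by rewrite /lincomb big1// => j _; rewrite scale0r.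
- move=> t; exists (Oconst k (e' t) *: v i).
    right; exists (fun j => if j == i then Oconst k (e' t) else 0) => [|j ij].
      rewrite (bigD1 i)//= eqxx big1 ?addr0// => j /negPf ->.
      by rewrite scale0r.
    by case: eqP ij => [->|_ _]; [rewrite ltnn|exact: aug0].
  have := cf_aug (fun j => if j == i then Oconst k (e' t) else 0) i.
  rewrite eqxx aug_const (bigD1 i)//= eqxx big1 ?addr0 => [->|j /negPf ->].
    exact: e'K.
  by rewrite scale0r.
move=> x Wx; have [r xr r0] := WE x Wx; split=> [|[|[a -> a0]]].
- rewrite xr cf_aug -{1}e0 => /(can_inj eK) ri; right; exists r => // j.
  by rewrite leq_eqVlt => /orP[/eqP/val_inj <-|/r0].
- by rewrite ltnNge ltnW// ltn_ord.
by rewrite cf_aug a0// e0.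
Qed.

Lemma simple_multE : locally_finite M -> simple_mult M d p = gdim M d p.
Proof.
move=> /locally_finiteP/(_ d p) hd; rewrite /simple_mult /jh_mult.
case: xgetP => [n _ [hn nmax]|/(_ (gdim M d p))]; last first.
  by case; split; [exact: factors_ge|move=> m; exact: factors_le].
by apply/eqP; rewrite eqn_leq (factors_le hd hn) nmax//; exact: factors_ge.
Qed.

End SimpleMultiplicity.

(** * Graded morphisms, exactness and isomorphisms *)

Section GradedMorphisms.
Variable k : nat.
Implicit Types M N : gsmod k.

Lemma gmorB M N (f : M -> N) : is_gmor f -> forall x y, f (x - y) = f x - f y.
Proof. by move=> [fl _] x y; rewrite addrC -scaleN1r fl scaleN1r addrC. Qed.

Lemma gmorZ M N (f : M -> N) : is_gmor f -> forall r x, f (r *: x) = r *: f x.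
Proof.
by move=> fm r x; have [fl _] := fm; rewrite -[_ *: _]addr0 fl (morph0 (gmorB fm)) addr0.
Qed.

Lemma gmor_hom M N (f : M -> N) d p x : is_gmor f -> ghom d p x -> ghom d p (f x).
Proof. by move=> [_ fh]; exact: fh. Qed.

Lemma gcomp_gmor M N (f : M -> N) z x : is_gmor f ->
  gcomp (gbigrading N) z (f x) = f (gcomp (gbigrading M) z x).
Proof.
move=> fm; have fh d p y : ghom d p y -> ghom (d + 0) (p (+) false) (f y).
  by rewrite addr0 addbF; exact: gmor_hom.
have := gcomp_morph (gbigrading M) (gbigrading N) (w := (0, false)) (gmorB fm) fh z x.
by rewrite /unshift_deg /= subr0 addbF -surjective_pairing.
Qed.

Lemma gmor_lift_hom M N (f : M -> N) d p y : is_gmor f -> (forall y, exists x, f x = y) ->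
  ghom d p y -> exists2 x, ghom d p x & f x = y.
Proof.
move=> fm fs hy; have [x xy] := fs y.
exists (gcomp (gbigrading M) (d, p) x); first exact: (gcomp_hom _ (d, p)).
by rewrite -gcomp_gmor// xy gcomp_id.
Qed.

Lemma gmor_inj_hom M N (f : M -> N) d p x : is_gmor f -> injective f ->
  ghom d p (f x) -> ghom d p x.
Proof.
move=> fm fi /(gcomp_id (gbigrading N)); rewrite gcomp_gmor// => /fi <-.
exact: (gcomp_hom _ (d, p)).
Qed.

Lemma gdim_short_exact M1 M M2 d p : locally_finite M1 -> locally_finite M2 ->
  short_exact M1 M M2 -> gdim M d p = (gdim M1 d p + gdim M2 d p)%N.
Proof.
move=> /locally_finiteP/(_ d p) h1 /locally_finiteP/(_ d p) [c [hc sc fc]].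
move=> [f [g [[fm gm] fi gs fg]]].
have ex i : exists x, ghom d p x /\ g x = c i.
  by have [x] := gmor_lift_hom gm gs (hc i); exists x.
have [b hb] := choice ex.
pose Q (x : qmod M) := exists2 y, ghom d p y & f y = x.
have gl a (cc : 'I_a -> rat) (e : 'I_a -> qmod M) :
    g (lincomb e cc) = lincomb (fun i => g (e i) : qmod M2) cc.
  rewrite /lincomb (morph_sum (gmorB gm)); apply: eq_bigr => i _.
  exact: gmorZ.
have sQ : subspace Q.
  split=> [|a _ _ [x hx <-] [y hy <-]].
    by exists 0; [exact: (hom0 (gbigrading M1))|exact: (morph0 (gmorB fm))].
  exists ((a *: (x : qmod M1)) + y); first by case: (qhom_subspace M1 d p) => _; apply.
  by case: fm => fl _; exact: fl.
apply: gdimP; apply: (has_dim_mod (P := qhom M d p) (b := b) sQ); last first.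
- apply: (has_dim_inj (f := f : qmod M1 -> qmod M) _ _ _ _ h1) => [a x y|x hx|_ [x hx <-]|x].
  + by case: fm => fl _; exact: fl.
  + by exists x.
  + by exists x.
  + by rewrite -[X in _ = X](morph0 (gmorB fm)) => /fi.
- split=> [i|x hx|cc [y hy e]].
  + by have [] := hb i.
  + have [cc /eqP] := sc _ (gmor_hom gm hx); rewrite subr_eq0 => /eqP gx.
    have hl : qhom M d p (x - lincomb (b : 'I__ -> qmod M) cc).
      apply: (homB (gbigrading M)) => //.
      by apply: (subspace_lincomb _ (qhom_subspace M d p)) => i; have [] := hb i.
    exists cc; have [|y ey] := (fg (x - lincomb (b : 'I__ -> qmod M) cc)).1.
      rewrite (gmorB gm) gl gx; apply/eqP; rewrite subr_eq0; apply/eqP.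
      by apply: eq_bigr => i _; have [_ ->] := hb i.
    by exists y => //; apply: (gmor_inj_hom fm fi); rewrite ey.
  + apply: fc; have -> : lincomb (c : 'I__ -> qmod M2) cc = g (lincomb (b : 'I__ -> qmod M) cc).
      by rewrite gl; apply: eq_bigr => i _; have [_ ->] := hb i.
    by apply/fg; exists y.
by move=> x [y hy <-]; exact: gmor_hom.
Qed.

Lemma split_short_exact M1 M M2 : split_exact M1 M M2 -> short_exact M1 M M2.
Proof.
move=> [f1 [f2 [m1 m2 [h hK Kh]]]].
have z1 := morph0 (gmorB m1); have z2 := morph0 (gmorB m2).
have hE x1 x2 : h (f1 x1 + f2 x2) = (x1, x2) by exact: (hK (x1, x2)).
have xE x : x = f1 (h x).1 + f2 (h x).2 by rewrite Kh.
exists f1, (fun x => (h x).2); split.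
- split=> //; split=> [r x y|d p x hx].
    rewrite [x in LHS]xE [y in LHS]xE scalerDr -!gmorZ// addrACA.
    by rewrite -(morphD (gmorB m1)) -(morphD (gmorB m2)) hE.
  have := gcomp_id (gbigrading M) hx; rewrite [x in gcomp _ _ x]xE.
  rewrite (morphD (gcompB (gbigrading M) (d, p))) !gcomp_gmor// => <-.
  by rewrite hE; exact: (gcomp_hom _ (d, p)).
- by move=> x y e; have := hE x 0; rewrite e hE => -[].
- by move=> y; exists (f2 y); rewrite -[f2 y]add0r -z1 hE.
move=> x; split=> [e|[y <-]]; first by exists (h x).1; rewrite [RHS]xE e z2 addr0.
by rewrite -[f1 y]addr0 -z2 hE.
Qed.

Lemma gmor_inverse M N (f : M -> N) g : is_gmor f -> cancel f g -> cancel g f -> is_gmor g.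
Proof.
move=> fm fK gK.
split=> [r x y|d p x hx]; first by apply: (can_inj fK); case: (fm) => fl _; rewrite fl !gK.
by apply: (gmor_inj_hom fm (can_inj fK)); rewrite gK.
Qed.

Lemma giso_sym M N : giso M N -> giso N M.
Proof. by move=> [f fm [g fK gK]]; exists g; [exact: gmor_inverse fm _ _|exists f]. Qed.

Lemma giso_gsupp M N d : giso M N -> gsupp M d -> gsupp N d.
Proof.
move=> [f fm [g fK gK]] [p [x [hx x0]]]; exists p, (f x); split; first exact: gmor_hom.
by rewrite -[0](morph0 (gmorB fm)) => /(can_inj fK).
Qed.

Lemma giso_has_dim M N d p n : giso M N -> has_dim (qhom M d p) n -> has_dim (qhom N d p) n.
Proof.
move=> [f fm [g fK gK]].
apply: (has_dim_inj (f := f : qmod M -> qmod N)) => [a x y|x|y hy|x].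
- by case: fm => fl _; exact: fl.
- exact: gmor_hom.
- by exists (g y); [apply: (gmor_inj_hom fm (can_inj fK))|]; rewrite gK.
by rewrite -[X in _ = X](morph0 (gmorB fm)) => /(can_inj fK).
Qed.

Lemma giso_admissible b M N : giso M N -> admissible b M -> admissible b N.
Proof.
move=> MN [/locally_finiteP lf sM]; split.
  apply/locally_finiteP => d p; have h := giso_has_dim MN (lf d p).
  by rewrite (gdimP h).
by apply: laurent_supp_sub sM => d; exact: giso_gsupp (giso_sym MN).
Qed.

Lemma giso_gdim M N d p : giso M N -> locally_finite M -> gdim N d p = gdim M d p.
Proof. by move=> MN /locally_finiteP lf; apply/gdimP/(giso_has_dim MN). Qed.

Lemma giso_projective M N : giso M N -> projective M -> projective N.
Proof.
move=> [f fm [g fK gK]] pM A B q e qm qs em.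
have gm := gmor_inverse fm fK gK.
have efm : is_gmor (fun x => e (f x)).
  split=> [r x y|d p x hx]; last exact/(gmor_hom em)/(gmor_hom fm).
  by case: (fm) => fl _; case: (em) => el _; rewrite fl el.
have [h hm hq] := pM A B q _ qm qs efm.
exists (fun x => h (g x)) => [|x]; last by rewrite hq gK.
split=> [r x y|d p x hx]; last exact/(gmor_hom hm)/(gmor_hom gm).
by case: (gm) => gl _; case: (hm) => hl _; rewrite gl hl.
Qed.

End GradedMorphisms.

(** * Homogeneous bases and projective modules *)

Section Bases.
Variable k : nat.

Let gO : bigrading (@Omega_hom k) := @ext_hom_bigrading _ _ _.

Definition hbasis (J : eqType) (M : gsmod k) (deg : J -> bideg * bool) (g : J -> M) : Prop :=
  gdecomp (@Omega_hom k) (@ghom k M) deg (fun j c => c *: g j).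

Lemma Omega_hom1 : @Omega_hom k 0 false 1.
Proof. exact: ext_hom1. Qed.

Section Fixed.
Variables (J : eqType) (M : gsmod k) (deg : J -> bideg * bool) (g : J -> M).
Hypothesis D : hbasis deg g.

Lemma hbasis_hom j : ghom (deg j).1 (deg j).2 (g j).
Proof.
by have [_ h _ _] := D; have := h j _ _ _ Omega_hom1; rewrite add0r addFb scale1r.
Qed.

Lemma gcoord_linear j r x y : gcoord D j (r *: x + y) = r * gcoord D j x + gcoord D j y.
Proof.
apply: (gcoord_unique D (c := fun j => r * gcoord D j x + gcoord D j y)).
have rB (a b : M) : r *: (a - b) = r *: a - r *: b by exact: scalerBr.
apply: eq_fin_sum (fin_sumD (fin_sum_morph rB (gcoord_sum D x)) (gcoord_sum D y)) => i.
by rewrite scalerDl scalerA.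
Qed.

Lemma hbasis_extend (N : gsmod k) (m : J -> N) :
  (forall j, ghom (deg j).1 (deg j).2 (m j)) ->
  exists h : M -> N, is_gmor h /\ forall x, fin_sum (fun j => gcoord D j x *: m j) (h x).
Proof.
move=> hm.
have ex x : exists y, fin_sum (fun j => gcoord D j x *: m j) y.
  have [s us xs] := gcoord_supp D x; exists (\sum_(j <- s) gcoord D j x *: m j).
  by exists s; split=> // j /xs ->; rewrite scale0r.
have [h hs] := choice ex; exists h; split=> //; split=> [r x y|d p x hx].
  apply: fin_sum_eq (hs _) _.
  have rB (a b : N) : r *: (a - b) = r *: a - r *: b by exact: scalerBr.
  apply: eq_fin_sum (fin_sumD (fin_sum_morph rB (hs x)) (hs y)) => i.
  by rewrite gcoord_linear scalerDl scalerA.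
have [s [_ _ ->]] := hs x; apply: (hom_sum (gbigrading N)) => j _.
have := gaction (gcoord_hom D gO (gbigrading M) j hx) (hm j).
by rewrite subrK addbK.
Qed.

Lemma gcoord_basis i j : gcoord D j (g i) = if j == i then 1 else 0.
Proof. by have := gcoord_iota D i j 1; rewrite scale1r. Qed.

(** Graded lifts of the images of the basis elements exist by taking homogeneous components. *)
Lemma hbasis_projective : projective M.
Proof.
move=> A B q f qm qs fm.
have ex j : exists x, ghom (deg j).1 (deg j).2 x /\ q x = f (g j).
  by have [x] := gmor_lift_hom qm qs (gmor_hom fm (hbasis_hom j)); exists x.
have [m hm] := choice ex.
have [|h [hmor hs]] := @hbasis_extend A m; first by move=> j; have [] := hm j.
exists h => // x; apply: fin_sum_eq (fin_sum_morph (gmorB qm) (hs x)) _.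
apply: eq_fin_sum (fin_sum_morph (gmorB fm) (gcoord_sum D x)) => j.
by rewrite !gmorZ//; have [_ ->] := hm j.
Qed.

End Fixed.

(** ** Free modules *)
Section Free.
Variables (J : eqType) (deg : J -> bideg * bool).

Fact free_scale_supp (r : Omega k) (f : fsfun J (Omega k)) :
  exists s : seq J, forall j, j \notin s -> r * f j = 0.
Proof. by have [s fs] := fs_supp f; exists s => j /fs ->; rewrite mulr0. Qed.

Definition free_scale r f : fsfun J (Omega k) := Fsfun (free_scale_supp r f).

Fact free_scaleA a c f : free_scale a (free_scale c f) = free_scale (a * c) f.
Proof. by apply: fs_eq => j /=; rewrite mulrA. Qed.
Fact free_scale1 : left_id 1 free_scale.
Proof. by move=> f; apply: fs_eq => j /=; rewrite mul1r. Qed.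
Fact free_scaleDr : right_distributive free_scale +%R.
Proof. by move=> a f g; apply: fs_eq => j /=; rewrite mulrDr. Qed.
Fact free_scaleDl f : {morph free_scale^~ f : a c / a + c}.
Proof. by move=> a c; apply: fs_eq => j /=; rewrite mulrDl. Qed.

Definition free_lmod : lmodType (Omega k) :=
  HB.pack (fsfun J (Omega k)) (GRing.Zmodule_isLmodule.Build (Omega k) (fsfun J (Omega k))
    free_scaleA free_scale1 free_scaleDr free_scaleDl).

Definition free_hom : bideg -> bool -> free_lmod -> Prop := fs_hom (@Omega_hom k) deg.

Lemma free_bigrading : bigrading free_hom.
Proof. exact/fs_bigrading/gO. Qed.

Lemma free_action : @graded_action k free_lmod free_hom.
Proof.
move=> d p e o a f ha hf j; have := ext_homM ha (hf j).
by rewrite addrA addbA.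
Qed.

Definition free_gsmod : gsmod k := Gsmod free_bigrading free_action.

Definition free_gen (j : J) : free_gsmod := fs_single j (1 : Omega k).

Lemma free_gen_scale c j : c *: free_gen j = fs_single j c.
Proof. by apply: fs_eq => i /=; case: eqP => _; rewrite ?mulr1 ?mulr0. Qed.

Lemma free_hbasis : hbasis deg free_gen.
Proof.
split=> [j x y|j d p c hc|f|c c0 j].
- exact: scalerBl.
- rewrite free_gen_scale => i /=; case: eqP => [->|_]; last exact: (hom0 gO).
  by rewrite addrK addbK.
- by exists f; apply: eq_fin_sum (fs_expand f) => j; rewrite free_gen_scale.
have ev f g : (f - g : fsfun J (Omega k)) j = f j - g j by [].
have := fin_sum_morph ev c0 => s0.
apply/esym; apply: fin_sum_eq s0 _.
apply: eq_fin_sum (fin_sum1 j (c j)) => i.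
by rewrite free_gen_scale /= eq_sym; case: eqP => [->|].
Qed.

End Free.

End Bases.

(** * Graded Nakayama lemma: bounded projective modules are free *)

Lemma unshift_eq0 (d : bideg) (p : bool) (z : bideg * bool) :
  (d - z.1, p (+) z.2) = (0, false) -> z = (d, p).
Proof.
move=> e; rewrite -[RHS](unshiftK z) /unshift_deg /= e /shift_deg /= add0r.
by rewrite -surjective_pairing.
Qed.

Section Nakayama.
Variables (k : nat) (P : gsmod k).
Hypothesis lf : locally_finite P.
Variable hmin : int.
Hypothesis hminP : forall d, gsupp P d -> hmin <= hgt k d.

Let gO : bigrading (@Omega_hom k) := @ext_hom_bigrading _ _ _.
Let gP := gbigrading P.

(** The part of degree (d, p) of the product of P with the augmentation ideal. *)
Definition aug_part (d : bideg) (p : bool) (x : qmod P) : Prop :=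
  exists2 s : seq (bideg * bool * Omega k * P),
    (forall z, z \in s -> [/\ @Omega_hom k z.1.1.1 z.1.1.2 z.1.2, 0 < hgt k z.1.1.1 &
       ghom (d - z.1.1.1) (p (+) z.1.1.2) z.2]) &
    x = \sum_(z <- s) z.1.2 *: z.2.

Lemma aug_part_subspace d p : subspace (aug_part d p).
Proof.
split=> [|a _ _ [s hs ->] [t ht ->]]; first by exists [::]; rewrite ?big_nil.
exists ([seq (z.1, Oconst k a *: z.2) | z <- s] ++ t).
  move=> z; rewrite mem_cat => /orP[/mapP[w /hs[h1 h2 h3] ->]|/ht//].
  split=> //=; have := gaction (@Oconst_hom k a) h3.
  by rewrite add0r addFb.
rewrite big_cat big_map /=; congr (_ + _).
rewrite [LHS]scaler_sumr; apply: eq_bigr => z _ /=.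
transitivity ((Oconst k a * z.1.2) *: z.2); first exact: (@scalerA (Omega k) P (Oconst k a) z.1.2 z.2).
have -> : Oconst k a * z.1.2 = z.1.2 * Oconst k a by exact: ext_constC.
exact: (esym (@scalerA (Omega k) P z.1.2 (Oconst k a) z.2)).
Qed.

Let ex_basis (z : bideg * bool) :
  exists n (b : 'I_n -> qmod P), basis_mod (qhom P z.1 z.2) (aug_part z.1 z.2) b.
Proof.
have [n [a ha]] := lf z.1 z.2.
apply: (basis_mod_exists (a := a : 'I_n -> qmod P)); first exact: aug_part_subspace.
exact: ha.
Qed.

Definition gen_mult (d : bideg) (p : bool) : nat := projT1 (cid (ex_basis (d, p))).

Definition gen_family (d : bideg) (p : bool) : 'I_(gen_mult d p) -> qmod P :=
  projT1 (cid (projT2 (cid (ex_basis (d, p))))).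

Lemma gen_familyP d p : basis_mod (qhom P d p) (aug_part d p) (gen_family (d := d) (p := p)).
Proof. exact: (projT2 (cid (projT2 (cid (ex_basis (d, p)))))). Qed.

Definition gen_index := {i : bideg * bool * nat | (i.2 < gen_mult i.1.1 i.1.2)%N}.

Definition gen_deg (j : gen_index) : bideg * bool := (val j).1.

Definition gen (j : gen_index) : P :=
  gen_family (d := (gen_deg j).1) (p := (gen_deg j).2) (Ordinal (valP j)).

Lemma gen_hom j : ghom (gen_deg j).1 (gen_deg j).2 (gen j).
Proof. by have [h _ _] := gen_familyP (gen_deg j).1 (gen_deg j).2; exact: h. Qed.

Lemma gen_neq0 j : gen j <> 0.
Proof.
have [_ _ fr] := gen_familyP (gen_deg j).1 (gen_deg j).2 => g0.
have /eqP : (1 : rat) = 0; last by rewrite oner_eq0.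
rewrite -(fr (fun i => (i == Ordinal (valP j))%:R) _ (Ordinal (valP j))) ?eqxx//.
rewrite /lincomb (bigD1 (Ordinal (valP j)))//= [X in _ *: X]g0 scaler0 add0r big1.
  by case: (aug_part_subspace (gen_deg j).1 (gen_deg j).2).
by move=> i /negPf ->; rewrite scale0r.
Qed.

Lemma gen_height j : hmin <= hgt k (gen_deg j).1.
Proof. by apply: hminP; exists (gen_deg j).2, (gen j); split; [exact: gen_hom|exact: gen_neq0]. Qed.

Definition gen_span (x : P) : Prop := exists c, fin_sum (fun j => c j *: gen j) x.

Definition gen_at d p (i : 'I_(gen_mult d p)) : gen_index := exist _ (d, p, val i) (ltn_ord i).

Lemma gen_atE d p (i : 'I_(gen_mult d p)) : gen (gen_at i) = gen_family i.
Proof. by rewrite /gen /=; congr gen_family; exact: val_inj. Qed.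

Lemma gen_at_inj d p : injective (@gen_at d p).
Proof. by move=> i j /(congr1 val)[] /val_inj. Qed.

Lemma gen_at_surj d p j : gen_deg j = (d, p) -> exists i, j = @gen_at d p i.
Proof.
case: j => [[[d' p'] n] nP]; rewrite /gen_deg /= => -[ed ep].
move: nP; rewrite /= ed ep => nP; exists (Ordinal nP); exact: val_inj.
Qed.

Lemma gen_spanD x y : gen_span x -> gen_span y -> gen_span (x + y).
Proof.
move=> [c cx] [e ey]; exists (fun j => c j + e j).
by apply: eq_fin_sum (fin_sumD cx ey) => j; rewrite scalerDl.
Qed.

Lemma gen_span0 : gen_span 0.
Proof.
by exists (fun=> 0); apply: eq_fin_sum (fin_sum0 gen_index P) => j; rewrite scale0r.
Qed.

Lemma gen_spanZ r x : gen_span x -> gen_span (r *: x).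
Proof.
move=> [c cx]; exists (fun j => r * c j).
have rB (a b : P) : r *: (a - b) = r *: a - r *: b by exact: scalerBr.
by apply: eq_fin_sum (fin_sum_morph rB cx) => j; rewrite scalerA.
Qed.

Lemma gen_span_gen j : gen_span (gen j).
Proof.
exists (fun i => if i == j then 1 else 0); apply: eq_fin_sum (fin_sum1 j (gen j)) => i.
by case: eqP => [->|_]; rewrite ?scale1r ?scale0r.
Qed.

Lemma gen_span_sum I (s : seq I) (E : I -> P) :
  (forall i, gen_span (E i)) -> gen_span (\sum_(i <- s) E i).
Proof.
move=> h; elim: s => [|i s IH]; first by rewrite big_nil; exact: gen_span0.
by rewrite big_cons; exact: gen_spanD.
Qed.

(** By induction on the height: modulo the generators of its degree, a vector is a combination
of vectors of smaller height, with coefficients in the augmentation ideal. *)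
Lemma gen_span_hom N d p x : ghom d p x -> hgt k d < hmin + N%:Z -> gen_span x.
Proof.
elim: N d p x => [|N IH] d p x hx hd.
  have [->|/eqP x0] := eqVneq x 0; first exact: gen_span0.
  have : hmin <= hgt k d by apply: hminP; exists p, x.
  by rewrite leNgt; move: hd; rewrite addr0 => ->.
have [_ sp _] := gen_familyP d p; have [c [s hs xs]] := sp x hx.
rewrite -[x](subrK (lincomb (gen_family (d := d) (p := p)) c)); apply: gen_spanD.
  rewrite [X in gen_span X]xs; elim: s hs {xs} => [|z s IHs] hs; first by rewrite big_nil; exact: gen_span0.
  rewrite big_cons; apply: gen_spanD; last by apply: IHs => w ws; apply: hs; rewrite inE ws orbT.
  have [|hr hz hy] := hs z; first by rewrite inE eqxx.
  apply/gen_spanZ/(IH _ _ _ hy); rewrite hgtB; lia.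
apply: gen_span_sum => i; apply: gen_spanZ.
by rewrite -gen_atE; exact: gen_span_gen.
Qed.

Lemma gen_span_all x : gen_span x.
Proof.
have [s hs ->] := hom_span gP x; elim: s hs => [|z s IH] hs.
  by rewrite big_nil; exact: gen_span0.
rewrite big_cons; apply: gen_spanD; last by apply: IH => w ws; apply: hs; rewrite inE ws orbT.
have hz : ghom z.1.1 z.1.2 z.2 by apply: hs; rewrite inE eqxx.
apply: (gen_span_hom (N := `|hgt k z.1.1 - hmin|%N.+1) hz); lia.
Qed.

Hypothesis pP : projective P.

Let Fr := free_gsmod k gen_deg.
Let DF := free_hbasis k gen_deg.

(** A free cover that is an isomorphism modulo the augmentation ideal splits;
its kernel is then a summand lying in the augmentation ideal times itself, and
vanishes for degree reasons. *)
Lemma gen_hbasis : hbasis gen_deg gen.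
Proof.
have [phi [phim phis]] := hbasis_extend DF gen_hom.
have phiB := gmorB phim.
have coordF (f : Fr) j : gcoord DF j f = (f : fsfun _ _) j.
  apply: (gcoord_unique DF (c := fun j => (f : fsfun _ _) j)).
  by apply: eq_fin_sum (fs_expand (f : fsfun _ _)) => i; rewrite free_gen_scale.
have phi_sum (f : Fr) : fin_sum (fun j => (f : fsfun _ _) j *: gen j) (phi f).
  by apply: eq_fin_sum (phis f) => j; rewrite coordF.
have phi_gen j : phi (free_gen k gen_deg j) = gen j.
  apply: fin_sum_eq (phi_sum (free_gen k gen_deg j)) _.
  apply: eq_fin_sum (fin_sum1 j (gen j)) => i /=.
  by case: eqP => [->|_]; rewrite ?scale1r ?scale0r.
have phi_surj y : exists f, phi f = y.
  have [c [s [us cs ->]]] := gen_span_all y.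
  exists (\sum_(j <- s) c j *: free_gen k gen_deg j).
  rewrite (morph_sum phiB); apply: eq_bigr => j _.
  by rewrite gmorZ// phi_gen.
have idm : is_gmor (fun x : P => x) by split.
(* phi is a surjection from a free module; its kernel is the image of the idempotent rho. *)
have [sec secm secK] := pP phim phi_surj idm.
pose rho (f : Fr) : Fr := f - sec (phi f).
have rhoB f g : rho (f - g) = rho f - rho g.
  by rewrite /rho phiB (gmorB secm) !opprD addrACA.
have rhoZ r f : rho (r *: f) = r *: rho f.
  by rewrite /rho gmorZ// gmorZ// scalerBr.
have phi_rho f : phi (rho f) = 0 by rewrite /rho phiB secK subrr.
have rho_hom d p f : ghom d p f -> ghom d p (rho f).
  move=> hf; apply: (homB (gbigrading Fr)) => //.
  exact/(gmor_hom secm)/(gmor_hom phim).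
(* The kernel lies in the augmentation ideal: the constant coefficients of f in degree (d, p)
   give a combination of the generators of that degree that lies in aug_part, hence vanish. *)
have supp d p (f : Fr) : ghom d p f -> phi f = 0 ->
    forall j, (f : fsfun _ _) j = 0 \/ 0 < hgt k (d - (gen_deg j).1).
  move=> hf f0.
  pose c i := aug ((f : fsfun _ _) (@gen_at d p i)).
  have fc i : (f : fsfun _ _) (@gen_at d p i) = Oconst k (c i).
    case/Omega_hom_cases: (hf (gen_at i)) => [|[_ //]|[]].
      by rewrite /c => ->; rewrite aug0 /Oconst mpolyC0; apply/esym; exact: rmorph0.
    by rewrite /= subrr hgt0 ltxx.
  pose A j : P := if gen_deg j == (d, p) then (f : fsfun _ _) j *: gen j else 0.
  have Asum : fin_sum A (lincomb (gen_family (d := d) (p := p)) c).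
    exists [seq gen_at i | i <- index_enum 'I_(gen_mult d p)]; split.
    - by rewrite map_inj_uniq ?index_enum_uniq//; exact: gen_at_inj.
    - move=> j; rewrite /A; case: eqP => // /gen_at_surj[i ->] /mapP[].
      by exists i => //; rewrite mem_index_enum.
    rewrite big_map; apply: eq_bigr => i _.
    by rewrite /A /gen_deg /= eqxx fc gen_atE.
  have Q : aug_part d p (lincomb (gen_family (d := d) (p := p)) c).
    have := fin_sumB (phi_sum f) Asum; rewrite f0 sub0r => /fin_sumN.
    rewrite opprK => -[s [_ _ ->]]; apply: (subspace_sum _ (aug_part_subspace d p)) => j.
    rewrite opprB /A; case: eqP => [_|ne]; first by rewrite subrr; case: (aug_part_subspace d p).
    rewrite sub0r -scaleNr.
    case/Omega_hom_cases: (hf j) => [->|[e _]|[hj _]].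
    - by rewrite oppr0 scale0r; case: (aug_part_subspace d p).
    - by case: ne; exact: unshift_eq0.
    exists [:: (d - (gen_deg j).1, p (+) (gen_deg j).2, - (f : fsfun _ _) j, gen j)].
      move=> z; rewrite inE => /eqP -> /=; split=> //.
        by rewrite -sub0r; apply: (homB gO); [exact: (hom0 gO)|exact: hf].
      by rewrite subKr addKb; exact: gen_hom.
    by rewrite big_seq1.
  have [_ _ fr] := gen_familyP d p; have c0 := fr c Q.
  move=> j; case/Omega_hom_cases: (hf j) => [->|[e _]|[hj _]]; [by left|left|by right].
  have /gen_at_surj[i ->] := unshift_eq0 e.
  by rewrite fc c0 /Oconst mpolyC0; exact: rmorph0.
(* If f is in the kernel then f = rho f is a combination of the rho of the generators, with
   coefficients of positive height; these are elements of the kernel of smaller height. *)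
have ker0 N : forall d p (f : Fr), ghom d p f -> phi f = 0 -> hgt k d < hmin + N%:Z -> f = 0.
  elim: N => [|N IH] d p f hf f0 hd.
    apply: fs_eq => j; have [//|] := supp d p f hf f0 j.
    by have := gen_height j; rewrite hgtB; lia.
  have fE : f = rho f by rewrite /rho f0 (morph0 (gmorB secm)) subr0.
  rewrite fE; apply: fin_sum_eq (fin_sum_morph rhoB (gcoord_sum DF f)) _.
  apply: eq_fin_sum (fin_sum0 _ _) => j; rewrite rhoZ coordF.
  have [->|hj] := supp d p f hf f0 j; first by rewrite scale0r.
  rewrite (IH _ _ (rho (free_gen k gen_deg j)) (rho_hom _ _ _ (hbasis_hom DF j)))//.
    by rewrite scaler0.
  by move: hj; rewrite hgtB; lia.
have inj0 f : phi f = 0 -> f = 0.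
  move=> f0; have := gcomp_sum (gbigrading Fr) f => fs.
  apply: fin_sum_eq fs _; apply: eq_fin_sum (fin_sum0 _ _) => z; apply/esym.
  apply: (ker0 `|hgt k z.1 - hmin|%N.+1 z.1 z.2); [exact: gcomp_hom| |lia].
  by rewrite -gcomp_gmor// f0 (morph0 (gcompB _ _)).
split=> [j x y|j d p c hc|y|c c0 j].
- exact: scalerBl.
- exact: gaction hc (gen_hom j).
- exact: gen_span_all.
have [s [us cs /esym s0]] := c0.
have [js|/cs cj] := boolP (j \in s).
  pose f : Fr := \sum_(i <- s) c i *: free_gen k gen_deg i.
  have f0 : f = 0.
    apply: inj0; rewrite (morph_sum phiB) -[RHS]s0; apply: eq_bigr => i _.
    by rewrite gmorZ// phi_gen.
  have := congr1 (fun f : fsfun gen_index (Omega k) => f j) f0; rewrite fs_sumE.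
  rewrite (bigD1_seq j)//= big1 => [|i ij].
    by rewrite eqxx mulr1 addr0.
  by rewrite eq_sym (negPf ij) mulr0.
have f0 : c j *: free_gen k gen_deg j = 0 by apply: inj0; rewrite gmorZ// phi_gen.
have := congr1 (fun f : fsfun gen_index (Omega k) => f j) f0.
by rewrite /= eqxx mulr1.
Qed.

End Nakayama.

(** * Multiplicities in free modules *)

Section ParityTwist.
Variable k : nat.

Let gO : bigrading (@Omega_hom k) := @ext_hom_bigrading _ _ _.

Definition par_act (p : bool) (c : Omega k) : Omega k := if p then ext_par c else c.

Lemma par_actK p : involutive (par_act p).
Proof. by case: p => c //; exact: ext_parK. Qed.

Lemma par_actB p x y : par_act p (x - y) = par_act p x - par_act p y.
Proof. by case: p => //; exact: rmorphB. Qed.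

(** The case distinction on p is needed for the carrier of [parity_pow] to reduce to Omega_k. *)
Definition parity_val (p : bool) : parity_pow p (gOmega k) -> Omega k :=
  if p is true then fun x => x else fun x => x.
Definition to_parity (p : bool) : Omega k -> parity_pow p (gOmega k) :=
  if p is true then fun x => x else fun x => x.

Lemma parity_valK p : cancel (@parity_val p) (@to_parity p).
Proof. by case: p. Qed.
Lemma to_parityK p : cancel (@to_parity p) (@parity_val p).
Proof. by case: p. Qed.

Lemma parity_val_linear p r x y :
  par_act p (@parity_val p (r *: x + y)) =
  r * par_act p (@parity_val p x) + par_act p (@parity_val p y).
Proof.
case: p x y => //= x y.
have -> : r *: x + y = (ext_par r * x + y : Omega k) by [].
by rewrite [LHS]ext_parD [ext_par (_ * _)]ext_parM ext_parK.
Qed.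

Lemma parity_val_hom p d o x : ghom (g := parity_pow p (gOmega k)) d o x <->
  @Omega_hom k d (o (+) p) (@parity_val p x).
Proof. by case: p x => x; rewrite ?addbT ?addbF. Qed.

Lemma par_act_hom p d o c : @Omega_hom k d o c -> @Omega_hom k d o (par_act p c).
Proof. by case: p => //; exact: Omega_par_hom. Qed.

Section FreeDecomposition.
Variables (P : gsmod k) (m : bideg -> bool -> nat).
Notation J := {i : bideg * bool * nat | (i.2 < m i.1.1 i.1.2)%N}.

(** A basis element of odd degree generates a copy of Pi Omega_k, in which the coefficient has
to be twisted by the parity automorphism. *)
Lemma hbasis_free_decomp (g : J -> P) : hbasis (fun j : J => (val j).1) g -> free_decomp P m.
Proof.
move=> D; have [_ gh _ gi] := D.
exists (fun i x => par_act (val i).1.2 (@parity_val (val i).1.2 x) *: g i).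
split=> [i|x|s c us c0 i is_].
- split=> [r x y|d p x].
    by rewrite /= parity_val_linear scalerDl scalerA.
  move=> /parity_val_hom hx; have := gh i _ _ _ (par_act_hom (p := (val i).1.2) hx).
  by rewrite subrK addbK.
- have [s [us cs e]] := gcoord_sum D x.
  exists s, (fun i => @to_parity (val i).1.2 (par_act (val i).1.2 (gcoord D i x))).
  by rewrite {1}e; apply: eq_bigr => i _; rewrite to_parityK par_actK.
have := gi (fun i => if i \in s then par_act (val i).1.2 (@parity_val (val i).1.2 (c i)) else 0).
move=> /(_ _ i); rewrite is_ => h.
have {}h : par_act (val i).1.2 (@parity_val (val i).1.2 (c i)) = 0.
  apply: h; rewrite -c0; apply: eq_fin_sum (fin_sum_of_seq _ us) => j.
  by case: ifP => // _; rewrite scale0r.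
rewrite -[c i]parity_valK -[parity_val _](par_actK (val i).1.2) h.
rewrite (morph0 (par_actB _)); by case: ((val i).1.2).
Qed.

Lemma free_decomp_hbasis : free_decomp P m ->
  exists g : J -> P, hbasis (fun j : J => (val j).1) g.
Proof.
move=> [iota [im isp ii]].
pose e (i : J) (c : Omega k) : gshift (val i).1.1 (parity_pow (val i).1.2 (gOmega k)) :=
  @to_parity (val i).1.2 (par_act (val i).1.2 c).
have eZ i c : iota i (e i c) = c *: iota i (e i 1).
  have [il _] := im i; rewrite -[RHS](gmorZ (im i)); congr iota.
  rewrite /e; case: ((val i).1.2) => //=.
    by rewrite rmorph1; have -> : c *: (1 : pi_car (gOmega k)) = ext_par c * 1 by []; rewrite mulr1.
  by have -> : c *: (1 : gOmega k) = c * 1 by []; rewrite mulr1.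
have eB i x y : iota i (e i (x - y)) = iota i (e i x) - iota i (e i y).
  by rewrite eZ scalerBl -!eZ.
exists (fun i => iota i (e i 1)); split=> [i x y|i d p c hc|x|c [s [us cs /esym s0]] i].
- exact: scalerBl.
- rewrite -eZ; apply: (gmor_hom (im i)); rewrite /= addrK.
  apply/parity_val_hom; rewrite /e to_parityK addbK; exact: par_act_hom.
- have [s [c ->]] := isp x.
  elim: s => [|i s [b hb]].
    by exists (fun=> 0); rewrite big_nil; apply: eq_fin_sum (fin_sum0 _ _) => j; rewrite scale0r.
  exists (fun j => (if j == i then par_act (val i).1.2 (@parity_val (val i).1.2 (c i)) else 0) + b j).
  rewrite big_cons; apply: eq_fin_sum (fin_sumD (fin_sum1 i (iota i (c i))) hb) => j.
  rewrite scalerDl; congr (_ + _); case: eqP => [->|_]; last by rewrite scale0r.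
  by rewrite -eZ /e par_actK parity_valK.
have key (t : seq J) : uniq t -> \sum_(j <- t) c j *: iota j (e j 1) = 0 ->
    forall j, j \in t -> c j = 0.
  move=> ut t0 j jt; have := ii t (fun j => e j (c j)) ut.
  have -> : \sum_(j <- t) iota j (e j (c j)) = 0.
    by rewrite -[RHS]t0; apply: eq_bigr => l _; rewrite eZ.
  move=> /(_ erefl j jt) ej; rewrite -[c j](par_actK (val j).1.2).
  by rewrite -(to_parityK (val j).1.2 (par_act _ (c j))) -/(e j (c j)) ej; case: ((val j).1.2) => //; exact: rmorph0.
have [is_|/cs ci] := boolP (i \in s); first exact: key us s0 i is_.
by apply: (key [:: i]) => //; rewrite ?big_seq1// inE.
Qed.

End FreeDecomposition.

End ParityTwist.

(** A bound on the lambda-degrees turns the cone condition into a lower bound for heights,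
which is what the Nakayama argument needs. *)
Lemma psmod_free_decomp k (P : gsmod k) : admissible true P -> projective P ->
  exists m, free_decomp P m.
Proof.
move=> [lf /laurent_suppP[N [N0 hN]]] pP.
have hm d : gsupp P d -> - N - 2 * N * N - (2 * k%:Z + 1) * N <= hgt k d.
  move=> /hN /andP[/andP[h1 h2] /= h3]; rewrite /hgt.
  have : N * (d.2 + N) <= N * (2 * N) by apply: ler_wpM2l => //; lia.
  have : (2 * k%:Z + 1) * - N <= (2 * k%:Z + 1) * d.2 by apply: ler_wpM2l; lia.
  by move: h2; lia.
by exists (gen_mult lf); apply: hbasis_free_decomp (gen_hbasis lf hm pP).
Qed.

(** * The modules Omega_k and S_k *)

Section RegularModule.
Variable k : nat.

Let gO : bigrading (@Omega_hom k) := @ext_hom_bigrading _ _ _.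
Notation mdeg2 := (mon_deg (fun i : 'I_k => (2 * i.+1)%:Z)).

(** Every x_i has height at least 1, so only finitely many monomials occur in a given degree. *)
Lemma mdeg_le_height (a : 'X_{1..k}) (U : {set 'I_k}) : (mdeg a)%:Z <= hgt k (mdeg2 a U).
Proof.
rewrite mon_height mdegE (big_morph Posz PoszD (erefl 0%:Z)) -[leLHS]addr0.
apply: lerD; last by apply: sumr_ge0 => j _; have := ltn_ord j; lia.
apply: ler_sum => i _; rewrite -mulr_natr natz.
by rewrite -[leLHS]mul1r ler_wpM2r.
Qed.

Lemma Omega_locally_finite : locally_finite (gOmega k).
Proof.
move=> d p; pose N := `|hgt k d|%N.+1.
pose T : finType := ({set 'I_k} * 'X_{1..k < N})%type.
pose b (z : T) : Omega k := ext_const k 'X_[z.2] * ext_mono {mpoly rat[k]} z.1.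
exists #|T|, (fun i => b (enum_val i)) => x hx.
pose c (z : T) : rat := (x z.1)@_(z.2).
exists (fun i => c (enum_val i)).
have bE (z : T) : Oconst k (c z) * b z =
    ext_const k ((x z.1)@_(z.2) *: 'X_[z.2]) * ext_mono {mpoly rat[k]} z.1.
  by rewrite /b /Oconst mulrA -ext_constM mul_mpolyC.
transitivity (\sum_(z : T) Oconst k (c z) * b z); last first.
  by rewrite (reindex (@enum_val T T : 'I_#|T| -> T)); last exact/onW_bij/enum_val_bij.
under eq_bigr => z _ do rewrite bE.
rewrite -(pair_bigA _ (fun U (a : 'X_{1..k < N}) =>
  ext_const k ((x U)@_a *: 'X_[a]) * ext_mono {mpoly rat[k]} U)) /=.
rewrite [LHS]ext_expand; apply: eq_bigr => U _.
rewrite -mulr_suml -rmorph_sum; congr (ext_const _ _ * _).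
apply: mpolywE; rewrite msizeE; apply/bigmax_leqP_seq => a aU _.
have [e _] := hx U a aU; have := mdeg_le_height a U; rewrite e /N; lia.
Qed.

Lemma Omega_supp b : laurent_supp b (gsupp (gOmega k)).
Proof.
have [K [K0 KE]] : exists K : int, 0 <= K /\ K = k%:Z * k%:Z.
  by exists (k%:Z * k%:Z); split=> //; exact: mulr_ge0.
apply/laurent_suppP; exists (2 * K + 2 * k%:Z); split; first lia.
move=> d [p [x [hx x0]]].
have [U [a aU]] : exists U a, a \in msupp (x U).
  apply: contrapT => nU; apply: x0; apply/ffunP => U; apply/mpolyP => a.
  rewrite ffunE mcoeff0; apply: memN_msupp_eq0; apply/negP => aU.
  by apply: nU; exists U, a.
have [<- _] := hx U a aU; rewrite /bnd /mon_deg /=.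
have cU : (#|U| <= k)%N by rewrite -[X in (_ <= X)%N]card_ord max_card.
have s1 : 0 <= \sum_(i < k) (2 * i.+1)%:Z *+ a i.
  by apply: sumr_ge0 => i _; exact: mulrn_wge0.
have s2 : \sum_(j in U) (2 * j.+1)%:Z <= 2 * K.
  apply: le_trans (_ : \sum_(j in U) 2 * k%:Z <= _).
    by apply: ler_sum => j _; have := ltn_ord j; lia.
  rewrite sumr_const -mulr_natr natz KE; move: cU; move: #|U| => u cU; nia.
have s3 : 0 <= (2 * K + 2 * k%:Z) * ((2 * #|U|)%:Z + (2 * K + 2 * k%:Z)).
  by apply: mulr_ge0; lia.
move: s1 s2 s3; set A := \sum_(i < k) _; set B := \sum_(j in U) _; set Q := _ * _.
move=> s1 s2 s3; rewrite -andbA; apply/and3P; split; [lia|lia|].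
by apply/implyP => _; move: cU; move: #|U| => u cU; lia.
Qed.

Lemma Omega_admissible b : admissible b (gOmega k).
Proof. by split; [exact: Omega_locally_finite|exact: Omega_supp]. Qed.

Lemma Omega_hbasis : hbasis (fun _ : unit => ((0, false) : bideg * bool)) (fun=> 1 : gOmega k).
Proof.
have scE (c : Omega k) : c *: (1 : gOmega k) = c.
  by have -> : c *: (1 : gOmega k) = c * 1 by []; rewrite mulr1.
split=> [i x y|i d p c hc|x|c c0 []].
- exact: scalerBl.
- by rewrite scE addr0 addbF.
- exists (fun=> x); apply: eq_fin_sum (fin_sum1 tt x) => -[]; by rewrite scE.
have := fin_sum_seq c0 (s := [:: tt]) isT => h.
by rewrite big_seq1 scE in h; rewrite -h// => -[].
Qed.

Lemma Omega_projective : projective (gOmega k).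
Proof. exact: hbasis_projective Omega_hbasis. Qed.

(** A free generator of Omega_k with nonzero augmentation has degree 0, hence is
invertible, and is then the only one. *)
Lemma free_decomp_Omega m : free_decomp (gOmega k) m ->
  forall d p, m d p = (d == 0) && ~~ p :> nat.
Proof.
move=> /free_decomp_hbasis[g D].
have [s [us gs e1]] := gcoord_sum D (1 : gOmega k).
have gh i : @Omega_hom k (val i).1.1 (val i).1.2 (g i) := hbasis_hom D i.
have [i0 ai0] : exists i, aug (g i : Omega k) <> 0.
  apply: contrapT => ne; have /eqP : (1 : rat) = 0; last by rewrite oner_eq0.
  rewrite -{1}(aug_const k 1) /Oconst mpolyC1 [ext_const k 1]e1.
  rewrite (morph_sum (@augB k)) big1// => i _; rewrite [aug _]augM.
  have [->|gi] := pselect (aug (g i : Omega k) = 0); first by rewrite mulr0.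
  by case: ne; exists i.
have [d0 gc] : (val i0).1 = (0, false) /\ (g i0 : Omega k) = Oconst k (aug (g i0)).
  case/Omega_hom_cases: (gh i0) => [g0|[e gc]|[_ //]]; first by case: ai0; rewrite g0 aug0.
  by split=> //; rewrite [LHS]surjective_pairing.
(* A second basis element would be a multiple of the invertible one. *)
have one j : j = i0.
  apply: contrapT => /eqP ji.
  have e2 : (g j : Omega k) * Oconst k (aug (g i0))^-1 * (g i0 : Omega k) = g j.
    rewrite gc -mulrA -[Oconst _ _ * Oconst _ _]ext_constM -mpolyCM.
    by rewrite aug_const mulVf ?mpolyC1; [exact: mulr1|exact/eqP].
  have := gcoord_iota D i0 j (g j * Oconst k (aug (g i0))^-1).
  rewrite [X in gcoord _ _ X]e2 (negPf ji) => h.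
  have := gcoord_basis D j j; rewrite eqxx [gcoord _ _ _]h => /esym/eqP.
  by rewrite oner_eq0.
move=> d p; case: (posnP (m d p)) => [m0|mdp].
  rewrite m0; case: (eqVneq d 0) => //= ed; case: p m0 => //=; rewrite ed => m0.
  by have := valP i0; rewrite /= d0 m0.
have j0 := one (exist _ (d, p, 0%N) mdp).
have m1 : (m d p <= 1)%N.
  rewrite leqNgt; apply/negP => m1; have := one (exist _ (d, p, 1%N) m1).
  by rewrite -j0 => /(congr1 val)/(congr1 snd).
have dp0 : (d, p) = (0, false) by rewrite -d0 -j0.
have -> : (d == 0) && ~~ p by case: dp0 => -> ->.
by apply/eqP; rewrite eqn_leq m1 mdp.
Qed.

End RegularModule.

Section SimpleModule.
Variable k : nat.

Lemma simple_has_dim d p : has_dim (qhom (gsimple k) d p) ((d == 0)%R && ~~ p).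
Proof.
have sE (c : rat) (x : qmod (gsimple k)) : c *: x = c * (x : rat) :> rat.
  by rewrite qscaleE -[LHS]/(aug (Oconst k c) * (x : rat)) aug_const.
case: (boolP ((d == 0) && ~~ p)) => [/andP[/eqP -> /negPf ->]|dp].
  exists (fun=> (1 : rat) : qmod (gsimple k)); split=> [i|x _|c c0 i].
  - by right.
  - exists (fun=> (x : rat)); rewrite /lincomb big_ord1 [X in x - X]sE mulr1.
    exact: subrr.
  - by move: c0; rewrite /lincomb big_ord1 [LHS]sE mulr1 [i]ord1.
exists (fun=> 0); split=> [[]//|x|c _ []//].
case=> [->|[d0 p0]]; last by rewrite d0 p0 eqxx in dp.
by exists (fun=> 0); rewrite /lincomb big_ord0 subr0.
Qed.

Lemma simple_admissible b : admissible b (gsimple k).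
Proof.
split.
  by apply/locally_finiteP => d p; have h := simple_has_dim d p; rewrite (gdimP h).
by apply: laurent_supp_sub (laurent_supp1 b 0) => d [p [x [[->|[-> _]]//]]].
Qed.

End SimpleModule.

(** * Characters of free modules *)

Section FreeCharacter.
Variables (b : bool) (k : nat) (P : gsmod k) (m : bideg -> bool -> nat).
Hypotheses (aP : admissible b P) (dP : free_decomp P m).

Lemma free_decomp_supp : laurent_supp b (fun d => exists p, m d p <> 0%N).
Proof.
have [g D] := free_decomp_hbasis dP; have [_ sP] := aP.
apply: laurent_supp_sub sP => d [p]; case: (posnP (m d p)) => // mdp _.
pose j : {i : bideg * bool * nat | (i.2 < m i.1.1 i.1.2)%N} := exist _ (d, p, 0%N) mdp.
exists p, (g j); split; first exact: (hbasis_hom D j).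
move=> g0; have := gcoord_basis D j j; rewrite eqxx g0 (morph0 (gcoordB D j)).
by move=> /esym/eqP; rewrite oner_eq0.
Qed.

(** For the decomposition along a homogeneous basis, the fibres have the sizes prescribed by m. *)
Lemma ch_free : ch b P = index_series b m * ch b (gOmega k).
Proof.
have [g D] := free_decomp_hbasis dP.
pose J := {i : bideg * bool * nat | (i.2 < m i.1.1 i.1.2)%N}.
pose fibre e o : seq J := pmap insub [seq (e, o, i) | i <- iota 0 (m e o)].
have fP e o (j : J) : (j \in fibre e o) = ((val j).1 == (e, o)).
  rewrite mem_pmap_sub; apply/mapP/eqP => [[i _ ->]//|].
  by case: j => [[[d p] i] /= mi] [<- <-]; exists i; rewrite ?mem_iota.
have fU e o : uniq (fibre e o).
  by apply: pmap_sub_uniq; rewrite map_inj_uniq ?iota_uniq// => i j [].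
have fS e o : size (fibre e o) = m e o.
  rewrite size_pmap_sub count_map -[RHS](size_iota 0) -[RHS]count_predT.
  by apply: eq_in_count => i; rewrite mem_iota /= => ->.
have -> : index_series b m = index_series b (fun e o => size (fibre e o)).
  by congr index_series; apply/funext => e; apply/funext => o; rewrite fS.
apply: (@ch_gdecomp b k k J (gOmega k) P (fun j => (val j).1)
  (fun j (c : gOmega k) => (c : Omega k) *: g j) D _ (Omega_admissible k b) _ fibre fU fP).
  by move=> i a x; rewrite scalerA.
apply: laurent_supp_sub free_decomp_supp => _ [[[[d p] i] /= mi] <-].
by exists p; case: (m d p) mi.
Qed.

End FreeCharacter.

(** * Small models of locally finite modules *)

Lemma bigrading_transport (V W : zmodType) (hom : bideg -> bool -> W -> Prop)
    (e : V -> W) (e' : W -> V) : (forall x y, e (x - y) = e x - e y) ->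
  cancel e e' -> cancel e' e -> bigrading hom -> bigrading (fun d p x => hom d p (e x)).
Proof.
move=> eB eK e'K gW; split=> [d p|d p x y hx hy|x|s c us hc c0 z zs].
- by rewrite (morph0 eB); exact: (hom0 gW).
- by rewrite eB; exact: (homB gW).
- have [s hs es] := hom_span gW (e x); exists [seq (z.1, e' z.2) | z <- s].
    by move=> _ /mapP[z /hs hz ->] /=; rewrite e'K.
  apply: (can_inj eK); rewrite es (morph_sum eB) big_map.
  by apply: eq_bigr => z _ /=; rewrite e'K.
apply: (can_inj eK); rewrite (morph0 eB).
apply: (hom_indep gW (c := fun z => e (c z)) us) => //.
by rewrite -(morph_sum eB) c0 (morph0 eB).
Qed.

Section SmallModel.
Variables (k : nat) (M : gsmod k) (X : Set) (e : X -> M) (e' : M -> X).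
Hypotheses (eK : cancel e e') (e'K : cancel e' e).

Definition small_lmod_of : small_lmod k.
Proof.
apply: (@SmallLmod k X (e' 0) (fun x => e' (- e x)) (fun x y => e' (e x + e y))
  (fun r x => e' (r *: e x))).
- by move=> x y z; rewrite !e'K addrA.
- by move=> x y; rewrite addrC.
- by move=> x; rewrite e'K add0r eK.
- by move=> x; rewrite e'K addNr.
- by move=> a c x; rewrite e'K scalerA.
- by move=> x; rewrite scale1r eK.
- by move=> a x y; rewrite !e'K scalerDr.
- by move=> x a c; rewrite !e'K scalerDl.
Defined.

Lemma small_valB (x y : scar small_lmod_of) : e (x - y) = e x - e y.
Proof. by rewrite -[x - y]/(e' (e x + e (e' (- e y)))) !e'K. Qed.

Definition small_of : smallmod k.
Proof.
apply: (@Smallmod k small_lmod_of (fun d p x => ghom d p (e x))).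
  exact: bigrading_transport small_valB eK e'K (gbigrading M).
move=> d p o q r x hr hx.
by rewrite -[r *: x]/(e' (r *: e x)) e'K; exact: gaction hr hx.
Defined.

Lemma small_of_giso : giso small_of M.
Proof.
exists e; last by exists e'.
split=> // r x y; rewrite -[r *: x + y]/(e' (e (e' (r *: e x)) + e y)) !e'K.
by [].
Qed.

End SmallModel.

(** The carrier is the set of the least indices of the values of an enumeration. *)
Lemma countable_small_model k (M : gsmod k) (f : nat -> M) :
  (forall x, exists n, f n = x) -> exists X : smallmod k, giso X M.
Proof.
move=> fs; pose good n := `[< forall m, (m < n)%N -> f m <> f n >].
pose X : Set := {n : nat | good n}.
pose e (x : X) : M := f (sval x).
have ex (y : M) : exists x, e x = y.
  have [n0 fn0] := fs y; pose Q n := `[< f n = y >].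
  have exQ : exists n, Q n by exists n0; apply/asboolP.
  case: (ex_minnP exQ) => n /asboolP fn nmin.
  have gn : good n.
    apply/asboolP => m mn fm; have Qm : Q m by apply/asboolP; rewrite fm.
    by have := nmin m Qm; rewrite leqNgt mn.
  by exists (exist _ n gn).
have [e' e'K] := choice ex.
have ei : injective e.
  move=> [n /= gn] [m /= gm]; rewrite /e /= => fnm; apply: val_inj => /=.
  case: (ltngtP n m) => // [nm|mn].
    by move/asboolP: gm => /(_ n nm) /(_ fnm).
  by move/asboolP: gn => /(_ m mn) /(_ (esym fnm)).
have eK : cancel e e' by move=> x; apply: ei; rewrite e'K.
by exists (small_of eK e'K); exact: small_of_giso.
Qed.

(** A locally finite module is spanned over the rationals by countably many
elements, hence countable. *)
Lemma locally_finite_small_model k (M : gsmod k) : locally_finite M ->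
  exists X : smallmod k, giso X M.
Proof.
move=> lf.
have ex (z : bideg * bool) : exists s : seq M, forall x, ghom z.1 z.2 x ->
    exists c : seq rat, x = \sum_(i < size s) Oconst k c`_i *: s`_i.
  have [n [b hb]] := lf z.1 z.2.
  exists (mkseq (fun i => if insub i is Some j then b j else 0) n) => x /hb[c ->].
  exists (mkseq (fun i => if insub i is Some j then c j else 0) n); rewrite size_mkseq.
  by apply: eq_bigr => i _; rewrite !nth_mkseq// valK.
have [b hb] := choice ex.
pose v (l : seq (bideg * bool * seq rat)) : M :=
  \sum_(w <- l) \sum_(i < size (b w.1)) Oconst k w.2`_i *: (b w.1)`_i.
apply: (@countable_small_model k M (fun n => if unpickle n is Some l then v l else 0)) => x.
suff [l <-] : exists l, v l = x by exists (pickle l); rewrite pickleK.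
have [s hs ->] := hom_span (gbigrading M) x; elim: s hs => [|z s IH] hs.
  by exists [::]; rewrite /v !big_nil.
have [|l lE] := IH; first by move=> w ws; apply: hs; rewrite inE ws orbT.
have [|c zc] := hb z.1 z.2; first by apply: hs; rewrite inE eqxx.
by exists ((z.1, c) :: l); rewrite /v !big_cons -/(v l) lE zc.
Qed.

(** * Shifts *)

Section Shifts.
Variables (k : nat) (c : bideg) (M : gsmod k).

Lemma gdim_shift d p : gdim (gshift c M) d p = gdim M (d - c) p.
Proof. by []. Qed.

Lemma shift_admissible b : admissible b M -> admissible b (gshift c M).
Proof.
move=> [lf sM]; split; first by move=> d p; exact: lf.
apply: laurent_supp_sub (laurent_supp_add (laurent_supp1 b c) sM) => d sd.
by exists c.
Qed.

Lemma shift_projective : projective M -> projective (gshift c M).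
Proof.
have unshift (A : gsmod k) d p x : ghom (g := gshift (- c) A) (d - c) p x <-> ghom (g := A) d p x.
  by rewrite /= opprK subrK.
have shift (A : gsmod k) d p x : ghom (g := gshift (- c) A) d p x <-> ghom (g := A) (d + c) p x.
  by rewrite /= opprK.
move=> pM A B q f [ql qh] qs [fl fh].
have [|//||h [hl hh] hq] := pM (gshift (- c) A) (gshift (- c) B) q f.
- by split=> // d p x /shift hx; apply/shift; exact: qh.
- by split=> // d p x hx; apply/shift; apply: fh; rewrite /= addrK.
by exists h => //; split=> // d p x /hh/unshift.
Qed.

End Shifts.

(** * Laurent series *)

Section LaurentSeries.
Variable b : bool.
Notation L := (laurent b rat).

Lemma lcoefD (f g : L) d : (f + g) d = f d + g d. Proof. by []. Qed.
Lemma lcoefB (f g : L) d : (f - g) d = f d - g d. Proof. by []. Qed.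

Lemma lmon_mulE c (f : L) d : (lmon b rat c * f) d = f (d - c).
Proof.
rewrite [LHS](lconvE (s := [:: c]))// => [|e /=]; last by case: eqP => // ->; rewrite inE.
by rewrite big_seq1 /= eqxx mul1r.
Qed.

Lemma lmonM c e : lmon b rat c * lmon b rat e = lmon b rat (c + e).
Proof. by apply: laurent_eq => d; rewrite lmon_mulE /= subr_eq [(e + c)%R]addrC. Qed.

Lemma qlM a c a' c' : ql b a c * ql b a' c' = ql b (a + a') (c + c').
Proof. exact: lmonM. Qed.

Lemma ql00 : ql b 0 0 = 1. Proof. by []. Qed.

Lemma ql_inv a c : ql b a c * ql b (- a) (- c) = 1.
Proof. by rewrite qlM !subrr. Qed.

Lemma ql_unit a c : ql b a c \is a GRing.unit.
Proof. by apply/unitrPr; exists (ql b (- a) (- c)); exact: ql_inv. Qed.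

Lemma ql_invE a c : (ql b a c)^-1 = ql b (- a) (- c).
Proof. by rewrite -[LHS]mulr1 -(ql_inv a c) mulKr// ql_unit. Qed.

Definition geo_coef (c : bideg) (d : bideg) : rat := (`[< exists n : nat, d = c *+ n >])%:R.

Lemma geo_supp c : succ0 c -> (b -> c.2 = 0) -> laurent_supp b (fun d => geo_coef c d <> 0).
Proof.
move=> c0 c2; apply: (laurent_supp_sub (Q := fun d => exists n : nat, d = c *+ n)).
  by move=> d; rewrite /geo_coef; case: asboolP.
split.
  exists c, c, 0; split=> // _ [n ->]; exists n%:R, 0; split=> //.
    by rewrite mul0r addr0 subr0 pair_mulrn /= rmorphMn mulr_natl.
  by rewrite mul0r addr0 subr0 pair_mulrn /= rmorphMn mulr_natl.
by move=> /c2 c2'; exists 0 => _ [n ->]; rewrite pair_mulrn /= c2' mul0rn normr0.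
Qed.

Definition geo c : L := mk_laurent b (geo_coef c).

Lemma geoE c : succ0 c -> (b -> c.2 = 0) -> (1 - lmon b rat c) * geo c = 1.
Proof.
move=> c0 c2; have gE d : geo c d = geo_coef c d by apply: mk_laurentE; exact: geo_supp.
apply: laurent_eq => d; rewrite mulrBl mul1r lcoefB lmon_mulE !gE /geo_coef.
rewrite -[(1 : L) d]/((d == 0)%:R : rat).
have cn0 n : c *+ n.+1 <> 0.
  rewrite pair_mulrn => -[/eqP + /eqP]; rewrite !mulrn_eq0 /= => /eqP e1 /eqP e2.
  by move: c0; rewrite /succ0 e1 e2 ltxx.
have [->|d0] := eqVneq d 0.
  rewrite sub0r; have -> : `[< exists n : nat, (0 : bideg) = c *+ n >] by apply/asboolP; exists 0%N.
  case: asboolP => [[n e]|_]; last by rewrite subr0.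
  by case: (cn0 n); rewrite mulrS -e subrr.
have -> : `[< exists n : nat, d - c = c *+ n >] = `[< exists n : nat, d = c *+ n >].
  apply/asboolP/asboolP => -[n e].
    by exists n.+1; rewrite mulrS -e addrC subrK.
  case: n e d0 => [->|n ->]; first by rewrite mulr0n eqxx.
  by move=> _; exists n; rewrite mulrS addrAC subrr add0r.
by rewrite subrr.
Qed.

Lemma geo_unit c : succ0 c -> (b -> c.2 = 0) -> 1 - lmon b rat c \is a GRing.unit.
Proof. by move=> c0 c2; apply/unitrPr; exists (geo c); exact: geoE. Qed.

Lemma geo_invE c : succ0 c -> (b -> c.2 = 0) -> (1 - lmon b rat c)^-1 = geo c.
Proof.
by move=> c0 c2; apply: (mulrI (geo_unit c0 c2)); rewrite mulrV ?geo_unit// geoE.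
Qed.

Definition qdiff : L := ql b 1 0 - ql b (-1) 0.
Definition qint (a : int) : L := (ql b a 0 - ql b (- a) 0) / qdiff.

Lemma qdiffE : qdiff = - ql b (-1) 0 * (1 - ql b 2 0).
Proof. by rewrite /qdiff mulrBr mulr1 mulNr qlM opprK addrC. Qed.

Lemma one_sub_q_unit (n : nat) : 1 - ql b n.+1%:Z 0 \is a GRing.unit.
Proof. by apply: geo_unit => //; rewrite /succ0 /= ltxx eqxx. Qed.

Lemma qdiff_unit : qdiff \is a GRing.unit.
Proof. by rewrite qdiffE unitrM unitrN ql_unit (one_sub_q_unit 1). Qed.

(** The left-hand side is the graded rank of the bimodule over its upper ring. *)
Lemma sum_ql k : \sum_(i < k.+1) ql b (2 * i%:Z) 0 = ql b k%:Z 0 * qint k.+1%:Z.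
Proof.
have key : (\sum_(i < k.+1) ql b (2 * i%:Z) 0) * qdiff = ql b (2 * k%:Z + 1) 0 - ql b (-1) 0.
  elim: k => [|k IH]; first by rewrite big_ord1 mulr0 ql00 mul1r.
  rewrite big_ord_recr /= mulrDl IH /qdiff mulrBr !qlM !addr0.
  have -> : 2 * k.+1%:Z - 1 = 2 * k%:Z + 1 by lia.
  by ring.
apply: (mulIr qdiff_unit); rewrite key /qint mulrA mulrVK ?qdiff_unit// mulrBr !qlM !addr0.
by congr (ql b _ _ - ql b _ _); lia.
Qed.

(** The shift of F_k times the graded rank of the bimodule over its lower ring. *)
Definition coefF (k : nat) : L :=
  ql b (- k%:Z) 0 * ((1 - ql b (- (2 * k%:Z + 2)) 2) / (1 - ql b 2 0)).
(** The shift of E_k times the graded rank of the bimodule over its upper ring. *)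
Definition coefE (k : nat) : L := ql b (2 * k%:Z + 2) (-1) * qint k.+1%:Z.
(** The coefficient of E m_{k+1} on m_k in the Verma module of highest weight lambda q^{-1}. *)
Definition vermaE (k : nat) : L :=
  (ql b (- 1 - k%:Z) 1 - ql b (k%:Z + 1) (-1)) / qdiff.

Lemma coefF_vermaE k : ql b (2 * k%:Z + 2) (-1) * coefF k = vermaE k.
Proof.
apply: (mulIr qdiff_unit); rewrite /vermaE mulrVK ?qdiff_unit//.
have u2 := one_sub_q_unit 1; rewrite qdiffE /coefF.
set u := (1 - ql b 2 0)^-1; have uE : u * (1 - ql b 2 0) = 1 by rewrite mulVr.
transitivity (ql b (2 * k%:Z + 2) (-1) * ql b (- k%:Z) 0 * - ql b (-1) 0 *
    (1 - ql b (- (2 * k%:Z + 2)) 2) * (u * (1 - ql b 2 0))); first by ring.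
rewrite uE mulr1 mulrN mulNr !qlM mulrBr mulr1 qlM opprB.
by congr (ql b _ _ - ql b _ _); lia.
Qed.

(** The commutator of E and F on the k-th weight vector. *)
Lemma qint_vermaE k :
  qint k.+1%:Z * vermaE k - (if k is j.+1 then qint k%:Z * vermaE j else 0) =
  (ql b (- 1 - 2 * k%:Z) 1 - ql b (1 + 2 * k%:Z) (-1)) / qdiff.
Proof.
have -> : (if k is j.+1 then qint k%:Z * vermaE j else 0) =
    qint k%:Z * ((ql b (- k%:Z) 1 - ql b k%:Z (-1)) / qdiff).
  case: k => [|j]; first by rewrite /qint subrr !mul0r.
  by rewrite /vermaE; congr (_ * ((ql b _ _ - ql b _ _) / _)); lia.
apply: (mulIr qdiff_unit); rewrite /vermaE mulrVK ?qdiff_unit//.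
apply: (mulIr qdiff_unit); rewrite /qint.
set u := qdiff^-1; have uE : u * qdiff = 1 by rewrite mulVr// qdiff_unit.
transitivity (((ql b k.+1%:Z 0 - ql b (- k.+1%:Z) 0) * (ql b (-1 - k%:Z) 1 - ql b (k%:Z + 1) (-1))
  - (ql b k%:Z 0 - ql b (- k%:Z) 0) * (ql b (- k%:Z) 1 - ql b k%:Z (-1))) *
   (u * qdiff) * (u * qdiff)); first by ring.
rewrite uE !mulr1 /qdiff !(mulrBl, mulrBr) !qlM !add0r !addr0.
have -> : k.+1%:Z + (-1 - k%:Z) = 0 by lia.
have -> : k%:Z - k%:Z = 0 by lia.
have -> : - k.+1%:Z + (k%:Z + 1) = 0 by lia.
have -> : - k%:Z + k%:Z = 0 by lia.
have -> : - k.+1%:Z + (-1 - k%:Z) = -1 - 2 * k%:Z - 1 by lia.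
have -> : - k%:Z - k%:Z = -1 - 2 * k%:Z + 1 by lia.
have -> : k.+1%:Z + (k%:Z + 1) = 1 + 2 * k%:Z + 1 by lia.
have -> : k%:Z + k%:Z = 1 + 2 * k%:Z - 1 by lia.
by ring.
Qed.

End LaurentSeries.

Arguments qint b a : clear implicits.
Arguments coefF b k : clear implicits.
Arguments coefE b k : clear implicits.
Arguments vermaE b k : clear implicits.

(** ** Change of coefficients *)
Section Inclusion.
Variable b : bool.

Fact inclb_supp (f : laurent b rat) : laurent_supp false (fun d => f d <> 0).
Proof. by have [cf _] := lcoefP f; split. Qed.

(** The inclusion into Q((q,lambda)), which is the identity for b = false; this treats both
kinds of series at once. *)
Definition inclb (f : laurent b rat) : QL := Laurent (inclb_supp f).

Fact inclb_is_zmod_morphism : zmod_morphism inclb.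
Proof. by move=> f g; apply: laurent_eq. Qed.

Fact inclb_is_monoid_morphism : monoid_morphism inclb.
Proof.
split=> [|f g]; apply: laurent_eq => d //=.
have [s us fs] := laurent_conv_fin d (lcoefP f) (lcoefP g).
by rewrite (lconvE us fs) [RHS](lconvE (f := inclb f) (g := inclb g) us fs).
Qed.

HB.instance Definition _ := GRing.isZmodMorphism.Build (laurent b rat) QL
  inclb inclb_is_zmod_morphism.
HB.instance Definition _ := GRing.isMonoidMorphism.Build (laurent b rat) QL
  inclb inclb_is_monoid_morphism.

Lemma inclb_inj : injective inclb.
Proof. by move=> f g e; apply: laurent_eq => d; rewrite -[LHS]/(inclb f d) e. Qed.

Lemma inclb_ql a c : inclb (ql b a c) = ql false a c.
Proof. by apply: laurent_eq. Qed.

Lemma inclb_inv (f : laurent b rat) : f \is a GRing.unit -> inclb f^-1 = (inclb f)^-1.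
Proof. exact: rmorphV. Qed.

Lemma inclb_qdiff : inclb (qdiff b) = qdiff false.
Proof. by rewrite rmorphB /= !inclb_ql. Qed.

Lemma inclb_qint a : inclb (qint b a) = qint false a.
Proof. by rewrite rmorphM rmorphB /= !inclb_ql inclb_inv ?qdiff_unit// inclb_qdiff. Qed.

Lemma inclb_coefE k : inclb (coefE b k) = coefE false k.
Proof. by rewrite rmorphM /= inclb_ql inclb_qint. Qed.

Lemma inclb_coefF k : inclb (coefF b k) = coefF false k.
Proof.
have u2 := one_sub_q_unit b 1.
by rewrite !rmorphM /= inclb_inv// !rmorphB !rmorph1 /= !inclb_ql.
Qed.

Lemma inclb_ch k (M : gsmod k) : admissible b M -> inclb (ch b M) = ch false M.
Proof.
move=> aM; apply: laurent_eq => d.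
rewrite -[LHS]/(ch b M d) !chE//; have [lf [cM _]] := aM; by split.
Qed.

End Inclusion.

(** Invertibility in Q((q,lambda)) of the ratios of consecutive ch Omega_k. *)
Lemma coefF_unit k : coefF false k \is a GRing.unit.
Proof.
rewrite /coefF !unitrM unitrV ql_unit (one_sub_q_unit false 1) andbT /=.
by apply: geo_unit => //; rewrite /succ0.
Qed.

(** * Specialization *)

Section Specialization.

Let h : {poly int} := 'X^2 - 1.

Lemma size_h : size h = 3%N.
Proof. by rewrite /h size_polyDl size_polyXn// size_polyN size_poly1. Qed.

Lemma mk_monic_h : mk_monic h = h.
Proof.
rewrite /mk_monic size_h /=; case: ifP => // /negP[].
by rewrite monicE lead_coefDl ?lead_coefXn// size_polyXn size_polyN size_poly1.
Qed.

Lemma horner_h : h.[-1] = 0.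
Proof. by rewrite /h !hornerE. Qed.

(** The evaluation at -1 factors through the quotient since -1 is a root of X^2 - 1. *)
Lemma spec_mod (p : {poly int}) : (Pdiv.Ring.rmodp p (mk_monic h)).[-1] = p.[-1].
Proof.
rewrite {2}(Pdiv.RingMonic.rdivp_eq (monic_mk_monic h) p) hornerD hornerM.
by rewrite mk_monic_h horner_h mulr0 add0r.
Qed.

Fact Zpi_spec_is_zmod_morphism : zmod_morphism Zpi_spec.
Proof. by move=> x y; rewrite /Zpi_spec -intrB !hornerE. Qed.

Fact Zpi_spec_is_monoid_morphism : monoid_morphism Zpi_spec.
Proof.
split=> [|x y]; rewrite /Zpi_spec.
  by rewrite -[((1 : Zpi) : {poly int})]/(1%:P) hornerC.
by rewrite -intrM -hornerM -[in RHS]spec_mod.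
Qed.

HB.instance Definition _ := GRing.isZmodMorphism.Build Zpi rat
  Zpi_spec Zpi_spec_is_zmod_morphism.
HB.instance Definition _ := GRing.isMonoidMorphism.Build Zpi rat
  Zpi_spec Zpi_spec_is_monoid_morphism.

Lemma Zpi_spec_mult (n m : nat) : Zpi_spec (n%:R + m%:R * Zpi_gen) = n%:R - m%:R.
Proof.
have gE : Zpi_spec Zpi_gen = -1 by rewrite /Zpi_spec /Zpi_gen /= spec_mod hornerX.
by rewrite rmorphD rmorphM !rmorph_nat /= gE mulrN1.
Qed.

Variable b : bool.

Fact spec_is_zmod_morphism : zmod_morphism (@spec b).
Proof. by move=> f g; apply: laurent_eq => d; exact: raddfB. Qed.

Fact spec_is_monoid_morphism : monoid_morphism (@spec b).
Proof.
split=> [|f g]; apply: laurent_eq => d /=; first by rewrite rmorph_nat.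
have [s us fs] := laurent_conv_fin d (lcoefP f) (lcoefP g).
rewrite (lconvE us fs) rmorph_sum [RHS](lconvE (f := spec f) (g := spec g) us).
  by apply: eq_bigr => e _; rewrite rmorphM.
by move=> e fe ge; apply: fs => e0; [apply: fe|apply: ge]; rewrite /= e0 Zpi_spec0.
Qed.

HB.instance Definition _ := GRing.isZmodMorphism.Build (laurent b Zpi) (laurent b rat)
  (@spec b) spec_is_zmod_morphism.
HB.instance Definition _ := GRing.isMonoidMorphism.Build (laurent b Zpi) (laurent b rat)
  (@spec b) spec_is_monoid_morphism.

End Specialization.

(** * Characters of tensor products *)

Lemma Omega_lo_const k c : Omega_lo (Oconst k c) = ext_const k.+1 c%:MP.
Proof. by rewrite Omega_loE -[LHS]/(ext_map _ _ _) /Oconst ext_map_const /= mwidenC. Qed.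

Lemma Omega_hi_const k c : Omega_hi (Oconst k.+1 c) = ext_const k.+1 c%:MP.
Proof. by rewrite Omega_hiE -[LHS]/(ext_map _ _ _) /Oconst ext_map_const /= hi_polyC. Qed.

Section TensorCharacter.
Variables (n k' k : nat) (l : Omega k' -> OmegaB n) (r : Omega k -> OmegaB n).
Hypothesis lB : forall x y, l (x - y) = l x - l y.
Hypothesis lM : forall x y, l (x * y) = l x * l y.
Hypothesis l1 : l 1 = 1.
Hypothesis rM : forall x y, r (x * y) = r x * r y.
Hypothesis r1 : r 1 = 1.
Hypothesis l_hom : forall d p c, @Omega_hom k' d p c -> @OmegaB_hom n d p (l c).
Hypothesis lC : forall c, l (Oconst k' c) = ext_const n.+1 c%:MP.
Hypothesis rC : forall c, r (Oconst k c) = ext_const n.+1 c%:MP.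
Variables (I : eqType) (deg : I -> bideg * bool) (beta : I -> OmegaB n).
Hypothesis beta_hom : forall i, @OmegaB_hom n (deg i).1 (deg i).2 (beta i).
Hypothesis D : gdecomp (@Omega_hom k) (@OmegaB_hom n) deg (fun i c => beta i * r c).
Variables (M : gsmod k) (T : gsmod k') (t : OmegaB n -> M -> T).
Hypothesis tT : is_tensor l r t.
Variables (b : bool) (fibre : bideg -> bool -> seq I).
Hypothesis aM : admissible b M.
Hypothesis sI : laurent_supp b (fun e => exists i, (deg i).1 = e).
Hypothesis fibre_uniq : forall e o, uniq (fibre e o).
Hypothesis fibreP : forall e o i, (i \in fibre e o) = (deg i == (e, o)).

Let DT := gdecomp_tensor lB lM l1 rM r1 l_hom beta_hom D tT.

Let tZ i a x : t (beta i) (Oconst k a *: x) = Oconst k' a *: t (beta i) x.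
Proof. by have [[_ _ tr] tl _ _] := tT; rewrite -tr -tl rC lC ext_constC. Qed.

Lemma tensor_admissible : admissible b T.
Proof. exact: (gdecomp_admissible DT tZ aM sI fibre_uniq fibreP). Qed.

Lemma ch_tensor : ch b T = index_series b (fun e o => size (fibre e o)) * ch b M.
Proof. exact: (ch_gdecomp DT tZ aM sI fibre_uniq fibreP). Qed.

End TensorCharacter.

Section IndexSeries.
Variables (b : bool) (k : nat).

(** The basis element xi^a s^e is determined by its q-degree and its parity. *)
Definition lo_fibre (e : bideg) (o : bool) : seq (nat * bool) :=
  [seq i <- [:: (absz ((e.1 + (if o then (2 * k.+1)%:Z else 0)) %/ 2)%Z, o)] |
     lo_deg k i == (e, o)].

Lemma lo_fibreP e o i : (i \in lo_fibre e o) = (lo_deg k i == (e, o)).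
Proof.
rewrite mem_filter; case: eqP => //= -[<- <-]; rewrite inE /= subrK.
by case: i => a o'; rewrite mulKz// eqxx.
Qed.

Lemma lo_fibre_uniq e o : uniq (lo_fibre e o). Proof. exact: filter_uniq. Qed.

Lemma lo_supp : laurent_supp b (fun e => exists i, (lo_deg k i).1 = e).
Proof.
apply/laurent_suppP; exists (2 * k%:Z + 4); split=> [|_ [[a o] <-]]; first lia.
by apply/andP; split; [apply/andP; split=> /=; case: o; nia|case: b => //=; case: o; lia].
Qed.

Lemma size_lo_fibre e o :
  (size (lo_fibre e o))%:R = geo_coef (2, 0) (e - (if o then (- (2 * k%:Z + 2), 2) else 0)).
Proof.
rewrite /geo_coef; congr (_%:R).
have -> : `[< exists n : nat, e - (if o then (- (2 * k%:Z + 2), 2) else 0) = ((2, 0) : bideg) *+ n >]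
    = has (fun=> true) (lo_fibre e o).
  apply/asboolP/hasP => [[n en]|[[a o'] + _]].
    exists (n, o) => //; rewrite lo_fibreP /lo_deg; apply/eqP; congr (_, _).
    have -> : e = ((2, 0) : bideg) *+ n + (if o then (- (2 * k%:Z + 2), 2) else 0).
      by rewrite -en subrK.
    rewrite pair_mulrn mul0rn; case: o {en} => /=; congr (_, _) => //=; lia.
  rewrite lo_fibreP => /eqP[<- <-]; exists a; rewrite pair_mulrn mul0rn.
  case: o' => /=; congr (_, _) => //=; lia.
by rewrite has_predT /lo_fibre /=; case: ifP.
Qed.

(** Summing over the powers of xi gives a geometric series; the odd half of the basis has the
degree (-2k-2, 2) of s and contributes with a sign. *)
Lemma index_lo : index_series b (fun e o => size (lo_fibre e o)) =
  (1 - ql b (- (2 * k%:Z + 2)) 2) / (1 - ql b 2 0).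
Proof.
have g0 : succ0 (2, 0) by [].
have gE d : geo b (2, 0) d = geo_coef (2, 0) d by apply: mk_laurentE; exact: geo_supp.
rewrite -[(1 - ql b 2 0)^-1]/((1 - lmon b rat (2, 0))^-1) geo_invE//.
apply: laurent_eq => d; rewrite mulrBl mul1r lcoefB lmon_mulE !gE mk_laurentE.
  by rewrite !size_lo_fibre subr0.
apply: laurent_supp_sub lo_supp => e h; apply: contrapT => ne; apply: h.
suff z o : lo_fibre e o = [::] by rewrite !z subrr.
case: (lo_fibre e o) (lo_fibreP e o) => // i s /(_ i).
by rewrite inE eqxx => /esym/eqP de; case: ne; exists i; rewrite de.
Qed.

Definition hi_fibre (e : bideg) (o : bool) : seq 'I_k.+1 :=
  [seq i <- enum 'I_k.+1 | hi_deg i == (e, o)].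

Lemma hi_fibreP e o i : (i \in hi_fibre e o) = (hi_deg i == (e, o)).
Proof. by rewrite mem_filter mem_enum andbT. Qed.

Lemma hi_fibre_uniq e o : uniq (hi_fibre e o).
Proof. by rewrite filter_uniq// enum_uniq. Qed.

Lemma hi_supp : laurent_supp b (fun e => exists i, (@hi_deg k i).1 = e).
Proof.
apply/laurent_suppP; exists 0; split=> // _ [i <-].
by apply/andP; split; [apply/andP; split=> /=; lia|case: b => //=].
Qed.

Lemma lcoef_sum (R : zmodType) J (s : seq J) (E : J -> laurent b R) d :
  (\sum_(j <- s) E j) d = \sum_(j <- s) E j d.
Proof. by elim: s => [|j s IH]; rewrite ?big_nil// !big_cons -IH. Qed.

Lemma index_hi : index_series b (fun e o => size (hi_fibre e o)) =
  \sum_(i < k.+1) ql b (2 * i%:Z) 0.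
Proof.
apply: laurent_eq => d; rewrite mk_laurentE.
  rewrite lcoef_sum !size_filter [X in _ - X%:R](_ : _ = 0%N).
    rewrite subr0 -sum1_count natr_sum big_mkcond big_enum /=.
    apply: eq_bigr => i _; rewrite /hi_deg xpair_eqE eqxx andbT eq_sym.
    by case: eqP.
  by apply/eqP; rewrite -leqn0 leqNgt -has_count; apply/hasP => -[i _ /eqP[]].
apply: laurent_supp_sub hi_supp => e h; apply: contrapT => ne; apply: h.
suff z o : hi_fibre e o = [::] by rewrite !z subrr.
case: (hi_fibre e o) (hi_fibreP e o) => // i s /(_ i).
by rewrite inE eqxx => /esym/eqP de; case: ne; exists i; rewrite de.
Qed.

End IndexSeries.

Lemma ch_shift b k c (M : gsmod k) : admissible b M ->
  ch b (gshift c M) = lmon b rat c * ch b M.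
Proof.
move=> aM; apply: laurent_eq => d.
by rewrite lmon_mulE chE ?gdim_shift ?chE//; apply: shift_admissible.
Qed.

Section OmegaMorphisms.
Variable k : nat.

Lemma Omega_loB (x y : Omega k) : Omega_lo (x - y) = Omega_lo x - Omega_lo y.
Proof. by rewrite !Omega_loE rmorphB. Qed.
Lemma Omega_loM (x y : Omega k) : Omega_lo (x * y) = Omega_lo x * Omega_lo y.
Proof. by rewrite !Omega_loE rmorphM. Qed.
Lemma Omega_lo1 : Omega_lo (1 : Omega k) = 1.
Proof. by rewrite Omega_loE rmorph1. Qed.
Lemma Omega_hiB (x y : Omega k.+1) : Omega_hi (x - y) = Omega_hi x - Omega_hi y.
Proof. by rewrite !Omega_hiE rmorphB. Qed.
Lemma Omega_hiM (x y : Omega k.+1) : Omega_hi (x * y) = Omega_hi x * Omega_hi y.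
Proof. by rewrite !Omega_hiE rmorphM. Qed.
Lemma Omega_hi1 : Omega_hi (1 : Omega k.+1) = 1.
Proof. by rewrite Omega_hiE rmorph1. Qed.

End OmegaMorphisms.

Section FunctorCharacters.
Variables (b : bool) (k : nat).

Lemma functorF_exists (M : gsmod k) : exists N, functorF M N.
Proof.
eexists; eexists; eexists; split; last reflexivity.
exact: (tens_is_tensor (@Omega_hiB k) (@Omega_hiM k) (@Omega_hi1 k) (@Omega_loM k) (@Omega_lo1 k) (@Omega_hi_hom k) (@lo_beta_hom k)
  (gdecomp_lo_right k)).
Qed.

Lemma functorE_exists (M : gsmod k.+1) : exists N, functorE M N.
Proof.
eexists; eexists; eexists; split; last reflexivity.
exact: (tens_is_tensor (@Omega_loB k) (@Omega_loM k) (@Omega_lo1 k) (@Omega_hiM k) (@Omega_hi1 k) (@Omega_lo_hom k) (@hi_beta_hom k)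
  (gdecomp_hi_right k)).
Qed.

Lemma functorF_ch (M : gsmod k) N : admissible b M -> functorF M N ->
  admissible b N /\ ch b N = coefF b k * ch b M.
Proof.
move=> aM [T [t [tT ->]]].
have aT := tensor_admissible (@Omega_hiB k) (@Omega_hiM k) (@Omega_hi1 k) (@Omega_loM k) (@Omega_lo1 k) (@Omega_hi_hom k) (@Omega_hi_const k)
  (@Omega_lo_const k) (@lo_beta_hom k) (gdecomp_lo_right k) tT aM (lo_supp b k)
  (@lo_fibre_uniq k) (@lo_fibreP k).
split; first exact: shift_admissible.
rewrite ch_shift// (ch_tensor (@Omega_hiB k) (@Omega_hiM k) (@Omega_hi1 k) (@Omega_loM k) (@Omega_lo1 k) (@Omega_hi_hom k) (@Omega_hi_const k)
  (@Omega_lo_const k) (@lo_beta_hom k) (gdecomp_lo_right k) tT aM (lo_supp b k)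
  (@lo_fibre_uniq k) (@lo_fibreP k)).
by rewrite index_lo mulrA.
Qed.

Lemma functorE_ch (M : gsmod k.+1) N : admissible b M -> functorE M N ->
  admissible b N /\ ch b N = coefE b k * ch b M.
Proof.
move=> aM [T [t [tT ->]]].
have aT := tensor_admissible (@Omega_loB k) (@Omega_loM k) (@Omega_lo1 k) (@Omega_hiM k) (@Omega_hi1 k) (@Omega_lo_hom k) (@Omega_lo_const k)
  (@Omega_hi_const k) (@hi_beta_hom k) (gdecomp_hi_right k) tT aM (hi_supp b k)
  (@hi_fibre_uniq k) (@hi_fibreP k).
split; first exact: shift_admissible.
rewrite ch_shift// (ch_tensor (@Omega_loB k) (@Omega_loM k) (@Omega_lo1 k) (@Omega_hiM k) (@Omega_hi1 k) (@Omega_lo_hom k) (@Omega_lo_const k)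
  (@Omega_hi_const k) (@hi_beta_hom k) (gdecomp_hi_right k) tT aM (hi_supp b k)
  (@hi_fibre_uniq k) (@hi_fibreP k)).
rewrite index_hi sum_ql -[lmon b rat _]/(ql b (k%:Z + 2) (-1)) /coefE.
move: (qint b _) => Q; rewrite !mulrA qlM addr0.
by have -> : k%:Z + 2 + k%:Z = 2 * k%:Z + 2 by lia.
Qed.

End FunctorCharacters.

Section FunctorProjectives.
Variable k : nat.

(** F_k takes a homogeneous basis to a homogeneous basis: it gets multiplied by the basis
    of the bimodule over its left ring. *)
Lemma tensorF_basis (M : gsmod k) (T : gsmod k.+1) t (J : eqType) (deg : J -> bideg * bool)
    (g : J -> M) : is_tensor (@Omega_hi k) (@Omega_lo k) t -> hbasis deg g ->
  hbasis (fun z : J * 'I_k.+1 => shift_deg (@hi_deg k z.2) (deg z.1))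
    (fun z => t (@hi_beta k z.2) (g z.1) : T).
Proof.
move=> tT hg; exact: (gdecomp_tensor_basis (@Omega_hiB k) (@Omega_hiM k) (@Omega_hi1 k)
  (@Omega_loM k) (@Omega_lo1 k) (@Omega_hi_hom k) (@lo_beta_hom k)
  (gdecomp_lo_right k) tT (gdecomp_hi_left k) hg).
Qed.

Lemma tensorE_basis (M : gsmod k.+1) (T : gsmod k) t (J : eqType) (deg : J -> bideg * bool)
    (g : J -> M) : is_tensor (@Omega_lo k) (@Omega_hi k) t -> hbasis deg g ->
  hbasis (fun z : J * (nat * bool) => shift_deg (lo_deg k z.2) (deg z.1))
    (fun z => t (lo_beta k z.2) (g z.1) : T).
Proof.
move=> tT hg; exact: (gdecomp_tensor_basis (@Omega_loB k) (@Omega_loM k) (@Omega_lo1 k)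
  (@Omega_hiM k) (@Omega_hi1 k) (@Omega_lo_hom k) (@hi_beta_hom k)
  (gdecomp_hi_right k) tT (gdecomp_lo_left k) hg).
Qed.

(** Bounded projectives have homogeneous bases, and tensoring with the bimodule takes these to
homogeneous bases. *)
Lemma functorF_projective (M : gsmod k) N : admissible true M -> projective M ->
  functorF M N -> projective N.
Proof.
move=> aM pM [T [t [tT ->]]]; apply: shift_projective.
have [m /free_decomp_hbasis [g hg]] := psmod_free_decomp aM pM.
exact: (hbasis_projective (tensorF_basis tT hg)).
Qed.

Lemma functorE_projective (M : gsmod k.+1) N : admissible true M -> projective M ->
  functorE M N -> projective N.
Proof.
move=> aM pM [T [t [tT ->]]]; apply: shift_projective.
have [m /free_decomp_hbasis [g hg]] := psmod_free_decomp aM pM.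
exact: (hbasis_projective (tensorE_basis tT hg)).
Qed.

(** The character of F_k(Omega_k) in two ways: from the freeness of the bimodule over the
lower ring, and from the basis of F_k(Omega_k) over the upper ring. *)
Lemma ch_Omega_rec b : qint b k.+1%:Z * ch b (gOmega k.+1) = coefF b k * ch b (gOmega k).
Proof.
have [N fN] := functorF_exists (gOmega k).
have [_ <-] := functorF_ch (Omega_admissible k b) fN.
have [T [t [tT NT]]] := fN.
have hT := tensorF_basis tT (@Omega_hbasis k).
have Z (z : unit * 'I_k.+1) a (x : gOmega k.+1) :
    ((Oconst k.+1 a *: x) : Omega k.+1) *: (t (@hi_beta k z.2) 1 : T) =
    Oconst k.+1 a *: ((x : Omega k.+1) *: (t (@hi_beta k z.2) 1 : T)).
  by rewrite [RHS]scalerA.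
pose fibre e o : seq (unit * 'I_k.+1) := [seq (tt, i) | i <- hi_fibre k e o].
have degE z : shift_deg (@hi_deg k z.2) (0, false) = hi_deg z.2.
  by rewrite /shift_deg addr0 addbF -surjective_pairing.
have lsupp : laurent_supp b (fun e => exists z : unit * 'I_k.+1,
    (shift_deg (@hi_deg k z.2) (0, false)).1 = e).
  by apply: laurent_supp_sub (hi_supp b k) => _ [z <-]; exists z.2; rewrite degE.
have ufib e o : uniq (fibre e o) by rewrite map_inj_uniq ?hi_fibre_uniq// => i j [].
have fibP e o z : (z \in fibre e o) = (shift_deg (@hi_deg k z.2) (0, false) == (e, o)).
  by case: z => -[] i; rewrite mem_map ?degE ?hi_fibreP// => i' j [].
have chT : ch b T = index_series b (fun e o => size (fibre e o)) * ch b (gOmega k.+1).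
  exact (@ch_gdecomp b k.+1 k.+1 (unit * 'I_k.+1)%type (gOmega k.+1) T _ _ hT Z
    (Omega_admissible k.+1 b) lsupp fibre ufib fibP).
have sz : (fun e o => size (fibre e o)) = (fun e o => size (hi_fibre k e o)) :> (bideg -> bool -> nat).
  by apply/funext => e; apply/funext => o; rewrite size_map.
have aT : admissible b T.
  exact (@gdecomp_admissible b k.+1 k.+1 (unit * 'I_k.+1)%type (gOmega k.+1) T _ _ hT Z
    (Omega_admissible k.+1 b) lsupp fibre ufib fibP).
rewrite NT ch_shift// chT sz index_hi sum_ql -[lmon b rat _]/(ql b (- k%:Z) 0).
move: (qint b _) => Q; rewrite !mulrA qlM addNr addr0 ql00 mul1r.
by [].
Qed.


End FunctorProjectives.

(** * Quotients and free modules *)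

Section QuotientMap.
Variables (R : nzRingType) (V W : lmodType R) (S : V -> Prop) (f : {linear V -> W}).
Hypothesis f0 : forall x, S x -> f x = 0.

Lemma lspan_ker x : lspan S x -> f x = 0.
Proof. by elim=> [|c y z Sy _ IH]; rewrite ?linear0// linearP f0// scaler0 add0r. Qed.

(** The values on arbitrarily chosen representatives; [lquot_mapE] shows independence of the
choice when f kills S. *)
Definition lquot_map (q : lquot S) : W := f (repr (q : Quotient.quot (lspanb S))).

Lemma lquot_mapE x : lquot_map (lpi S x) = f x.
Proof.
apply/eqP; rewrite -subr_eq0 -linearB; apply/eqP/lspan_ker/asboolP.
rewrite -[asbool _]/(_ \in lspanb S) Quotient.idealrBE.
by rewrite reprK.
Qed.

Fact lquot_map_linear : linear lquot_map.
Proof.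
move=> a x y; rewrite -[x]lpi_repr -[y]lpi_repr.
move: (repr x) (repr y) => {}x {}y.
rewrite -[RHS]/(a *: lquot_map (lpi S x) + lquot_map (lpi S y)) !lquot_mapE -linearP -lquot_mapE.
by rewrite lpiD lpiZ.
Qed.

End QuotientMap.

Lemma lpiZ' (R : nzRingType) (V : lmodType R) (S : V -> Prop) (a : R) (x : V) :
  lpi S (a *: x) = a *: lpi S x.
Proof. exact: lpiZ. Qed.

Section FreeLift.
Variables (R : nzRingType) (K : choiceType) (W : lmodType R) (f : K -> W).

Lemma fglift1 x : fglift f << x >> = f x. Proof. by rewrite liftU scale1r. Qed.

Fact fglift_is_linear : linear (fglift f : {freeg K / R} -> W).
Proof.
move=> a D1 D2; have fB := lift_is_additive f.
rewrite (morphD fB); congr (_ + _).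
have sE (s : seq K) (g : K -> {freeg K / R}) :
    fglift f (\sum_(x <- s) g x) = \sum_(x <- s) fglift f (g x).
  by elim: s => [|x s IH]; rewrite ?big_nil ?(morph0 fB)// !big_cons (morphD fB) IH.
rewrite -[in RHS](freeg_sumE D1) -[a *: D1]/(\sum_(x <- dom D1) << a * coeff x D1 *g x >>).
by rewrite !sE scaler_sumr; apply: eq_bigr => x _; rewrite !liftU scalerA.
Qed.

HB.instance Definition _ := GRing.isLinear.Build R {freeg K / R} W _ (fglift f) fglift_is_linear.

End FreeLift.

(** * Grothendieck groups *)

Section GrothendieckCharacter.
Variables (b : bool) (C : gcat b) (k : nat) (w : laurent b rat).
Hypothesis w_reg : forall f, f * w = 0 -> f = 0.
Hypothesis obj_admissible : forall M : gsmod k, gobj C M -> admissible b M.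
Hypothesis exact_ses : forall M1 M M2 : gsmod k, gexact C M1 M M2 -> short_exact M1 M M2.
Hypothesis series_ch : forall M : gsmod k, gobj C M -> spec (gseries C M) * w = ch b M.
Hypothesis obj_giso : forall M N : gsmod k, giso M N -> gobj C M -> gobj C N.
Variable G : gsmod k.
Hypothesis G_obj : gobj C G.
Hypothesis G_series : forall M, giso G M -> gseries C M = 1.

Lemma ch_giso (M N : gsmod k) : admissible b M -> giso M N -> ch b N = ch b M.
Proof.
move=> aM MN; have aN := giso_admissible MN aM; have [lf _] := aM.
by apply: laurent_eq => d; rewrite !chE// !(giso_gdim _ _ MN).
Qed.

Lemma ch_exact (M1 M M2 : gsmod k) : admissible b M1 -> admissible b M -> admissible b M2 ->
  short_exact M1 M M2 -> ch b M = ch b M1 + ch b M2.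
Proof.
move=> a1 a a2 ses; have [l1 _] := a1; have [l2 _] := a2.
apply: laurent_eq => d; rewrite lcoefD !chE// !(gdim_short_exact _ _ l1 l2 ses) !natrD.
by rewrite addrACA opprD.
Qed.

Lemma gfree_seriesE (x : gfree C k) :
  gfree_series x = fglift (fun X : gob C k => gseries C (sval X) : zmodule (laurent b Zpi)) x.
Proof.
rewrite /gfree_series -[in RHS](freeg_sumE x) linear_sum.
by apply: eq_bigr => X _; rewrite /= liftU.
Qed.

Definition free_spec : {linear gfree C k -> zmodule (laurent b rat)} :=
  fglift (fun X : gob C k => spec (gseries C (sval X)) : zmodule (laurent b rat)).

Lemma free_specE (x : gfree C k) : free_spec x = spec (gfree_series x).
Proof.
rewrite -[in LHS](freeg_sumE x) linear_sum /gfree_series raddf_sum.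
by apply: eq_bigr => X _; rewrite raddfMz /= liftU.
Qed.

Lemma free_spec_ch (X : gob C k) : (free_spec << X >> : laurent b rat) * w = ch b (sval X).
Proof. by rewrite [free_spec _]fglift1 series_ch//; exact: svalP X. Qed.

(** Characters are additive on exact sequences; as w is regular, so are the multiplicity series. *)
Lemma free_spec_relator x : top_relator x -> free_spec x = 0.
Proof.
case=> [[X1 [X [X2 [/exact_ses ses ->]]]]|x0]; last by rewrite free_specE x0 raddf0.
apply: w_reg; rewrite linearB linearD /= mulrBl mulrDl !free_spec_ch.
have adm (Y : gob C k) := obj_admissible (svalP Y).
by rewrite (ch_exact (adm X1) (adm X) (adm X2) ses) subrr.
Qed.

Definition top_spec : top_groth C k -> laurent b rat := @lquot_map _ _ _ _ free_spec.

Lemma top_specE X : top_spec (top_pi X) = spec (gfree_series X).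
Proof. by rewrite -free_specE; exact: (lquot_mapE free_spec_relator). Qed.

Lemma top_specD x y : top_spec (x + y) = top_spec x + top_spec y.
Proof.
have := lquot_map_linear free_spec_relator 1 x y; rewrite !scale1r; exact.
Qed.

Lemma top_scale_spec s x y : top_scale s x y -> top_spec y = spec s * top_spec x.
Proof. by move=> [X [Y [-> -> e]]]; rewrite !top_specE e rmorphM. Qed.

Definition free_char : {linear {freeg (top_groth C k) / laurent b rat} -> (laurent b rat)^o} :=
  fglift (fun x : top_groth C k => top_spec x : (laurent b rat)^o).

Lemma free_char_relator z : ext_relator z -> free_char z = 0.
Proof.
case=> [[x [y ->]]|[s [x [y [sxy ->]]]]].
  by rewrite linearB linearD /= !fglift1 top_specD subrr.
by rewrite linearB linearZ /= !fglift1 (top_scale_spec sxy) subrr.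
Qed.

(** The coordinate on the Grothendieck group of the modules over Omega_k; by [gchar_class] it
sends the class of M to ch M / w. *)
Definition gchar : groth_at C k -> (laurent b rat)^o := @lquot_map _ _ _ _ free_char.

Lemma gcharE z : gchar (lpi (@ext_relator b C k) z) = free_char z.
Proof. exact: (lquot_mapE free_char_relator). Qed.

Lemma gchar_linear : linear gchar.
Proof. exact: (lquot_map_linear free_char_relator). Qed.

HB.instance Definition _ := GRing.isLinear.Build _ (groth_at C k) _ _ gchar gchar_linear.

(** A class is only defined through small models, which exist by local finiteness. *)
Lemma gob_exists M : gobj C M -> exists X : gob C k, giso (sval X) M.
Proof.
move=> oM; have [lf _] := obj_admissible oM.
have [X XM] := locally_finite_small_model lf.
by exists (exist _ X (obj_giso (giso_sym XM) oM)).
Qed.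

Lemma gchar_class M : gobj C M -> gchar (class_at C M) * w = ch b M.
Proof.
move=> oM; rewrite gcharE [free_char _]fglift1 /top_class.
have [X0 XM0] := gob_exists oM.
case: xgetP => [x _ [X [XM ->]]|/(_ (top_pi << X0 >>))]; last by case; exists X0.
have aX := obj_admissible (svalP X).
by rewrite (ch_giso aX XM) top_specE -free_specE free_spec_ch.
Qed.

(** If G has multiplicity series 1, then in the topological Grothendieck group the class of any
Y is its own multiplicity series times the class of G; extension of scalars turns this into
an equation in groth_at. *)
Lemma groth_generator : exists g : groth_at C k, gchar g = 1 /\ forall z, z = gchar z *: g.
Proof.
have [X0 X0G] := gob_exists G_obj.
have s1 : gfree_series (<< X0 >> : gfree C k) = 1.
  by rewrite gfree_seriesE fglift1 (G_series (giso_sym X0G)).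
pose x0 : top_groth C k := top_pi << X0 >>.
pose g : groth_at C k := lpi (@ext_relator b C k) << x0 >>.
have g1 : gchar g = 1 by rewrite gcharE [free_char _]fglift1 top_specE s1 rmorph1.
have gen (y : top_groth C k) : lpi (@ext_relator b C k) << y >> =
    gchar (lpi (@ext_relator b C k) << y >>) *: g :> groth_at C k.
  have [Y yY] : exists Y, y = top_pi Y 
    by exists (repr (y : Quotient.quot (lspanb (@top_relator b C k)))); exact: esym (lpi_repr y).
  rewrite gcharE [free_char _]fglift1 yY top_specE -lpiZ'.
  apply: lpi_eq; rewrite -[_ - _]scale1r -[_ *: _]addr0.
  apply: LSpanS; last exact: LSpan0.
  right; exists (gfree_series Y), x0, (top_pi Y); split=> //.
  by exists << X0 >>, Y; rewrite s1 mulr1.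
exists g; split=> // z.
rewrite -[z]lpi_repr; move: (repr z) => {}z.
rewrite -(freeg_sumE z).
have lsum (s : seq (top_groth C k)) (E : top_groth C k -> {freeg (top_groth C k) / laurent b rat}) :
    lpi (@ext_relator b C k) (\sum_(x <- s) E x) = \sum_(x <- s) lpi (@ext_relator b C k) (E x).
  elim: s => [|x s IH]; first by rewrite !big_nil; exact: raddf0.
  by rewrite !big_cons lpiD IH.
rewrite lsum linear_sum scaler_suml; apply: eq_bigr => x _.
have -> : << coeff x z *g x >> = coeff x z *: << x >> :> {freeg (top_groth C k) / laurent b rat}.
  by apply/eqP/freeg_eqP => y; rewrite coeffZ !coeffU mul1r.
by rewrite lpiZ' linearZ /= -scalerA -gen.
Qed.

End GrothendieckCharacter.

(** * Ladder operators on a direct sum of lines *)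

Section Ladder.
Variables (b : bool) (V : nat -> lmodType (laurent b rat)).
Notation L := (laurent b rat).
Variables (chi : forall k, V k -> L^o) (g : forall k, V k).
Hypothesis chi_linear : forall k, linear (@chi k).
Hypothesis chi_g : forall k, chi (g k) = 1.
Hypothesis chiK : forall k (z : V k), z = chi z *: g k.
Variables fc ec : nat -> L.
Hypothesis fc_ec : forall k, fc k * ec k = qint b k.+1%:Z * vermaE b k.

Let chiL k : {linear V k -> L^o} := HB.pack (@chi k)
  (GRing.isLinear.Build L (V k) L^o _ (@chi k) (@chi_linear k)).

Definition co (x : dsum V) (k : nat) : L := chi (x k).

Lemma chi0 k : chi (0 : V k) = 0. Proof. exact: (linear0 (chiL k)). Qed.
Lemma chiZ k a (x : V k) : chi (a *: x) = a * chi x. Proof. exact: (linearZ_LR (chiL k)). Qed.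
Lemma chiB k (x y : V k) : chi (x - y) = chi x - chi y. Proof. exact: (linearB (chiL k)). Qed.
Lemma chi_inj k (x y : V k) : chi x = chi y -> x = y.
Proof. by move=> e; rewrite [x]chiK e -chiK. Qed.
Lemma chi_scale k a : chi (a *: g k) = a. Proof. by rewrite chiZ chi_g mulr1. Qed.

Lemma coP a x y k : co (a *: x + y) k = a * co x k + co y k.
Proof. exact: (chi_linear a (x k) (y k)). Qed.
Lemma co0 k : co 0 k = 0. Proof. exact: chi0. Qed.
Lemma coZ a x k : co (a *: x) k = a * co x k.
Proof. exact: chiZ. Qed.
Lemma coB x y k : co (x - y) k = co x k - co y k.
Proof. exact: chiB. Qed.
Lemma co_sum J (s : seq J) (E : J -> dsum V) k :
  co (\sum_(j <- s) E j) k = \sum_(j <- s) co (E j) k.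
Proof.
elim: s => [|j s IH]; first by rewrite !big_nil co0.
by rewrite !big_cons -[E j]scale1r coP mul1r scale1r IH.
Qed.

Lemma co_eq x y : (forall k, co x k = co y k) -> x = y.
Proof. by move=> e; apply: dsum_eq => k; exact/chi_inj/e. Qed.

Lemma co_fin x : exists n, forall k, (n <= k)%N -> co x k = 0.
Proof. by have [n hn] := dsumP x; exists n => k /hn; rewrite /co => ->; exact: chi0. Qed.

Fact of_co_fin (c : nat -> L) (n : nat) : (forall k, (n <= k)%N -> c k = 0) ->
  exists n, forall k, (n <= k)%N -> c k *: g k = 0.
Proof. by move=> h; exists n => k /h ->; rewrite scale0r. Qed.

Definition of_co c n h := DSum (@of_co_fin c n h).
Lemma co_of_co c n h k : co (@of_co c n h) k = c k.
Proof. exact: chi_scale. Qed.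

Lemma co_dinj k (v : V k) j : co (dinj v) j = if k == j then chi v else 0.
Proof.
rewrite /co /=; case: eqP => [e|_]; last exact: chi0.
by case: j / e.
Qed.

Lemma linear_of_coef (T : dsum V -> nat -> L) :
  (forall a x y k, T (a *: x + y) k = a * T x k + T y k) ->
  (forall x, exists n, forall k, (n <= k)%N -> T x k = 0) ->
  exists f : {linear dsum V -> dsum V}, forall x k, co (f x) k = T x k.
Proof.
move=> Tl Tf; pose f x := of_co (projT2 (cid (Tf x))).
have fl : linear f.
  by move=> a x y; apply: co_eq => k; rewrite coP !co_of_co Tl.
pose F : {linear dsum V -> dsum V} := HB.pack f (GRing.isLinear.Build L (dsum V) (dsum V) _ f fl).
by exists F => x k; exact: co_of_co.
Qed.

Lemma opF_exists : exists f : {linear dsum V -> dsum V},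
  forall x k, co (f x) k = if k is j.+1 then fc j * co x j else 0.
Proof.
apply: linear_of_coef => [a x y [|k]|x] /=; first by rewrite mulr0 addr0.
  by rewrite coP; ring.
by have [n hn] := co_fin x; exists n.+1 => -[//|k] nk; rewrite /= hn// mulr0.
Qed.

Lemma opE_exists : exists f : {linear dsum V -> dsum V},
  forall x k, co (f x) k = ec k * co x k.+1.
Proof.
apply: linear_of_coef => [a x y k|x]; first by rewrite coP; ring.
by have [n hn] := co_fin x; exists n => k nk; rewrite hn ?mulr0//; lia.
Qed.

Lemma diag_exists (d : nat -> L) : exists f : {linear dsum V -> dsum V},
  forall x k, co (f x) k = d k * co x k.
Proof.
apply: linear_of_coef => [a x y k|x]; first by rewrite coP; ring.
by have [n hn] := co_fin x; exists n => k nk; rewrite hn ?mulr0.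
Qed.

Section Relations.
Variables E F K Ki : {linear dsum V -> dsum V}.
Variable e : int -> {linear dsum V -> dsum V}.
Hypothesis coE : forall x k, co (E x) k = ec k * co x k.+1.
Hypothesis coF : forall x k, co (F x) k = if k is j.+1 then fc j * co x j else 0.
Hypothesis coK : forall x k, co (K x) k = ql b (- 1 - 2 * k%:Z) 1 * co x k.
Hypothesis coKi : forall x k, co (Ki x) k = ql b (1 + 2 * k%:Z) (-1) * co x k.
Hypothesis coe : forall n x k, co (e n x) k = (n == - 1 - 2 * k%:Z)%:R * co x k.

Lemma co_commutator x k : co (E (F x) - F (E x)) k =
  ((ql b (- 1 - 2 * k%:Z) 1 - ql b (1 + 2 * k%:Z) (-1)) / qdiff b) * co x k.
Proof.
rewrite coB coE coF -qint_vermaE coF.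
case: k => [|k]; first by rewrite -fc_ec subr0; ring.
by rewrite -!fc_ec coE; ring.
Qed.

Lemma ladder_Uq : Uq_relations E F K Ki.
Proof.
split.
- split=> x; apply: co_eq => k; rewrite !(coK, coKi) mulrA qlM.
    have -> : - 1 - 2 * k%:Z + (1 + 2 * k%:Z) = 0 by lia.
    by rewrite mul1r.
  have -> : 1 + 2 * k%:Z + (- 1 - 2 * k%:Z) = 0 by lia.
  by rewrite mul1r.
- move=> x; apply: co_eq => k; rewrite coZ !(coK, coE).
  have -> : ql b (-1 - 2 * k%:Z) 1 = ql b 2 0 * ql b (-1 - 2 * k.+1%:Z) 1.
    by rewrite qlM; congr (ql b _ _); lia.
  by ring.
- move=> x; apply: co_eq => -[|k]; rewrite coZ coK !coF ?coK; first by rewrite !mulr0.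
  have -> : ql b (-1 - 2 * k.+1%:Z) 1 = ql b (-2) 0 * ql b (-1 - 2 * k%:Z) 1.
    by rewrite qlM; congr (ql b _ _); lia.
  by ring.
move=> x; apply: co_eq => k; rewrite co_commutator coZ coB coK coKi.
by rewrite -[(ql b 1 0 - _)]/(qdiff b); ring.
Qed.

Lemma ladder_Udot : Udot_relations E F K e.
Proof.
split.
- move=> m n x; apply: co_eq => k; rewrite !coe.
  case: (eqVneq m n) => [->|mn]; first by rewrite coe; case: eqP; rewrite ?mul1r ?mul0r.
  by rewrite co0; case: eqP => [<-|_]; rewrite ?mul0r// eq_sym (negPf mn) mul0r mulr0.
- move=> n x; split; apply: co_eq => k; rewrite coZ ?(coK, coe) ?(coK, coe);
    by case: eqP => [->|_]; rewrite ?mul0r ?mul1r ?mulr0.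
- move=> n x; apply: co_eq => k; rewrite !(coE, coe).
  have -> : (n + 2 == -1 - 2 * k%:Z) = (n == -1 - 2 * k.+1%:Z).
    by apply/eqP/eqP; lia.
  by rewrite mulrCA.
- move=> n x; apply: co_eq => -[|k]; rewrite !(coe, coF); first by rewrite mulr0.
  have -> : (n - 2 == -1 - 2 * k.+1%:Z) = (n == -1 - 2 * k%:Z).
    by apply/eqP/eqP; lia.
  by rewrite mulrCA.
move=> n x; apply: co_eq => k; rewrite co_commutator coZ coe.
case: eqP => [->|_]; last by rewrite !mul0r !mulr0.
by congr (_ / _ * _); congr (_ - ql b _ _); lia.
Qed.

(** Distinct weights differ by an invertible series, a monomial times some 1 - q^j. *)
Lemma ql_sub_reg (m n c : int) (f : L) : m != n -> ql b m c * f = ql b n c * f -> f = 0.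
Proof.
wlog mn : m n / m < n => [hw|_].
  move=> ne; case: (ltrP m n) => [lt|]; first exact: hw.
  by rewrite le_eqVlt eq_sym (negPf ne) /= => lt /esym; apply: hw => //; rewrite eq_sym.
have [j nE] : exists j : nat, n = m + j.+1%:Z by exists (absz (n - m - 1)%R); lia.
move=> /eqP; rewrite -subr_eq0 -mulrBl => /eqP.
have -> : ql b m c - ql b n c = ql b m c * (1 - ql b j.+1%:Z 0).
  by rewrite mulrBr mulr1 qlM addr0 nE.
have u : ql b m c * (1 - ql b j.+1%:Z 0) \is a GRing.unit.
  by rewrite unitrM ql_unit one_sub_q_unit.
by move=> h; apply: (mulrI u); rewrite h mulr0.
Qed.

Lemma ladder_weights : weight_projections K e.
Proof.
split=> [n x Kx|x].
  apply: co_eq => k; rewrite coe; case: eqP => [_|/eqP nk]; first by rewrite mul1r.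
  rewrite mul0r; apply/esym/(@ql_sub_reg n (-1 - 2 * k%:Z) 1) => //.
  by rewrite -coZ -Kx coK.
have [N hN] := co_fin x; pose s := [seq -1 - 2 * k%:Z | k <- iota 0 N].
exists s; first by rewrite map_inj_uniq ?iota_uniq// => i j; lia.
apply: co_eq => k; rewrite co_sum big_map.
have wE (j : nat) : (-1 - 2 * j%:Z == -1 - 2 * k%:Z) = (j == k) by apply/eqP/eqP; lia.
under eq_bigr => j _ do rewrite coe wE.
case: (ltnP k N) => [kN|/hN k0].
  by rewrite (bigD1_seq k) ?iota_uniq ?mem_iota//= eqxx mul1r big1 ?addr0// => j /negPf ->; rewrite mul0r.
by rewrite k0 big1// => j _; rewrite mulr0.
Qed.

End Relations.

(** ** Comparison with the Verma module *)
Variable a : nat -> QL.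
Hypothesis a_unit : forall k, a k \is a GRing.unit.
Hypothesis a_F : forall k, inclb (fc k) * a k.+1 = qint false k.+1%:Z * a k.
Hypothesis a_E : forall k, inclb (ec k) * a k = vermaE false k * a k.+1.

(** The map that sends the k-th coordinate line to the k-th weight line, with the scaling
factors a k; the two recursions on a say that it intertwines F and E. *)
Definition to_verma (x : dsum V) : verma :=
  \sum_(k < projT1 (cid (co_fin x))) (inclb (co x k) * a k) *: vm k.

Lemma to_vermaE x n : (forall k, (n <= k)%N -> co x k = 0) ->
  to_verma x = \sum_(k < n) (inclb (co x k) * a k) *: vm k.
Proof.
rewrite /to_verma; case: (cid _) => m /= hm hn.
wlog mn : m n hm hn / (m <= n)%N.
  by move=> hw; case: (leqP m n) => [|/ltnW] h; [exact: hw|rewrite (hw n m)].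
rewrite -[RHS](big_mkord xpredT (fun k => (inclb (co x k) * a k) *: vm k)).
rewrite (big_cat_nat (n := m)) //= big_mkord [X in _ = _ + X]big_nat.
rewrite [X in _ = _ + X]big1 ?addr0// => k /andP[mk _].
by rewrite hm// rmorph0 mul0r scale0r.
Qed.

Lemma co_bound2 x y : exists n, (forall k, (n <= k)%N -> co x k = 0) /\
  (forall k, (n <= k)%N -> co y k = 0).
Proof.
have [n hn] := co_fin x; have [m hm] := co_fin y.
by exists (n + m)%N; split=> k nk; [apply: hn|apply: hm]; lia.
Qed.

Lemma to_verma_semilinear c x y :
  to_verma (c *: x + y) = inclb c *: to_verma x + to_verma y.
Proof.
have [n [hx hy]] := co_bound2 x y.
rewrite (to_vermaE hx) (to_vermaE hy) (to_vermaE (n := n)); last first.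
  by move=> k nk; rewrite coP hx// hy// mulr0 addr0.
rewrite scaler_sumr -big_split; apply: eq_bigr => k _ /=.
by rewrite scalerA -scalerDl coP rmorphD rmorphM /= mulrDl !mulrA.
Qed.

Lemma coeff_vm_sum n (c : nat -> QL) j :
  coeff j (\sum_(k < n) c k *: vm k) = if (j < n)%N then c j else 0.
Proof.
rewrite raddf_sum /=.
under eq_bigr => k _ do rewrite coeffZ coeffU mul1r.
case: ltnP => jn.
  rewrite (bigD1 (Ordinal jn))//= eqxx mulr1 big1 ?addr0// => k kj.
  have /negPf -> : (k : nat) != j by apply: contraNneq kj => e; apply/eqP/val_inj.
  by rewrite mulr0.
rewrite big1// => k _.
have /negPf -> : (k : nat) != j by apply/eqP => e; have := ltn_ord k; rewrite e ltnNge jn.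
by rewrite mulr0.
Qed.

Lemma coeff_to_verma x k : coeff k (to_verma x) = inclb (co x k) * a k.
Proof.
have [n hn] := co_fin x; rewrite (to_vermaE hn).
rewrite (coeff_vm_sum n (fun k => inclb (co x k) * a k)).
by case: ltnP => // /hn ->; rewrite rmorph0 mul0r.
Qed.

Lemma to_verma_inj : injective to_verma.
Proof.
move=> x y e; apply: co_eq => k; apply: inclb_inj; apply: (mulIr (a_unit k)).
by rewrite -!coeff_to_verma e.
Qed.

Lemma to_verma_dinj k (v : V k) : to_verma (dinj v) = (inclb (chi v) * a k) *: vm k.
Proof.
apply/eqP/freeg_eqP => j; rewrite coeff_to_verma co_dinj coeffZ coeffU mul1r.
move: (chi v) => c; case: eqP => [->|_]; first by rewrite mulr1.
by rewrite rmorph0 mul0r mulr0.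
Qed.

Lemma to_verma_of_sum n (c : nat -> L) : exists x : dsum V,
  to_verma x = \sum_(k < n) (inclb (c k) * a k) *: vm k.
Proof.
have cf k : (n <= k)%N -> (if (k < n)%N then c k else 0) = 0 by rewrite ltnNge => ->.
exists (@of_co (fun k => if (k < n)%N then c k else 0) n cf); rewrite (to_vermaE (n := n)).
  by apply: eq_bigr => k _; rewrite co_of_co ltn_ord.
by move=> k nk; rewrite co_of_co cf.
Qed.

Lemma verma_linear_sum (f : nat -> verma) n (c : nat -> QL) :
  fglift f (\sum_(k < n) c k *: vm k) = \sum_(k < n) c k *: f k.
Proof. by rewrite linear_sum; apply: eq_bigr => k _; rewrite linearZ /= fglift1. Qed.

Section Intertwining.
Variables E F K : {linear dsum V -> dsum V}.
Variable e : int -> {linear dsum V -> dsum V}.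
Hypothesis coE : forall x k, co (E x) k = ec k * co x k.+1.
Hypothesis coF : forall x k, co (F x) k = if k is j.+1 then fc j * co x j else 0.
Hypothesis coK : forall x k, co (K x) k = ql b (- 1 - 2 * k%:Z) 1 * co x k.
Hypothesis coe : forall n x k, co (e n x) k = (n == - 1 - 2 * k%:Z)%:R * co x k.

Lemma to_verma_F : intertwines to_verma F verma_F.
Proof.
move=> x; have [n hn] := co_fin x.
rewrite (to_vermaE hn) (to_vermaE (n := n.+1)); last first.
  by move=> [//|k] nk; rewrite coF hn ?mulr0.
rewrite /verma_F (verma_linear_sum _ _ (fun k => inclb (co x k) * a k)) big_ord_recl.
rewrite coF rmorph0 mul0r scale0r add0r; apply: eq_bigr => k _.
rewrite coF rmorphM /= scalerA; congr (_ *: _).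
by rewrite -[qnum _]/(qint false k.+1%:Z) -[RHS]mulrA [a k * _]mulrC -a_F; ring.
Qed.

Lemma to_verma_E : intertwines to_verma E (verma_E (-1)).
Proof.
move=> x; have [n hn] := co_fin x.
have hn1 k : (n.+1 <= k)%N -> co x k = 0 by move=> nk; apply: hn; lia.
rewrite (to_vermaE hn1) (to_vermaE (n := n)); last first.
  by move=> k nk; rewrite coE hn ?mulr0//; lia.
rewrite /verma_E (verma_linear_sum _ _ (fun k => inclb (co x k) * a k)) big_ord_recl.
rewrite scaler0 add0r; apply: eq_bigr => k _.
rewrite coE rmorphM /= scalerA; congr (_ *: _).
set c := (X in _ = _ * X); have -> : c = vermaE false k.
  rewrite /c /mu ql_invE !qlM -[ql false 1 0 - _]/(qdiff false) /vermaE.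
  by congr ((ql _ _ _ - ql _ _ _) / _); rewrite /= /bump leq0n; lia.
by rewrite -[RHS]mulrA [a _ * _]mulrC -a_E; ring.
Qed.


Lemma to_verma_K : intertwines to_verma K (verma_K (-1)).
Proof.
move=> x; have [n hn] := co_fin x.
rewrite (to_vermaE hn) (to_vermaE (n := n)); last first.
  by move=> k nk; rewrite coK hn ?mulr0.
rewrite /verma_K (verma_linear_sum _ _ (fun k => inclb (co x k) * a k)).
apply: eq_bigr => k _; rewrite coK rmorphM /= inclb_ql scalerA /mu qlM; congr (_ *: _).
have -> : -1 + -2 * k%:Z = -1 - 2 * k%:Z by lia.
by rewrite addr0 -mulrA mulrC.
Qed.

Lemma to_verma_e n : intertwines to_verma (e n) (verma_e (-1) n).
Proof.
move=> x; have [m hm] := co_fin x.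
rewrite (to_vermaE hm) (to_vermaE (n := m)); last first.
  by move=> k mk; rewrite coe hm ?mulr0.
rewrite /verma_e (verma_linear_sum _ _ (fun k => inclb (co x k) * a k)).
apply: eq_bigr => k _; rewrite coe; case: eqP => _; first by rewrite mul1r.
by rewrite mul0r rmorph0 mul0r scale0r scaler0.
Qed.

End Intertwining.

End Ladder.

(** * The action on a Grothendieck group *)

(** Omega_0 is the field of rationals. *)
Lemma ch_Omega0 b : ch b (gOmega 0) = 1.
Proof.
have augm : @is_gmor 0 (gOmega 0) (gsimple 0) (fun f => aug (f : Omega 0) : rat).
  split=> [r x y|d p x hx]; first by rewrite augD augM.
  case: (eqVneq (aug (x : Omega 0)) 0) => [->|x0]; first by left.
  right; have [|<- <-] := hx finset.set0 0%MM; first by rewrite mcoeff_msupp.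
  rewrite /mon_deg cards0 big_set0 subr0 muln0 /=; split=> //.
  by congr (_, _); rewrite big_ord0.
have OS : giso (gOmega 0) (gsimple 0).
  exists (fun f => aug (f : Omega 0) : rat) => //.
  exists (fun c : rat => Oconst 0 c) => [f|c]; last exact: aug_const.
  apply/ffunP => U; have -> : U = finset.set0 by apply/setP => -[].
  rewrite ffunE eqxx; apply/mpolyP => m; have -> : m = 0%MM by apply/mnmP => -[].
  by rewrite mcoeffC eqxx mulr1.
rewrite -(ch_giso (Omega_admissible 0 b) OS).
apply: laurent_eq => d; rewrite chE; last exact: simple_admissible.
rewrite !(gdimP (simple_has_dim _ _ _)) andbF subr0 andbT.
by rewrite -[RHS]/((d == 0)%:R : rat).
Qed.

Lemma ch_Omega_unit k : ch false (gOmega k) \is a GRing.unit.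
Proof.
elim: k => [|k IH]; first by rewrite ch_Omega0 unitr1.
have := unitrM (coefF false k) (ch false (gOmega k)).
by rewrite -ch_Omega_rec coefF_unit IH unitrM => /andP[].
Qed.

Lemma incl_inclb (f : AL) : incl f = inclb f.
Proof. exact: laurent_eq. Qed.

Lemma inclb_id (f : QL) : inclb f = f.
Proof. exact: laurent_eq. Qed.

Section CategoryAction.
Variables (b : bool) (C : gcat b) (w fc ec : nat -> laurent b rat).
Hypothesis w_unit : forall k, inclb (w k) \is a GRing.unit.
Hypothesis obj_admissible : forall k (M : gsmod k), gobj C M -> admissible b M.
Hypothesis exact_ses : forall k (M1 M M2 : gsmod k),
  gexact C M1 M M2 -> short_exact M1 M M2.
Hypothesis series_ch : forall k (M : gsmod k), gobj C M -> spec (gseries C M) * w k = ch b M.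
Hypothesis obj_giso : forall k (M N : gsmod k), giso M N -> gobj C M -> gobj C N.
Hypothesis obj_shift : forall k c (M : gsmod k), gobj C M -> gobj C (gshift c M).
Hypothesis obj_F : forall k (M : gsmod k) N, gobj C M -> functorF M N -> gobj C N.
Hypothesis obj_E : forall k (M : gsmod k.+1) N, gobj C M -> functorE M N -> gobj C N.
Variable G : forall k, gsmod k.
Hypothesis G_obj : forall k, gobj C (G k).
Hypothesis G_series : forall k M, giso (G k) M -> gseries C M = 1.
Hypothesis fc_w : forall k, fc k * w k.+1 = coefF b k * w k.
Hypothesis ec_w : forall k, ec k * w k = coefE b k * w k.+1.

Lemma w_reg k f : f * w k = 0 -> f = 0.
Proof.
move=> /(congr1 (@inclb b)); rewrite rmorphM rmorph0 /= => e.
apply: inclb_inj; rewrite rmorph0; apply: (mulIr (w_unit k)).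
by rewrite mul0r.
Qed.

Lemma w_cancel k f h : f * w k = h * w k -> f = h.
Proof. by move=> /eqP; rewrite -subr_eq0 -mulrBl => /eqP/w_reg/eqP; rewrite subr_eq0 => /eqP. Qed.

Notation V := (fun k => groth_at C k).
Notation chi := (fun k => @gchar b C k).

Let chi_linear k : linear (@gchar b C k).
Proof. exact: (gchar_linear (@w_reg k) (@obj_admissible k) (@exact_ses k) (@series_ch k)). Qed.

Lemma chi_class k (M : gsmod k) : gobj C M -> gchar (class_at C M) * w k = ch b M.
Proof.
exact: (gchar_class (@w_reg k) (@obj_admissible k) (@exact_ses k) (@series_ch k) (@obj_giso k)).
Qed.

Let gens : exists g : forall k, groth_at C k,
  forall k, gchar (g k) = 1 /\ forall z, z = gchar z *: g k.
Proof.
have ex k := groth_generator (@w_reg k) (@obj_admissible k) (@exact_ses k) (@series_ch k)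
  (@obj_giso k) (@G_obj k) (@G_series k).
by exists (fun k => projT1 (cid (ex k))) => k; case: (cid _).
Qed.

Let fc_ec k : fc k * ec k = qint b k.+1%:Z * vermaE b k.
Proof.
apply: (@w_cancel k); rewrite -mulrA ec_w mulrCA fc_w mulrA; congr (_ * _).
by rewrite /coefE -coefF_vermaE; move: (qint b _) (coefF b k) => Q c; ring.
Qed.

(** The factor that turns the coordinate ch M / w into ch M / ch Omega_k. *)
Definition normal k : QL := inclb (w k) / ch false (gOmega k).

Let normal_unit k : normal k \is a GRing.unit.
Proof. by rewrite /normal unitrM unitrV w_unit ch_Omega_unit. Qed.

Let coefF_Omega k : coefF false k / ch false (gOmega k.+1) =
  qint false k.+1%:Z / ch false (gOmega k).
Proof.
apply: (mulIr (ch_Omega_unit k.+1)); rewrite mulrVK ?ch_Omega_unit//.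
apply: (mulIr (ch_Omega_unit k)); rewrite -ch_Omega_rec.
move: (qint _ _) (ch_Omega_unit k) => Q u.
rewrite [in RHS]mulrAC mulrVK//.
Qed.

Let normal_F k : inclb (fc k) * normal k.+1 = qint false k.+1%:Z * normal k.
Proof.
rewrite /normal mulrA -rmorphM fc_w rmorphM /= inclb_coefF.
rewrite mulrAC coefF_Omega; move: (qint _ _) (_^-1) => Q u; ring.
Qed.

Let normal_E k : inclb (ec k) * normal k = vermaE false k * normal k.+1.
Proof.
rewrite /normal mulrA -rmorphM ec_w rmorphM /= inclb_coefE -coefF_vermaE.
rewrite /coefE; have := coefF_Omega k.
move: (qint _ _) (coefF _ _) (_^-1) (_^-1) => Q c v u e.
transitivity (ql false (2 * k%:Z + 2) (-1) * inclb (w k.+1) * (Q * v)); first by ring.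
by rewrite -e; ring.
Qed.

(** The common form of the three parts of the theorem: w is the factor between multiplicity
series and characters, G a module with multiplicity series 1, and fc, ec are the
coefficients of F and E on the classes of the modules G. *)
Lemma category_action :
  exists (E F K Ki : {linear groth C -> groth C})
         (e : int -> {linear groth C -> groth C}),
  [/\ functorial_action E F K, Uq_relations E F K Ki,
      Udot_relations E F K e /\ weight_projections K e &
      exists phi : groth C -> verma,
      [/\ (forall a x y, phi (a *: x + y) = inclb a *: phi x + phi y) /\ injective phi,
          forall n (c : nat -> laurent b rat), exists x,
            phi x = \sum_(k < n) inclb (c k) *: (normal k *: vm k),
          forall x, exists n (c : nat -> laurent b rat),
            phi x = \sum_(k < n) inclb (c k) *: (normal k *: vm k),
          [/\ intertwines phi E (verma_E (-1)), intertwines phi F verma_F,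
              intertwines phi K (verma_K (-1)) &
              forall n, intertwines phi (e n) (verma_e (-1) n)] &
          forall k (M : gsmod k), gobj C M ->
            phi (gclass C M) = (ch false M / ch false (gOmega k)) *: vm k]].
Proof.
have [g hg] := gens; pose gchi k : gchar (g k) = 1 := (hg k).1.
pose gK k (z : groth_at C k) : z = gchar z *: g k := (hg k).2 z.
have [E coE] := opE_exists chi_linear gchi gK ec.
have [F coF] := opF_exists chi_linear gchi gK fc.
have [K coK] := diag_exists chi_linear gchi gK (fun k => ql b (- 1 - 2 * k%:Z) 1).
have [Ki coKi] := diag_exists chi_linear gchi gK (fun k => ql b (1 + 2 * k%:Z) (-1)).
have [e coe] : exists e : int -> {linear groth C -> groth C},
    forall n x k, co chi (e n x) k = (n == - 1 - 2 * k%:Z)%:R * co chi x k.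
  have ex n := diag_exists chi_linear gchi gK (fun k => (n == - 1 - 2 * k%:Z)%:R).
  by exists (fun n => projT1 (cid (ex n))) => n; case: (cid _).
have ceq := co_eq gK.
exists E, F, K, Ki, e; split.
- split.
  + move=> k M oM; split=> [|N fN]; first exact: functorF_exists.
    have oN := obj_F oM fN; split=> //; apply: ceq => j.
    have [_ cN] := functorF_ch (obj_admissible oM) fN.
    have eN : gchar (class_at C N) = fc k * gchar (class_at C M).
      apply: (@w_cancel k.+1); rewrite chi_class// cN -(chi_class oM) [in RHS]mulrAC fc_w.
      by rewrite -[RHS]mulrA [w k * _]mulrC.
    rewrite coF; case: j => [|j]; rewrite !(co_dinj chi_linear) ?eN// eqSS.
    by case: eqP => [<-//|_]; rewrite mulr0.
  + move=> k M oM; split=> [|N fN]; first exact: functorE_exists.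
    have oN := obj_E oM fN; split=> //; apply: ceq => j.
    have [_ cN] := functorE_ch (obj_admissible oM) fN.
    have eN : gchar (class_at C N) = ec k * gchar (class_at C M).
      apply: (@w_cancel k); rewrite chi_class// cN -(chi_class oM) [in RHS]mulrAC ec_w.
      by rewrite -[RHS]mulrA [w k.+1 * _]mulrC.
    rewrite coE !(co_dinj chi_linear) eN eqSS.
    by case: eqP => [<-//|_]; rewrite mulr0.
  + move=> M oM; apply: ceq => j.
    by rewrite coE (co_dinj chi_linear) mulr0 (co0 chi_linear).
  + move=> k M oM; apply: ceq => j.
    have eN : gchar (class_at C (gshift (- 2 * k%:Z - 1, 1) M)) =
        ql b (- 1 - 2 * k%:Z) 1 * gchar (class_at C M).
      apply: (@w_cancel k); rewrite chi_class; last exact: obj_shift.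
      rewrite ch_shift; last exact: obj_admissible.
      rewrite -[RHS]mulrA chi_class//; congr (_ * _).
      by congr (lmon b rat (_, _)); lia.
    rewrite coK !(co_dinj chi_linear) eN.
    by case: eqP => [<-//|_]; rewrite mulr0.
  move=> k x; apply: ceq => j; rewrite coK (coZ chi_linear) (co_dinj chi_linear).
  by case: eqP => [<-//|_]; rewrite !mulr0.
- exact: (ladder_Uq chi_linear gK fc_ec coE coF coK coKi).
- split; first exact: (ladder_Udot chi_linear gK fc_ec coE coF coK coe).
  exact: (ladder_weights chi_linear gK coK coe).
exists (to_verma chi_linear normal); split.
- split=> [a x y|]; first exact: to_verma_semilinear.
  exact: (to_verma_inj gK normal_unit).
- move=> n c; have [x xE] := to_verma_of_sum chi_linear gchi normal n c.
  by exists x; rewrite xE; apply: eq_bigr => k _; rewrite scalerA.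
- move=> x; have [n hn] := co_fin chi_linear x; exists n, (co chi x).
  by rewrite (to_vermaE _ _ hn); apply: eq_bigr => k _; rewrite scalerA.
- split.
  + exact: (to_verma_E chi_linear normal_E coE).
  + exact: (to_verma_F chi_linear normal_F coF).
  + exact: (to_verma_K chi_linear normal coK).
  exact: (to_verma_e chi_linear normal coe).
move=> k M oM; rewrite /gclass to_verma_dinj; congr (_ *: _).
rewrite /normal mulrA -rmorphM chi_class//= inclb_ch//; exact: obj_admissible.
Qed.

End CategoryAction.

(** * The three categories *)

Lemma spec_gseries b (C : gcat b) k (M : gsmod k) :
  laurent_supp b (fun d => exists p, gmult C M d p <> 0%N) ->
  spec (gseries C M) = index_series b (gmult C M).
Proof.
move=> sM; apply: laurent_eq => d.
rewrite -[LHS]/(Zpi_spec (gseries C M d)) !mk_laurentE ?Zpi_spec_mult//.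
  apply: laurent_supp_sub sM => e h; apply: contrapT => ne; apply: h.
  have z p : gmult C M e p = 0%N by apply: contrapT => h; apply: ne; exists p.
  by rewrite !z subrr.
apply: laurent_supp_sub sM => e h; apply: contrapT => ne; apply: h.
have z p : gmult C M e p = 0%N by apply: contrapT => h; apply: ne; exists p.
by rewrite !z mul0r addr0.
Qed.

Lemma gseries1 b (C : gcat b) k (M : gsmod k) :
  (forall d p, gmult C M d p = (d == 0) && ~~ p :> nat) -> gseries C M = 1.
Proof.
move=> hM; apply: laurent_eq => d; rewrite mk_laurentE.
  by rewrite !hM andbF mul0r addr0 andbT.
apply: laurent_supp_sub (laurent_supp1 b 0) => e; rewrite !hM andbF mul0r addr0 andbT.
by case: eqP.
Qed.

Lemma simple_mult_series b (C : gcat b) k (M : gsmod k) : gmult C M = simple_mult M ->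
  admissible b M -> spec (gseries C M) = ch b M.
Proof.
move=> CM [lf sM]; have mE d p : gmult C M d p = gdim M d p by rewrite CM simple_multE.
rewrite spec_gseries.
  by congr (index_series b _); apply/funext => d; apply/funext => p; rewrite mE.
apply: laurent_supp_sub sM => d [p]; rewrite mE => h; apply: contrapT => nd; apply: h.
exact: not_gsupp_gdim.
Qed.

Lemma simple_mult_simple b (C : gcat b) k (M : gsmod k) : gmult C M = simple_mult M ->
  giso (gsimple k) M -> gseries C M = 1.
Proof.
move=> CM SM; have [lf _] := simple_admissible k false; apply: gseries1 => d p.
have [lM _] := giso_admissible SM (simple_admissible k false).
by rewrite CM simple_multE// (giso_gdim _ _ SM)// (gdimP (simple_has_dim _ _ _)).
Qed.

Lemma free_decomp_giso k (P Q : gsmod k) m : giso P Q -> free_decomp P m -> free_decomp Q m.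
Proof.
move=> [f fm fb] [iota [im isp ii]]; exists (fun i x => f (iota i x)).
have fB := gmorB fm; have finj := bij_inj fb; have [f' f'K fK] := fb.
split=> [i|x|s c us].
- by split=> [r x y|d p x hx]; [rewrite (im i).1 fm.1|apply/fm.2/(im i).2].
- have [s [c e]] := isp (f' x); exists s, c; rewrite -[x]fK e.
  by elim: s {e} => [|i s IH]; rewrite ?big_nil ?(morph0 fB)// !big_cons (morphD fB) IH.
move=> h; apply: ii => //; apply: finj; rewrite (morph0 fB) -h.
elim: s {us h} => [|i s IH]; rewrite ?big_nil ?(morph0 fB)// !big_cons (morphD fB).
by rewrite IH.
Qed.

Lemma free_multP k (P : gsmod k) : admissible true P -> projective P ->
  free_decomp P (free_mult P).
Proof.
move=> aP pP; have [m hm] := psmod_free_decomp aP pP.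
by rewrite /free_mult; case: xgetP => [n _ //|/(_ m)].
Qed.

(** ** The dual canonical basis *)
(** Both sides satisfy the same recursion, by [ch_Omega_rec]. *)
Lemma vmd_Omega k : vmd (-1) k = (ch false (gOmega k))^-1 *: vm k.
Proof.
rewrite /vmd; congr (_ *: _); elim: k => [|k IH].
  by rewrite big_geq// ch_Omega0 invr1.
rewrite big_nat_recr //= IH.
apply: (mulIr (ch_Omega_unit k.+1)); rewrite mulVr ?ch_Omega_unit//.
set X := qnum _ * _ / _; have XE : X * coefF false k = qint false k.+1%:Z.
  have -> : coefF false k = ql false (- (2 * k%:Z + 2)) 1 * vermaE false k.
    by rewrite -coefF_vermaE mulrA qlM addNr ql00 mul1r.
  have mE : mu (-1) = ql false (-1) 1 by [].
  rewrite /X mE ql_invE !qlM -[ql false 1 0 - _]/(qdiff false).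
  have -> : -1 + (1 - 2 * k.+1%:Z) = - (2 * k%:Z + 2) by lia.
  have -> : -1 + (1 - k.+1%:Z) = -1 - k%:Z by lia.
  have -> : - -1 + (k.+1%:Z - 1) = k%:Z + 1 by lia.
  rewrite !addr0.
  have vE : ql false (-1 - k%:Z) 1 - ql false (k%:Z + 1) (-1) = vermaE false k * qdiff false.
    by rewrite /vermaE mulrVK// qdiff_unit.
  rewrite vE -[qnum _]/(qint false k.+1%:Z).
  have vu : vermaE false k \is a GRing.unit.
    rewrite -coefF_vermaE unitrM ql_unit; exact: coefF_unit.
  have := qdiff_unit false; move: vu (ql_unit false (- (2 * k%:Z + 2)) 1).
  move: (qdiff false) (vermaE false k) (qint _ _) (ql _ _ _) => D v Q l vu lu Du.
  have u : l * (v * D) \is a GRing.unit by rewrite !unitrM lu vu.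
  by rewrite -[RHS](mulrK u); ring.
have cu := coefF_unit k; apply: (mulIr cu).
have ou := ch_Omega_unit k; rewrite mul1r.
transitivity ((ch false (gOmega k))^-1 * (X * coefF false k) * ch false (gOmega k.+1)).
  by move: (coefF _ _) (_^-1) => c u; ring.
rewrite XE -mulrA ch_Omega_rec mulrCA mulVr// mulr1; by [].
Qed.

Lemma A_iso_of (C : gcat true) (w : nat -> AL) (v : nat -> verma) (phi : groth C -> verma) :
  (forall k, v k = normal w k *: vm k) ->
  (forall a x y, phi (a *: x + y) = inclb a *: phi x + phi y) /\ injective phi ->
  (forall n (c : nat -> AL), exists x,
     phi x = \sum_(k < n) inclb (c k) *: (normal w k *: vm k)) ->
  (forall x, exists n (c : nat -> AL),
     phi x = \sum_(k < n) inclb (c k) *: (normal w k *: vm k)) ->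
  A_iso_onto (A_span v) phi.
Proof.
move=> vE [phiL phi_inj] h1 h2; split=> // [a x y|u]; first by rewrite incl_inclb.
split=> [[n [c ->]]|[x <-]].
  have [x xE] := h1 n c; exists x; rewrite xE.
  by apply: eq_bigr => k _; rewrite incl_inclb vE.
have [n [c ->]] := h2 x; exists n, c.
by apply: eq_bigr => k _; rewrite incl_inclb vE.
Qed.

Lemma normal_simple b k : @normal b (fun=> 1) k *: vm k = vmd (-1) k.
Proof. by rewrite vmd_Omega /normal rmorph1 mul1r. Qed.

Lemma smod_lf_admissible k (M : gsmod k) : smod_lf M <-> admissible false M.
Proof. by split=> [[lf c]|[lf [c _]]]; split=> //; split. Qed.

Lemma smod_lf_lambda_admissible k (M : gsmod k) : smod_lf_lambda M <-> admissible true M.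
Proof.
by split=> [[[lf c] l]|[lf [c l]]]; [split|split; [|exact: l]].
Qed.

Lemma ch_simple b k : ch b (gsimple k) = 1.
Proof.
apply: laurent_eq => d; rewrite chE; last exact: simple_admissible.
rewrite !(gdimP (simple_has_dim _ _ _)) andbF subr0 andbT.
by rewrite -[RHS]/((d == 0)%:R : rat).
Qed.

Lemma verma_expand (v : verma) : exists n (c : nat -> QL), v = \sum_(k < n) c k *: vm k.
Proof.
exists (\max_(k <- dom v) k.+1)%N, (fun k => coeff k v); apply/eqP/freeg_eqP => j.
rewrite (coeff_vm_sum _ (fun k => coeff k v)); case: ltnP => // jn; rewrite coeff_outdom//.
apply/negP => jv; move: jn; rewrite leqNgt => /negP[].
exact: (@leq_bigmax_seq _ (dom v) xpredT (fun k => k.+1) j).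
Qed.

Theorem theorem6p12 :
  [/\
    exists (E F K Ki : {linear groth cat_K -> groth cat_K})
           (e : int -> {linear groth cat_K -> groth cat_K}),
      [/\ functorial_action E F K, Uq_relations E F K Ki,
          Udot_relations E F K e /\ weight_projections K e &
          exists phi : groth cat_K -> verma,
          [/\ A_iso_onto (A_span vm) phi,
              intertwines phi E (verma_E (-1)) /\ intertwines phi F verma_F,
              intertwines phi K (verma_K (-1)) /\
                (forall n, intertwines phi (e n) (verma_e (-1) n)) &
              forall k, phi (gclass cat_K (gOmega k)) = vm k]],
    exists (E F K Ki : {linear groth cat_G -> groth cat_G})
           (e : int -> {linear groth cat_G -> groth cat_G}),
      [/\ functorial_action E F K, Uq_relations E F K Ki,
          Udot_relations E F K e /\ weight_projections K e &
          exists phi : groth cat_G -> verma,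
          [/\ A_iso_onto (A_span (vmd (-1))) phi,
              intertwines phi E (verma_E (-1)) /\ intertwines phi F verma_F,
              intertwines phi K (verma_K (-1)) /\
                (forall n, intertwines phi (e n) (verma_e (-1) n)) &
              forall k, phi (gclass cat_G (gsimple k)) = vmd (-1) k]] &
    exists (E F K Ki : {linear groth cat_Ghat -> groth cat_Ghat}),
      [/\ functorial_action E F K, Uq_relations E F K Ki &
          exists phi : {linear groth cat_Ghat -> verma},
          [/\ bijective phi,
              intertwines phi E (verma_E (-1)) /\ intertwines phi F verma_F,
              intertwines phi K (verma_K (-1)),
              forall k, phi (gclass cat_Ghat (gOmega k)) = vm k &
              forall k, phi (gclass cat_Ghat (gsimple k)) = vmd (-1) k]]].
Proof.
have K_adm k (M : gsmod k) : gobj cat_K M -> admissible true M.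
  by move=> [/smod_lf_lambda_admissible].
have G_adm k (M : gsmod k) : gobj cat_G M -> admissible true M.
  by move=> /smod_lf_lambda_admissible.
have H_adm k (M : gsmod k) : gobj cat_Ghat M -> admissible false M.
  by move=> /smod_lf_admissible.
split.
- have w_unit k : inclb (ch true (gOmega k)) \is a GRing.unit.
    by rewrite inclb_ch; [exact: ch_Omega_unit|exact: Omega_admissible].
  have series k (M : gsmod k) : gobj cat_K M ->
      spec (gseries cat_K M) * ch true (gOmega k) = ch true M.
    move=> oM; have aM := K_adm _ _ oM; have dM := free_multP aM oM.2.
    rewrite spec_gseries -?(ch_free aM dM)//; exact: (free_decomp_supp aM dM).
  have K_giso k (M N : gsmod k) : giso M N -> gobj cat_K M -> gobj cat_K N.
    move=> MN oM; split; first exact/smod_lf_lambda_admissible/(giso_admissible MN)/K_adm.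
    exact: giso_projective MN oM.2.
  have K_shift k c (M : gsmod k) : gobj cat_K M -> gobj cat_K (gshift c M).
    move=> oM; split; first exact/smod_lf_lambda_admissible/shift_admissible/K_adm.
    exact: shift_projective oM.2.
  have K_F k (M : gsmod k) N : gobj cat_K M -> functorF M N -> gobj cat_K N.
    move=> oM fN; have aM := K_adm _ _ oM; split.
      by apply/smod_lf_lambda_admissible; have [] := functorF_ch aM fN.
    exact: functorF_projective aM oM.2 fN.
  have K_E k (M : gsmod k.+1) N : gobj cat_K M -> functorE M N -> gobj cat_K N.
    move=> oM fN; have aM := K_adm _ _ oM; split.
      by apply/smod_lf_lambda_admissible; have [] := functorE_ch aM fN.
    exact: functorE_projective aM oM.2 fN.
  have Omega_obj k : gobj cat_K (gOmega k).
    by split; [exact/smod_lf_lambda_admissible/Omega_admissible|exact: Omega_projective].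
  have Omega_series k M : giso (gOmega k) M -> gseries cat_K M = 1.
    move=> OM; apply: gseries1 => d p; have oM := K_giso _ _ _ OM (Omega_obj k).
    apply: free_decomp_Omega; apply: free_decomp_giso (giso_sym OM) _.
    exact: free_multP (K_adm _ _ oM) oM.2.
  have ec_w k : vermaE true k * ch true (gOmega k) = coefE true k * ch true (gOmega k.+1).
    by rewrite /coefE -[RHS]mulrA ch_Omega_rec -coefF_vermaE -[LHS]mulrA.
  have [E [F [K [Ki [e [h1 h2 h3 [phi [h4 h5 h6 [h7 h8 h9 h10] h11]]]]]]]] :=
    category_action w_unit K_adm (fun k => @split_short_exact k) series K_giso K_shift K_F K_E
      Omega_obj Omega_series (@ch_Omega_rec ^~ true) ec_w.
  exists E, F, K, Ki, e; split=> //; exists phi; split=> //.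
    apply: (A_iso_of _ h4 h5 h6) => k.
    by rewrite /normal inclb_ch ?mulrV ?scale1r// ?ch_Omega_unit//; exact: Omega_admissible.
  by move=> k; rewrite h11// mulrV ?scale1r// ch_Omega_unit.
- have w_unit (k : nat) : inclb (1 : AL) \is a GRing.unit by rewrite rmorph1 unitr1.
  have series k (M : gsmod k) : gobj cat_G M -> spec (gseries cat_G M) * 1 = ch true M.
    by move=> oM; rewrite mulr1 simple_mult_series//; exact: G_adm.
  have G_giso k (M N : gsmod k) : giso M N -> gobj cat_G M -> gobj cat_G N.
    by move=> MN oM; exact/smod_lf_lambda_admissible/(giso_admissible MN)/G_adm.
  have G_shift k c (M : gsmod k) : gobj cat_G M -> gobj cat_G (gshift c M).
    by move=> oM; exact/smod_lf_lambda_admissible/shift_admissible/G_adm.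
  have G_F k (M : gsmod k) N : gobj cat_G M -> functorF M N -> gobj cat_G N.
    by move=> oM fN; apply/smod_lf_lambda_admissible; have [] := functorF_ch (G_adm _ _ oM) fN.
  have G_E k (M : gsmod k.+1) N : gobj cat_G M -> functorE M N -> gobj cat_G N.
    by move=> oM fN; apply/smod_lf_lambda_admissible; have [] := functorE_ch (G_adm _ _ oM) fN.
  have simple_obj k : gobj cat_G (gsimple k).
    exact/smod_lf_lambda_admissible/simple_admissible.
  have simple_series k M : giso (gsimple k) M -> gseries cat_G M = 1.
    exact: simple_mult_simple.
  have [E [F [K [Ki [e [h1 h2 h3 [phi [h4 h5 h6 [h7 h8 h9 h10] h11]]]]]]]] :=
    category_action (w := fun=> 1) w_unit G_adm (fun k M1 M M2 h => h) series G_giso G_shift G_F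
      G_E simple_obj simple_series (fun k => erefl (coefF true k * 1))
      (fun k => erefl (coefE true k * 1)).
  exists E, F, K, Ki, e; split=> //; exists phi; split=> //.
    by apply: (A_iso_of _ h4 h5 h6) => k; rewrite normal_simple.
  by move=> k; rewrite h11// ch_simple mul1r vmd_Omega.
have w_unit (k : nat) : inclb (1 : QL) \is a GRing.unit by rewrite rmorph1 unitr1.
have series k (M : gsmod k) : gobj cat_Ghat M -> spec (gseries cat_Ghat M) * 1 = ch false M.
  by move=> oM; rewrite mulr1 simple_mult_series//; exact: H_adm.
have H_giso k (M N : gsmod k) : giso M N -> gobj cat_Ghat M -> gobj cat_Ghat N.
  by move=> MN oM; exact/smod_lf_admissible/(giso_admissible MN)/H_adm.
have H_shift k c (M : gsmod k) : gobj cat_Ghat M -> gobj cat_Ghat (gshift c M).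
  by move=> oM; exact/smod_lf_admissible/shift_admissible/H_adm.
have H_F k (M : gsmod k) N : gobj cat_Ghat M -> functorF M N -> gobj cat_Ghat N.
  by move=> oM fN; apply/smod_lf_admissible; have [] := functorF_ch (H_adm _ _ oM) fN.
have H_E k (M : gsmod k.+1) N : gobj cat_Ghat M -> functorE M N -> gobj cat_Ghat N.
  by move=> oM fN; apply/smod_lf_admissible; have [] := functorE_ch (H_adm _ _ oM) fN.
have simple_obj k : gobj cat_Ghat (gsimple k).
  exact/smod_lf_admissible/simple_admissible.
have simple_series k M : giso (gsimple k) M -> gseries cat_Ghat M = 1.
  exact: simple_mult_simple.
have Omega_obj k : gobj cat_Ghat (gOmega k) by exact/smod_lf_admissible/Omega_admissible.
have [E [F [K [Ki [e [h1 h2 h3 [phi [[phiL phi_inj] h5 h6 [h7 h8 h9 h10] h11]]]]]]]] :=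
  category_action (w := fun=> 1) w_unit H_adm (fun k M1 M M2 h => h) series H_giso H_shift H_F
    H_E simple_obj simple_series (fun k => erefl (coefF false k * 1))
    (fun k => erefl (coefE false k * 1)).
have phi_lin : linear phi by move=> a x y; rewrite phiL inclb_id.
pose Phi : {linear groth cat_Ghat -> verma} :=
  HB.pack phi (GRing.isLinear.Build QL (groth cat_Ghat) verma _ phi phi_lin).
exists E, F, K, Ki; split=> //; exists Phi; split=> //.
- have surj v : exists x, phi x = v.
    have [n [c ->]] := verma_expand v.
    have [x xE] := h5 n (fun k => c k / normal (b := false) (fun=> 1) k).
    exists x; rewrite xE; apply: eq_bigr => k _; rewrite inclb_id scalerA mulrVK//.
    by rewrite /normal rmorph1 mul1r unitrV ch_Omega_unit.
  have [psi psiK] := choice surj.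
  by exists psi => // x; apply: phi_inj; rewrite psiK.
- by move=> k; rewrite -[LHS]/(phi _) h11// mulrV ?scale1r// ch_Omega_unit.
by move=> k; rewrite -[LHS]/(phi _) h11// ch_simple mul1r vmd_Omega.
Qed.
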